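(* Let $(Z,J,\omega)$ be a compact connected Kähler manifold with a Hamiltonian action by Kähler isometries of a compact connected Lie subgroup $U\subset \mathrm{U}(n)$, and let $\mu:Z\to\mathfrak u^*$ be an $\mathrm{Ad}_U^*$-equivariant momentum map. Let $G\subseteq U^{\mathbb C}$ be a real compatible subgroup with Cartan decomposition $G=K\exp(\mathfrak p)$, $\mathfrak g=\mathfrak k\oplus\mathfrak p$, and let $\mu_{\mathfrak p}:Z\to\mathfrak p$ be the gradient map associated with $\mu$. Let $f:\mathfrak p\to\mathbb R$ be an $\mathrm{Ad}_K$-invariant, strictly convex function. Suppose that $z\in Z$ is a critical point of $f\circ\mu_{\mathfrak p}:Z\to\mathbb R$, and that $f$ admits a strictly convex, $\mathrm{Ad}_U$-invariant extension to $i\mathfrak u$ which is $(\mathfrak k,\mathfrak p)$-compatible at $\mu_{\mathfrak p}(z)$. Let $G_z$ and $K_z$ be the stabilizers of $z$ in $G$ and $K$, and let $G_z^o$, $K_z^o$ be their identity components. Then $$K_z^o=G_z^o\cap K,$$ and $K_z^o$ is a maximal compact subgroup of $G_z^o$.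
   Context: Setting. $(Z,J,\omega)$ is a compact connected Kähler manifold with complex structure $J$, symplectic form $\omega$ and Riemannian metric $Q(\cdot,\cdot)=\omega(\cdot,J\cdot)$. $U\subset\mathrm U(n)$ is a compact connected Lie subgroup with Lie algebra $\mathfrak u$, acting on $Z$ by Kähler isometries (preserving $J$, $\omega$, $Q$). Its complexification is $U^{\mathbb C}=\{\exp(i\eta)u : u\in U,\ \eta\in\mathfrak u\}\subseteq \mathrm{Gl}(n,\mathbb C)$, with Lie algebra $\mathfrak u^{\mathbb C}=\mathfrak u\oplus i\mathfrak u$; since $Z$ is compact the $U$-action extends to a holomorphic action of $U^{\mathbb C}$ on $Z$. For $\xi\in\mathfrak u^{\mathbb C}$, $\xi_Z(z)=\frac{d}{dt}\exp(t\xi).z|_{t=0}$. A momentum map is a map $\mu:Z\to\mathfrak u^*$ satisfying $\langle (d\mu)_z(v)|\xi\rangle=\omega_z(v,\xi_Z(z))$ for all $z\in Z$, $v\in T_zZ$, $\xi\in\mathfrak u$ (with $\langle\cdot|\cdot\rangle$ the canonical pairing), and it is $\mathrm{Ad}_U^*$-equivariant: $\mu(u.z)=\mathrm{Ad}_u^*\mu(z)$, where $\langle\mathrm{Ad}_u^*\alpha|\xi\rangle=\langle\alpha|\mathrm{Ad}_{u^{-1}}\xi\rangle$. The action is Hamiltonian if such a $\mu$ exists. A real compatible (= real reductive) subgroup $G\subseteq U^{\mathbb C}$ is a closed real subgroup with Lie algebra $\mathfrak g$ such that, with $K:=G\cap U$ (compact), $\mathfrak k:=\mathrm{Lie}(K)$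 and $\mathfrak p:=\mathfrak g\cap i\mathfrak u$, one has $G=K\exp(\mathfrak p)$ and $\mathfrak g=\mathfrak k\oplus\mathfrak p$. Inner product. $\langle\cdot,\cdot\rangle$ is the $\mathbb R$-bilinear $\mathrm{Ad}_U$-invariant Euclidean inner product on $\mathfrak u^{\mathbb C}$ for which $\mathfrak u\perp i\mathfrak u$, $\langle X,Y\rangle=-\mathrm{Re}\,\mathrm{Tr}(XY)$ for $X,Y\in\mathfrak u$, and $\langle X,Y\rangle=\mathrm{Re}\,\mathrm{Tr}(XY)$ for $X,Y\in i\mathfrak u$. The symbol $\#$ denotes the duality (covectors to vectors) induced by $\langle\cdot,\cdot\rangle$. Gradient map. For $\alpha\in\mathfrak u^*$ let $i\alpha\in(i\mathfrak u)^*$ be $\langle i\alpha|\xi\rangle=\langle\alpha|i\xi\rangle$, $\xi\in i\mathfrak u$. The gradient map is $\mu_{\mathfrak p}(z)=\pi(\#\, i\mu(z))$, with $\pi:\mathfrak u^{\mathbb C}\to\mathfrak p$ the $\langle\cdot,\cdot\rangle$-orthogonal projection. Equivalently, $\langle\mu_{\mathfrak p}(z),\xi\rangle=\langle\mu(z)|i\xi\rangle$ for all $\xi\in\mathfrak p$. Convexity and compatibility. Functions are smooth, and ''strictly convex'' means that the Hessian is positive definite at every point. A smooth $F:i\mathfrak u\to\mathbb R$ is $(\mathfrak k,\mathfrak p)$-compatible at $\zeta\in i\mathfrak u$ if the $\langle\cdot,\cdot\rangle$-symmetric endomorphism $\#(\mathrm H F)_\zeta:i\mathfrak u\to i\mathfrak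 u$, obtained from the Hessian $(\mathrm HF)_\zeta$ of $F$ at $\zeta$ (i.e. $\langle\#(\mathrm HF)_\zeta a,b\rangle=(\mathrm HF)_\zeta(a,b)$), satisfies $\#(\mathrm HF)_\zeta(\mathfrak p)\subseteq\mathfrak p$ and $\#(\mathrm HF)_\zeta(i\mathfrak k)\subseteq i\mathfrak k$. *)

(* Defs.v *)
(* MathComp-Analysis, over an arbitrary R : realType.  Complex numbers are
   R[i] (real-closed); complex m-space is 'rV[R]_(m + m), with first block the
   real parts and second block the imaginary parts. *)
From HB Require Import structures.
From mathcomp Require Import all_boot all_order all_algebra spectral.
From mathcomp Require Import complex.
From mathcomp Require Import all_classical all_reals all_analysis.
Import Order.TTheory GRing.Theory Num.Theory numFieldNormedType.Exports.

Set Implicit Arguments.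
Unset Strict Implicit.
Unset Printing Implicit Defensive.

Local Open Scope classical_set_scope.
Local Open Scope ring_scope.
Local Open Scope complex_scope.

(* The usual topology of C; matrices over R[i] then carry the entrywise one. *)
HB.instance Definition _ (R : realType) := NormedModule.copy R[i] R[i]^o.

Section Smoothness.
Variables (R : realType) (V W : normedModType R).

(* Meant for A open and V finite-dimensional, where requiring all directional
   derivatives to be again of class C^k is the usual notion. *)
Fixpoint Ck (k : nat) (A : set V) (f : V -> W) : Prop :=
  match k with
  | 0 => forall x, A x -> {for x, continuous f}
  | k'.+1 => (forall x, A x -> differentiable f x) /\
             (forall v, Ck k' A (fun x => 'D_v f x))
  end.

Definition smooth_on (A : set V) (f : V -> W) : Prop := forall k, Ck k A f.

End Smoothness.

Section MatrixGroups.
Variables (R : realType) (n : nat).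
Local Notation M := 'M[R[i]]_n.
Implicit Types (X Y : M) (H G U V : set M).

Definition mexp X : M :=
  lim (series (fun k : nat => (k`!%:R)^-1 *: X ^+ k) @ \oo).

Definition is_subgroup H : Prop :=
  [/\ forall g, H g -> g \in unitmx, H 1%:M,
      forall g h, H g -> H h -> H (g *m h)
    & forall g, H g -> H (invmx g)].

(* The Lie algebra of a closed subgroup of GL(n, C). *)
Definition lie H : set M := [set X | forall t : R, H (mexp (t%:C *: X))].

Definition imul V : set M := [set 'i *: X | X in V].

(* A compact subgroup of U(n) is closed, hence a Lie subgroup. *)
Definition compact_connected_unitary U : Prop :=
  [/\ is_subgroup U, forall u, U u -> u \is unitarymx, compact U
    & connected U].

Definition complexification U : set M :=
  [set mexp ('i *: eta) *m u | eta in lie U & u in U].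

Definition complexified_lie U : set M :=
  [set X + Y | X in lie U & Y in imul (lie U)].

Definition cartanK U G : set M := G `&` U.
Definition cartank U G : set M := lie (cartanK U G).
Definition cartanp U G : set M := lie G `&` imul (lie U).

Definition real_compatible U G : Prop :=
  [/\ [/\ is_subgroup G, G `<=` complexification U
        & complexification U `&` closure G `<=` G],
      G = [set k *m mexp X | k in cartanK U G & X in cartanp U G],
      lie G = [set X + Y | X in cartank U G & Y in cartanp U G]
    & cartank U G `&` cartanp U G = [set 0]].

Definition Ad (g X : M) : M := g *m X *m invmx g.

(* For X in u + iu, the components in u and iu are the skew-Hermitian and
   Hermitian parts of X, since u consists of skew-Hermitian matrices. *)
Definition skew_part X : M := 2%:R^-1 *: (X - (X ^t*)%sesqui).
Definition herm_part X : M := 2%:R^-1 *: (X + (X ^t*)%sesqui).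

Definition ip X Y : R :=
  - complex.Re (\tr (skew_part X *m skew_part Y))
  + complex.Re (\tr (herm_part X *m herm_part Y)).

Definition id_component H : set M := connected_component H 1%:M.

Definition maximal_compact_subgroup L H : Prop :=
  [/\ is_subgroup L, compact L, L `<=` H
    & forall L', is_subgroup L' -> compact L' -> L' `<=` H ->
        L `<=` L' -> L' = L].

(* Functions on a real subspace V of M are represented by total functions on M
   of which only the values on V are used. *)
Definition smooth_subspace V (F : M -> R) : Prop :=
  forall (k : nat) (X : 'I_k -> M), (forall a, V (X a)) ->
    smooth_on [set: 'rV[R]_k]
      (fun t : 'rV[R]_k => F (\sum_(a < k) (t 0 a)%:C *: X a)).

Definition hess (F : M -> R) (zeta a b : M) : R :=
  derive1 (fun s : R =>
    derive1 (fun t : R => F (zeta + s%:C *: a + t%:C *: b)) 0) 0.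

Definition strictly_convex V (F : M -> R) : Prop :=
  smooth_subspace V F /\
  forall zeta a, V zeta -> V a -> a != 0 -> 0 < hess F zeta a a.

Definition Ad_invariant H V (F : M -> R) : Prop :=
  forall g X, H g -> V X -> F (Ad g X) = F X.

Definition sharp_hess V (F : M -> R) (zeta : M) (S : M -> M) : Prop :=
  forall a, V a -> V (S a) /\ forall b, V b -> ip (S a) b = hess F zeta a b.

Definition kp_compatible_at U G (F : M -> R) (zeta : M) : Prop :=
  exists S : M -> M,
    [/\ sharp_hess (imul (lie U)) F zeta S,
        S @` cartanp U G `<=` cartanp U G
      & S @` imul (cartank U G) `<=` imul (cartank U G)].

End MatrixGroups.

Section Manifolds.
Variables (R : realType) (m : nat).
Local Notation E := 'rV[R]_(m + m).

(* A Hausdorff space with an atlas of charts into R^(2m); param i inverts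
   coord i on the image of the chart.  Second countability is omitted, being
   automatic for compact spaces. *)
Record manifold := Manifold {
  mpoint :> topologicalType;
  chart : Type;
  cdom : chart -> set mpoint;
  coord : chart -> mpoint -> E;
  param : chart -> E -> mpoint;
  mhausdorff : hausdorff_space mpoint;
  cdom_open : forall i, open (cdom i);
  cdom_cover : forall z, exists i, cdom i z;
  cimg_open : forall i, open (coord i @` cdom i);
  coordK : forall i z, cdom i z -> param i (coord i z) = z;
  coord_continuous : forall i z, cdom i z -> {for z, continuous (coord i)};
  param_continuous : forall i x, (coord i @` cdom i) x ->
    {for x, continuous (param i)}
}.

Definition cimg (Z : manifold) (i : chart Z) : set E := coord i @` cdom i.

(* The openness condition makes c continuous on the open set B. *)
Definition smooth_into (Z : manifold) (k : nat) (B : set 'rV[R]_k)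
    (c : 'rV[R]_k -> Z) : Prop :=
  forall j : chart Z, open (B `&` c @^-1` cdom j) /\
    smooth_on (B `&` c @^-1` cdom j) (fun y => coord j (c y)).

Definition smooth_map (Z : manifold) (h : Z -> Z) : Prop :=
  forall i : chart Z, smooth_into (cimg i) (fun x => h (param i x)).

Definition smooth_function (Z : manifold) (h : Z -> R) : Prop :=
  forall i : chart Z, smooth_on (cimg i) (fun x => h (param i x)).

Definition Jmul (v : E) : E := row_mx (- rsubmx v) (lsubmx v).

Definition local_diff (Z : manifold) (h : Z -> Z) (i j : chart Z) (x v : E) : E :=
  'D_v (fun y => coord j (h (param i y))) x.

(* Smooth with complex-linear differential (Cauchy-Riemann); with h the
   identity, this says that the transition maps are holomorphic. *)
Definition holomorphic_map (Z : manifold) (h : Z -> Z) : Prop :=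
  smooth_map h /\
  forall (i j : chart Z) x v, cimg i x -> cdom j (h (param i x)) ->
    local_diff h i j x (Jmul v) = Jmul (local_diff h i j x v).

(* A field of bilinear forms, given by its Gram matrix in each chart. *)
Definition bform (Z : manifold) := chart Z -> E -> 'M[R]_(m + m).

Definition bapp (Z : manifold) (om : bform Z) (i : chart Z) (x v w : E) : R :=
  (v *m om i x *m w^T) 0 0.

Definition preserves (Z : manifold) (b : chart Z -> E -> E -> E -> R)
    (h : Z -> Z) : Prop :=
  forall (i j : chart Z) x v w, cimg i x -> cdom j (h (param i x)) ->
    b j (coord j (h (param i x))) (local_diff h i j x v) (local_diff h i j x w)
    = b i x v w.

(* A complex manifold with a closed J-invariant 2-form omega such that
   omega(., J .) is positive definite; preservation by the identity is the
   transformation rule under change of charts. *)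
Record kahler := Kahler {
  kmanifold :> manifold;
  kform : bform kmanifold;
  ktransition : holomorphic_map (fun z : kmanifold => z);
  kform_transition : preserves (bapp kform) (fun z : kmanifold => z);
  kform_smooth : forall i : chart kmanifold, smooth_on (cimg i) (kform i);
  kform_skew : forall (i : chart kmanifold) x v w, cimg i x ->
    bapp kform i x v w = - bapp kform i x w v;
  kform_J : forall (i : chart kmanifold) x v w, cimg i x ->
    bapp kform i x (Jmul v) (Jmul w) = bapp kform i x v w;
  kform_pos : forall (i : chart kmanifold) x v, cimg i x -> v != 0 ->
    0 < bapp kform i x v (Jmul v);
  kform_closed : forall (i : chart kmanifold) x u v w, cimg i x ->
    'D_u (fun y => bapp kform i y v w) x
    + 'D_v (fun y => bapp kform i y w u) x
    + 'D_w (fun y => bapp kform i y u v) x = 0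
}.

Definition komega (Z : kahler) := bapp (@kform Z).

Definition kmetric (Z : kahler) (i : chart Z) (x v w : E) : R :=
  komega i x v (Jmul w).

Definition kahler_isometry (Z : kahler) (h : Z -> Z) : Prop :=
  [/\ holomorphic_map h, preserves (@komega Z) h & preserves (@kmetric Z) h].

Definition critical_point (Z : manifold) (h : Z -> R) (z : Z) : Prop :=
  forall (i : chart Z) (v : E), cdom i z ->
    is_derive (coord i z) v (fun x => h (param i x)) 0.

End Manifolds.

Section Actions.
Variables (R : realType) (m n : nat) (Z : kahler R m).
Local Notation M := 'M[R[i]]_n.
Implicit Types (U G : set M) (act : M -> Z -> Z) (mu : Z -> M -> R).

(* The coordinates, in the chart j around z, of the vector xi_Z(z). *)
Definition fund act (xi : M) (j : chart Z) (z : Z) : 'rV[R]_(m + m) :=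
  derive1 (fun t : R => coord j (act (mexp (t%:C *: xi)) z)) 0.

(* Only the values act g for g in U^C matter.  Smoothness of U^C x Z -> Z is
   expressed in the coordinates exp(t_1 X_1 + ... + t_k X_k) g around g, the
   X_a in u^C; a smooth action is holomorphic iff its differentials in
   both variables are complex linear. *)
Definition holomorphic_action U act : Prop :=
  let UC := complexification U in
  [/\ forall z, act 1%:M z = z,
      forall g h z, UC g -> UC h -> act (g *m h) z = act g (act h z),
      forall (k : nat) (X : 'I_k -> M) (g : M) (i : chart Z),
        (forall a, complexified_lie U (X a)) -> UC g ->
        smooth_into [set y : 'rV[R]_(k + (m + m)) | cimg i (rsubmx y)]
          (fun y => act (mexp (\sum_(a < k) (lsubmx y 0 a)%:C *: X a) *m g)
                        (param i (rsubmx y))),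
      forall g, UC g -> holomorphic_map (act g)
    & forall xi (j : chart Z) z, complexified_lie U xi -> cdom j z ->
        fund act ('i *: xi) j z = Jmul (fund act xi j z)].

(* mu z is an element of the dual of u, i.e. a real-linear functional on u,
   represented by a total function on matrices. *)
Definition momentum_map U act mu : Prop :=
  [/\ forall z (a b : R) xi eta, lie U xi -> lie U eta ->
        mu z (a%:C *: xi + b%:C *: eta) = a * mu z xi + b * mu z eta,
      forall xi, lie U xi -> smooth_function (fun z => mu z xi)
    & forall (i : chart Z) z v xi, cdom i z -> lie U xi ->
        'D_v (fun x => mu (param i x) xi) (coord i z)
        = komega i (coord i z) v (fund act xi i z)].

Definition Ad_star_equivariant U act mu : Prop :=
  forall u z xi, U u -> lie U xi -> mu (act u z) xi = mu z (Ad (invmx u) xi).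

(* mup z is the orthogonal projection to p of beta = #(i mu(z)). *)
Definition gradient_map U G mu (mup : Z -> M) : Prop :=
  forall z, exists beta : M,
    [/\ imul (lie U) beta,
        forall xi, imul (lie U) xi -> ip beta xi = mu z ('i *: xi),
        cartanp U G (mup z)
      & forall eta, cartanp U G eta -> ip (beta - mup z) eta = 0].

Definition stabilizer act (H : set M) (z : Z) : set M :=
  [set g | H g /\ act g z = z].

End Actions.

(* Main.v *)
(* Let zeta = mu_p(z) and let beta in p be the gradient of f at zeta.  Criticality
   and the strict inequality f(Y) > f(zeta) + <beta, Y - zeta> make z a minimum of
   f o mu_p - <beta, mu_p>, so the vector field of i beta, hence that of beta, vanishes
   at z.  By Iwasawa, g in G_z is kQ with k in K and Q, Q^-1 parabolic, i.e.
   exp(- t beta) Q exp(t beta) converges, to the Levi part r of Q, as t -> + oo.  For X in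
   p, <mu_p, X> is nondecreasing along the flow of X; letting t -> + oo in
   exp(- t Ad_k beta) z = k exp(- t beta) Q exp(t beta) z this gives
   <zeta, beta> = <mu_p(r z), beta> <= <zeta, Ad_k beta>, and strict convexity forces
   Ad_k zeta = zeta, then Ad_k beta = beta.  Thus G_z lies in the parabolic subgroup of
   beta, and its elements commuting with beta have both polar factors in G_z.  The
   K-part of the Levi part is therefore a retraction of G_z onto the elements of K_z
   commuting with beta; it fixes all of K_z, because a unitary g such that g and g^-1
   are parabolic commutes with beta.  An element of G_z killed by this retraction and
   lying in a compact group has Levi part exp X with bounded powers, so X = 0, and is
   then unipotent with bounded powers, hence trivial. *)
Require Import Defs.
From HB Require Import structures.
From mathcomp Require Import all_boot all_order all_algebra spectral.
From mathcomp Require Import complex.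
From mathcomp Require Import all_classical all_reals all_analysis.
From mathcomp Require Import ring lra.
Import Order.TTheory GRing.Theory Num.Theory numFieldNormedType.Exports.
Local Open Scope classical_set_scope.
Local Open Scope ring_scope.
Local Open Scope complex_scope.

Set Implicit Arguments.
Unset Strict Implicit.

(** * Frobenius geometry of complex matrices *)

(** The argument lets group elements converge, exp (- t beta) g exp (t beta) to a Levi part for
    instance, and follows their action on z. The action is only known to be smooth in coordinates
    exp (X) g, which need not reach every element of U^C near g. Continuity in g is therefore built
    from two facts: exp covers a neighbourhood of 1 in U, and polar factors depend continuously on
    the matrix. Criticality enters as follows: z is critical for f o mu_p and minimises f o mu_p -
    <beta, mu_p>, hence is critical for <beta, mu_p>, whose Hamiltonian field is that of i beta up
    to sign. The derivative of <mu_p, X> along the flow of X is the squared length of the field of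
    X, which gives both the monotonicity and its equality case, where the flow is stationary. The
    retraction settles both claims. It is continuous and fixes 1, so it maps G_z^o into K_z^o; as it
    fixes every element of K_z, an element of G_z^o lying in K is in K_z^o. *)

Section RealSums.
Variable R : realType.

(** Lagrange's identity: twice the difference of the two sides is the double sum of (u_k v_l - u_l
    v_k)^2. *)
Lemma sum_cauchy_schwarz (I : finType) (u v : I -> R) :
  (\sum_k u k * v k) ^+ 2 <= (\sum_k u k ^+ 2) * (\sum_k v k ^+ 2).
Proof.
have E1 : (\sum_k u k * v k) ^+ 2 = \sum_k \sum_l (u k * v k) * (u l * v l).
  by rewrite expr2 mulr_suml; apply: eq_bigr => k _; rewrite mulr_sumr.
have E2 : (\sum_k u k ^+ 2) * (\sum_k v k ^+ 2)
    = \sum_k \sum_l u k ^+ 2 * v l ^+ 2.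
  by rewrite mulr_suml; apply: eq_bigr => k _; rewrite mulr_sumr.
have E3 : (\sum_k u k ^+ 2) * (\sum_k v k ^+ 2)
    = \sum_k \sum_l u l ^+ 2 * v k ^+ 2 by rewrite E2 exchange_big.
rewrite -(ler_pMn2r (n := 2)) // [leRHS]mulr2n {1}E2 E3 -big_split /= E1 -sumrMnl.
apply: ler_sum => k _; rewrite -sumrMnl -big_split /=; apply: ler_sum => l _.
by have := sqr_ge0 (u k * v l - u l * v k); nra.
Qed.

End RealSums.

(** Locked, like the matrix operations below, so that rewriting and conversion never descend to
    entries; [adj.body] is the function itself, for use as an argument. *)
HB.lock Definition adj (R : realType) (n : nat) (A : 'M[R[i]]_n) : 'M[R[i]]_n :=
  (A ^t*)%sesqui.

(** The Euclidean inner product of M seen as a real vector space; on Hermitian matrices it agrees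
    with [ip] ([hermx_ip]). *)
HB.lock Definition dot (R : realType) (n : nat) (A B : 'M[R[i]]_n) : R :=
  \sum_i \sum_j (complex.Re (A i j) * complex.Re (B i j)
               + complex.Im (A i j) * complex.Im (B i j)).

HB.lock Definition fro (R : realType) (n : nat) (A : 'M[R[i]]_n) : R :=
  Num.sqrt (dot A A).

Section Frobenius.
Variables (R : realType) (n : nat).
Local Notation M := 'M[R[i]]_n.
Implicit Types (A B C V : M) (a b c e : R).

Lemma adj_def A : (A ^t*)%sesqui = adj A.
Proof. by rewrite adj.unlock. Qed.

Lemma dot_def A B : dot A B = \sum_i \sum_j
  (complex.Re (A i j) * complex.Re (B i j) + complex.Im (A i j) * complex.Im (B i j)).
Proof. by rewrite dot.unlock. Qed.

Lemma froE A : fro A = Num.sqrt (dot A A).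
Proof. by rewrite fro.unlock. Qed.

Lemma adjE A i j : adj A i j = conjc (A j i).
Proof. by rewrite -adj_def !mxE. Qed.

Lemma mx_subE A B i j : (A - B) i j = A i j - B i j.
Proof. by rewrite !mxE. Qed.

Lemma mx_addE A B i j : (A + B) i j = A i j + B i j.
Proof. by rewrite !mxE. Qed.

Lemma adjK A : adj (adj A) = A.
Proof. by rewrite -!adj_def trmxCK. Qed.

Lemma adjM A B : adj (A *m B) = adj B *m adj A.
Proof. by rewrite -!adj_def trmx_mul map_mxM. Qed.

Lemma adjD A B : adj (A + B) = adj A + adj B.
Proof. by rewrite -!adj_def linearD map_mxD. Qed.

Lemma adjB A B : adj (A - B) = adj A - adj B.
Proof. by rewrite -!adj_def linearB map_mxB. Qed.

Lemma adjN A : adj (- A) = - adj A.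
Proof. by rewrite -!adj_def linearN map_mxN. Qed.

Lemma adjZ (z : R[i]) A : adj (z *: A) = conjc z *: adj A.
Proof. by rewrite -!adj_def linearZ map_mxZ. Qed.

Lemma adjZr c A : adj (c%:C *: A) = c%:C *: adj A.
Proof. by rewrite adjZ conjc_real. Qed.

Lemma adj1 : adj (1%:M : M) = 1%:M.
Proof. by rewrite -!adj_def trmx1 map_mx1. Qed.

Lemma adj0 : adj (0 : M) = 0.
Proof. by rewrite -!adj_def trmx0 map_mx0. Qed.

Lemma unitary_adj V : V \is unitarymx -> V *m adj V = 1%:M.
Proof. by move/unitarymxP; rewrite adj_def. Qed.

Lemma unitary_adjl V : V \is unitarymx -> adj V *m V = 1%:M.
Proof. by move=> /unitary_adj /mulmx1C. Qed.

Lemma adj_unitary V : V \is unitarymx -> adj V \is unitarymx.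
Proof. by rewrite -adj_def trmxC_unitary. Qed.

Lemma ReD (x y : R[i]) : complex.Re (x + y) = complex.Re x + complex.Re y.
Proof. by case: x; case: y. Qed.

Lemma ImD (x y : R[i]) : complex.Im (x + y) = complex.Im x + complex.Im y.
Proof. by case: x; case: y. Qed.

Lemma Re_sum (I : finType) (F : I -> R[i]) :
  complex.Re (\sum_k F k) = \sum_k complex.Re (F k).
Proof. by rewrite (big_morph _ ReD (erefl : complex.Re 0 = 0)). Qed.

Lemma ReZr c (x : R[i]) : complex.Re (c%:C * x) = c * complex.Re x.
Proof. by case: x => x y /=; rewrite mul0r subr0. Qed.

Lemma ImZr c (x : R[i]) : complex.Im (c%:C * x) = c * complex.Im x.
Proof. by case: x => x y /=; rewrite mul0r addr0. Qed.

Lemma dotE A B : dot A B = complex.Re (\tr (A *m adj B)).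
Proof.
rewrite dot_def /mxtrace Re_sum; apply: eq_bigr => i _.
rewrite mxE Re_sum; apply: eq_bigr => j _.
by rewrite adjE; case: (A i j) => x y; case: (B i j) => z w /=; rewrite mulrN opprK.
Qed.

Lemma dotC A B : dot A B = dot B A.
Proof. by rewrite !dot_def; apply: eq_bigr => i _; apply: eq_bigr => j _; rewrite mulrC [X in _ + X]mulrC. Qed.

Lemma dotDl A B C : dot (A + B) C = dot A C + dot B C.
Proof.
rewrite !dot_def -big_split /=; apply: eq_bigr => i _; rewrite -big_split /=.
by apply: eq_bigr => j _; rewrite !mxE ReD ImD; ring.
Qed.

Lemma dotDr A B C : dot C (A + B) = dot C A + dot C B.
Proof. by rewrite dotC dotDl ![dot _ C]dotC. Qed.

Lemma dotZl c A B : dot (c%:C *: A) B = c * dot A B.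
Proof.
rewrite !dot_def mulr_sumr; apply: eq_bigr => i _; rewrite mulr_sumr.
by apply: eq_bigr => j _; rewrite !mxE ReZr ImZr; ring.
Qed.

Lemma dotZr c A B : dot A (c%:C *: B) = c * dot A B.
Proof. by rewrite dotC dotZl dotC. Qed.

Lemma dotNl A B : dot (- A) B = - dot A B.
Proof. by rewrite -scaleN1r -(rmorphN1 (real_complex R)) dotZl mulN1r. Qed.

Lemma dotNr A B : dot A (- B) = - dot A B.
Proof. by rewrite dotC dotNl dotC. Qed.

Lemma dotBl A B C : dot (A - B) C = dot A C - dot B C.
Proof. by rewrite dotDl dotNl. Qed.

Lemma dotBr A B C : dot C (A - B) = dot C A - dot C B.
Proof. by rewrite dotDr dotNr. Qed.

Lemma dot0l A : dot 0 A = 0.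
Proof. by rewrite -(subrr A) dotBl subrr. Qed.

Lemma dot0r A : dot A 0 = 0.
Proof. by rewrite dotC dot0l. Qed.

Lemma dot_suml (I : finType) (F : I -> M) A :
  dot (\sum_k F k) A = \sum_k dot (F k) A.
Proof. by rewrite (big_morph (fun B => dot B A) (fun x y => dotDl x y A) (dot0l A)). Qed.

Lemma dot_ge0 A : 0 <= dot A A.
Proof. by rewrite dot_def; apply: sumr_ge0 => i _; apply: sumr_ge0 => j _; rewrite -!expr2 addr_ge0 ?sqr_ge0. Qed.

Lemma dot_eq0 A : dot A A = 0 -> A = 0.
Proof.
rewrite dot_def => /eqP; rewrite psumr_eq0; last first.
  by move=> i _; apply: sumr_ge0 => j _; rewrite -!expr2 addr_ge0 ?sqr_ge0.
move=> /allP H; apply/matrixP => i j; rewrite mxE.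
have := H i (mem_index_enum _) => /=; rewrite psumr_eq0; last first.
  by move=> k _; rewrite -!expr2 addr_ge0 ?sqr_ge0.
move=> /allP /(_ j (mem_index_enum _)) /=.
rewrite -!expr2 paddr_eq0 ?sqr_ge0 // !sqrf_eq0 => /andP[/eqP Hr /eqP Hi].
by move: Hr Hi; case: (A i j) => x y /= -> ->.
Qed.

Lemma fro_ge0 A : 0 <= fro A. Proof. by rewrite froE sqrtr_ge0. Qed.
Hint Resolve fro_ge0 : core.

Lemma sqr_fro A : fro A ^+ 2 = dot A A.
Proof. by rewrite froE sqr_sqrtr // dot_ge0. Qed.

Lemma fro_eq0 A : fro A = 0 -> A = 0.
Proof. by move=> H; apply: dot_eq0; rewrite -sqr_fro H expr0n. Qed.

Lemma fro0 : fro (0 : M) = 0.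
Proof. by rewrite !froE dot0l sqrtr0. Qed.

Lemma fro_gt0 A : A != 0 -> 0 < fro A.
Proof.
by move=> A0; rewrite lt_def fro_ge0 andbT; apply: contraNneq A0 => /fro_eq0 ->.
Qed.

Lemma froZ c A : fro (c%:C *: A) = `|c| * fro A.
Proof. by rewrite !froE dotZl dotZr mulrA -expr2 sqrtrM ?sqr_ge0 // sqrtr_sqr. Qed.

Lemma froN A : fro (- A) = fro A.
Proof. by rewrite !froE dotNl dotNr opprK. Qed.

Lemma fro_distC A B : fro (A - B) = fro (B - A).
Proof. by rewrite -froN opprB. Qed.

Lemma dot_le A B : dot A B <= fro A * fro B.
Proof.
have [->|A0] := eqVneq A 0; first by rewrite dot0l fro0 mul0r.
have [->|B0] := eqVneq B 0; first by rewrite dot0r fro0 mulr0.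
have a0 := fro_gt0 A0; have b0 := fro_gt0 B0.
have := dot_ge0 ((fro B)%:C *: A - (fro A)%:C *: B).
rewrite dotBl !dotBr !dotZl !dotZr -!sqr_fro [dot B A]dotC => H.
have ab0 : 0 < 2 * (fro A * fro B) by rewrite !mulr_gt0.
rewrite -(ler_pM2l ab0); nra.
Qed.

Lemma dot_norm_le A B : `|dot A B| <= fro A * fro B.
Proof. by rewrite ler_norml dot_le andbT lerNl -dotNl -(froN A) dot_le. Qed.

Lemma froD A B : fro (A + B) <= fro A + fro B.
Proof.
rewrite -(@ler_pXn2r _ 2) ?nnegrE ?addr_ge0 //.
rewrite sqr_fro dotDl !dotDr [dot B A]dotC -!sqr_fro.
by have := dot_le A B; nra.
Qed.

Lemma froB A B : fro (A - B) <= fro A + fro B.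
Proof. by rewrite -(froN B) froD. Qed.

Lemma fro_triangle A B C : fro (A - C) <= fro (A - B) + fro (B - C).
Proof. by rewrite (le_trans _ (froD _ _)) // addrA subrK. Qed.

Lemma fro_lerB A B : fro A - fro B <= fro (A - B).
Proof. by rewrite lerBlDr (le_trans _ (froD _ _)) // subrK. Qed.

Lemma fro_sum (I : Type) (r : seq I) (P : pred I) (F : I -> M) :
  fro (\sum_(k <- r | P k) F k) <= \sum_(k <- r | P k) fro (F k).
Proof.
elim/big_rec2: _ => [|k x y _ H]; first by rewrite fro0.
by rewrite (le_trans (froD _ _)) // lerD2l.
Qed.

(** The squared modulus with values in R; the norm of R[i] takes its values in R[i]. *)
Definition sqn (x : R[i]) : R := complex.Re x ^+ 2 + complex.Im x ^+ 2.

Lemma sqn_sum_mul (I : finType) (x y : I -> R[i]) :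
  sqn (\sum_k x k * y k) <= (\sum_k sqn (x k)) * (\sum_k sqn (y k)).
Proof.
have E z : sqn z = Normc.normc z ^+ 2.
  by case: z => a b; rewrite sqr_sqrtr // addr_ge0 ?sqr_ge0.
rewrite E.
have H : Normc.normc (\sum_k x k * y k) <= \sum_k Normc.normc (x k) * Normc.normc (y k).
  elim/big_rec2: _ => [|k u v _ H]; first by rewrite Normc.normc0.
  by rewrite (le_trans (le_normcD _ _)) // Normc.normcM lerD2l.
have H0 z : 0 <= Normc.normc z by case: z => a b; exact: sqrtr_ge0.
apply: (@le_trans _ _ ((\sum_k Normc.normc (x k) * Normc.normc (y k)) ^+ 2)).
  by rewrite ler_pXn2r ?nnegrE // sumr_ge0 // => k _; rewrite mulr_ge0.
rewrite (le_trans (sum_cauchy_schwarz _ _)) //.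
by under eq_bigr do rewrite -E; under [X in _ * X]eq_bigr do rewrite -E.
Qed.

Lemma dot_sqn A : dot A A = \sum_i \sum_j sqn (A i j).
Proof. by rewrite dot_def. Qed.

Lemma sqn_ge0 x : 0 <= sqn x.
Proof. by rewrite addr_ge0 ?sqr_ge0. Qed.

Lemma froM A B : fro (A *m B) <= fro A * fro B.
Proof.
rewrite -(@ler_pXn2r _ 2) ?nnegrE ?mulr_ge0 // exprMn !sqr_fro !dot_sqn.
have -> : (\sum_i \sum_j sqn (A i j)) * (\sum_i \sum_j sqn (B i j))
  = \sum_i \sum_j (\sum_k sqn (A i k)) * (\sum_k sqn (B k j)).
  rewrite mulr_suml; apply: eq_bigr => i _.
  by rewrite -mulr_sumr [X in _ * X]exchange_big.
apply: ler_sum => i _; apply: ler_sum => j _.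
by rewrite mxE; exact: sqn_sum_mul.
Qed.

Lemma fro_adj A : fro (adj A) = fro A.
Proof.
rewrite !froE; congr Num.sqrt; rewrite !dot_def exchange_big /=; apply: eq_bigr => i _.
by apply: eq_bigr => j _; rewrite adjE; case: (A i j) => x y /=; rewrite mulrNN.
Qed.

Lemma dotMl C A B : dot (C *m A) B = dot A (adj C *m B).
Proof. by rewrite !dotE adjM adjK mulmxA [RHS]/= [in RHS]mxtrace_mulC mulmxA. Qed.

Lemma dotMr C A B : dot (A *m C) B = dot A (B *m adj C).
Proof. by rewrite !dotE adjM adjK mulmxA. Qed.

Lemma dot_unitl V A B : V \is unitarymx -> dot (V *m A) (V *m B) = dot A B.
Proof. by move=> uV; rewrite dotMl mulmxA unitary_adjl // mul1mx. Qed.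

Lemma dot_unitr V A B : V \is unitarymx -> dot (A *m V) (B *m V) = dot A B.
Proof. by move=> uV; rewrite dotMr -mulmxA unitary_adj // mulmx1. Qed.

Lemma fro_unitl V A : V \is unitarymx -> fro (V *m A) = fro A.
Proof. by move=> uV; rewrite !froE dot_unitl. Qed.

Lemma fro_unitr V A : V \is unitarymx -> fro (A *m V) = fro A.
Proof. by move=> uV; rewrite !froE dot_unitr. Qed.

Lemma sqn_le_fro A i j : sqn (A i j) <= fro A ^+ 2.
Proof.
rewrite sqr_fro dot_sqn (bigD1 i) //= (bigD1 j) //= -addrA lerDl addr_ge0 //.
  by rewrite sumr_ge0 // => k _; rewrite sqn_ge0.
by rewrite sumr_ge0 // => k _; rewrite sumr_ge0 // => l _; rewrite sqn_ge0.
Qed.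

Lemma fro_le_entries A c : 0 <= c -> (forall i j, sqn (A i j) <= c ^+ 2) ->
  fro A <= n%:R * c.
Proof.
move=> c0 H; rewrite -(@ler_pXn2r _ 2) ?nnegrE ?mulr_ge0 // sqr_fro dot_sqn exprMn.
have -> : n%:R ^+ 2 * c ^+ 2 = \sum_(i < n) \sum_(j < n) c ^+ 2 :> R.
  by rewrite !sumr_const !card_ord -mulrnA -[RHS]mulr_natl natrM expr2.
by apply: ler_sum => i _; apply: ler_sum => j _; exact: H.
Qed.

Lemma normc_sqr (x : R[i]) : Normc.normc x ^+ 2 = sqn x.
Proof. by case: x => a b; rewrite sqr_sqrtr // addr_ge0 ?sqr_ge0. Qed.

(** The bridge from the entrywise topology, whose radii live in R[i], to the Frobenius norm; later
    topological arguments on matrices use real radii only. *)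
Lemma nbhs_fro A (P : set M) :
  nbhs A P <-> exists2 e, 0 < e & forall B, fro (B - A) < e -> P B.
Proof.
have nc0 (z : R[i]) : 0 <= Normc.normc z by case: z => a b; exact: sqrtr_ge0.
split.
  move/nbhs_ballP => [e /= e0 H].
  have [er Ee] : exists er : R, e = er%:C.
    by exists (complex.Re e); move: e0 (RRe_real (gtr0_real e0)) => _ ->.
  rewrite Ee ltcR in e0; exists er => // B HB; apply: H; split => [|i j]; first by rewrite Ee ltcR.
  rewrite /ball /= /ball_ /= Ee /=.
  have -> : `|A i j - B i j| = (Normc.normc (A i j - B i j))%:C by [].
  rewrite ltcR (le_lt_trans _ HB) //.
  rewrite -(@ler_pXn2r _ 2) ?nnegrE // normc_sqr fro_distC.
  by have := sqn_le_fro (A - B) i j; rewrite !mxE.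
move=> [e e0 H]; apply/nbhs_ballP.
(* [fro_le_entries] multiplies the entry bound by n, which leaves at most e / 2; [n.+1] makes the
   radius positive also for n = 0. *)
exists ((e / n.+1%:R / 2)%:C) => /=; first by rewrite ltcR !divr_gt0.
move=> B [_ HB]; apply: H.
apply: (@le_lt_trans _ _ (n%:R * (e / n.+1%:R / 2))).
  apply: fro_le_entries; first by rewrite ltW // !divr_gt0.
  move=> i j; have := HB i j; rewrite /ball /= /ball_ /=.
  have -> : `|A i j - B i j| = (Normc.normc (A i j - B i j))%:C by [].
  rewrite ltcR => /ltW h.
  rewrite -normc_sqr !mxE ler_pXn2r ?nnegrE //; last by rewrite ltW // !divr_gt0.
  by rewrite -opprB normcN.
have n1 : 0 < n.+1%:R :> R by rewrite ltr0n.
have -> : n%:R * (e / n.+1%:R / 2) = e * ((n%:R / n.+1%:R) / 2) by ring.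
have h : n%:R / n.+1%:R <= 1 :> R by rewrite ler_pdivrMr // mul1r ler_nat.
by rewrite gtr_pMr //; move: (_ / n.+1%:R) h => x h; lra.
Qed.

Lemma cvg_fro (u : nat -> M) A : (u @ \oo --> A) <->
  (forall e, 0 < e -> exists N, forall k, (N <= k)%N -> fro (u k - A) < e).
Proof.
split=> [H e e0|H P /nbhs_fro [e e0 HP]].
  have : nbhs A [set B | fro (B - A) < e] by apply/nbhs_fro; exists e.
  by move/H => [N _ HN]; exists N => k hk; apply: HN.
by have [N HN] := H e e0; exists N => // k /= hk; apply/HP/HN.
Qed.

End Frobenius.
#[export] Hint Extern 0 (is_true (_ <= fro _)) => solve [apply: fro_ge0] : core.
#[export] Hint Extern 0 (is_true (_ <= sqn _)) => solve [apply: sqn_ge0] : core.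

(** * Convergence, compactness and real subspaces of matrices *)

Section Topology.
Variables (R : realType) (n : nat).
Local Notation M := 'M[R[i]]_n.
Implicit Types (A B C V : M) (S : set M) (e r : R).

Lemma continuous_fro (f : M -> M) A :
  (forall e, 0 < e -> exists2 d, 0 < d &
     forall B, fro (B - A) < d -> fro (f B - f A) < e) ->
  {for A, continuous f}.
Proof.
move=> H P /nbhs_fro [e e0 HP]; have [d d0 Hd] := H e e0.
by apply/nbhs_fro; exists d => // B /Hd /HP.
Qed.

Lemma fro_continuous : continuous (@fro.body R n).
Proof.
move=> A P /nbhs_ballP [e /= e0 HP]; apply/nbhs_fro; exists e => // B HB.
apply: HP; rewrite /ball /= ltr_norml; have := fro_lerB A B; have := fro_lerB B A.
by rewrite fro_distC; move: HB; rewrite fro_distC => *; apply/andP; split; lra.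
Qed.

Definition rsub S := S 0 /\ forall (a : R) A B, S A -> S B -> S (a%:C *: A + B).

Lemma rsubD S A B : rsub S -> S A -> S B -> S (A + B).
Proof. by move=> [_ H] SA SB; rewrite -[A]scale1r -(rmorph1 (real_complex R)); exact: H. Qed.

Lemma rsubZ S (a : R) A : rsub S -> S A -> S (a%:C *: A).
Proof. by move=> [S0 H] SA; rewrite -[X in S X]addr0; exact: H. Qed.

Lemma rsubN S A : rsub S -> S A -> S (- A).
Proof. by move=> HS SA; rewrite -scaleN1r -(rmorphN1 (real_complex R)); exact: rsubZ. Qed.

Lemma rsubB S A B : rsub S -> S A -> S B -> S (A - B).
Proof. by move=> HS SA SB; apply: rsubD => //; exact: rsubN. Qed.

Lemma rsub_sum S (I : finType) (F : I -> M) :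
  rsub S -> (forall k, S (F k)) -> S (\sum_k F k).
Proof.
by move=> HS HF; elim/big_ind: _ => //; [case: HS | move=> *; exact: rsubD].
Qed.

Definition orthofam k (X : 'I_k -> M) :=
  forall a b, dot (X a) (X b) = (a == b)%:R.

(** The real coordinates of the family form a matrix with k rows and 2 n^2 columns whose product
    with its transpose is 1, so its rank is k. *)
Lemma orthonormal_size k (X : 'I_k -> M) :
  orthofam X -> (k <= n * n + n * n)%N.
Proof.
move=> oX.
pose G : 'M[R]_(k, n * n + n * n) := \matrix_(a, j)
  (row_mx (mxvec (map_mx (@complex.Re R) (X a)))
          (mxvec (map_mx (@complex.Im R) (X a)))) 0 j.
have GE a j : G a j = row_mx (mxvec (map_mx (@complex.Re R) (X a)))
    (mxvec (map_mx (@complex.Im R) (X a))) 0 j by rewrite mxE.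
have GG : G *m G^T = 1%:M.
  apply/matrixP => a b; rewrite !mxE -oX dot_def big_split_ord /=.
  rewrite -[RHS](eq_bigr _ (fun i _ => esym (big_split _ _ _ _ _))) big_split /=.
  congr (_ + _).
    rewrite (reindex _ (curry_mxvec_bij n n)) /= [RHS]pair_bigA /=.
    by apply: eq_bigr => -[i j] _ /=; rewrite [G^T _ _]mxE !GE !row_mxEl !mxvecE [LHS]/= !mxE.
  rewrite (reindex _ (curry_mxvec_bij n n)) /= [RHS]pair_bigA /=.
  by apply: eq_bigr => -[i j] _ /=; rewrite [G^T _ _]mxE !GE !row_mxEr !mxvecE [LHS]/= !mxE.
rewrite -(mxrank1 R k) -GG (leq_trans (mxrankM_maxl _ _)) //.
exact: rank_leq_col.
Qed.

(** An orthonormal family in S of maximal size works: a nonzero residue of some A could be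
    normalised and appended to it. *)
Lemma orthonormal_basis S : rsub S ->
  exists (k : nat) (X : 'I_k -> M), [/\ forall a, S (X a), orthofam X
    & forall A, S A -> A = \sum_a (dot A (X a))%:C *: X a].
Proof.
move=> HS.
pose P k := `[< exists X : 'I_k -> M, (forall a, S (X a)) /\ orthofam X >].
have P0 : exists k, P k.
  by exists 0%N; apply/asboolP; exists (fun=> 0); split => [[]|[]].
have Pb k : P k -> (k <= n * n + n * n)%N.
  by move=> /asboolP [X [_ /orthonormal_size]].
case: (ex_maxnP P0 Pb) => k /asboolP [X [SX oX]] kmax.
exists k, X; split=> // A SA; apply/eqP; rewrite -subr_eq0; apply/negPn/negP => E0.
set E := _ - _ in E0.
have SE : S E by apply: rsubB => //; apply: rsub_sum => // a; exact: rsubZ.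
have EX a : dot E (X a) = 0.
  rewrite dotBl dot_suml (bigD1 a) //= dotZl oX eqxx mulr1 big1 ?addr0 ?subrr //.
  by move=> b ba; rewrite dotZl oX (negbTE ba) mulr0.
have e0 := fro_gt0 E0.
pose Y : 'I_k.+1 -> M := fun a => if unlift ord_max a is Some b then X b
  else ((fro E)^-1)%:C *: E.
suff : P k.+1 by move/kmax; rewrite ltnn.
apply/asboolP; exists Y; split.
  by move=> a; rewrite /Y; case: unliftP => [b _|_] //; exact: rsubZ.
move=> a b; rewrite /Y; case: unliftP => [a' ->|->]; case: unliftP => [b' ->|->].
- by rewrite oX (inj_eq lift_inj).
- by rewrite dotC dotZl EX mulr0 eq_sym (negbTE (neq_lift _ _)).
- by rewrite dotZl EX mulr0 (negbTE (neq_lift _ _)).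
- by rewrite dotZl dotZr -sqr_fro eqxx expr2 mulKf ?mulVf // gt_eqF.
Qed.

Lemma orthonormal_fro k (X : 'I_k -> M) b : orthofam X -> fro (X b) = 1.
Proof. by move=> oX; rewrite !froE oX eqxx sqrtr1. Qed.

Lemma lincomb_continuous k (X : 'I_k -> M) :
  continuous (fun t : 'rV[R]_k => \sum_a (t 0 a)%:C *: X a).
Proof.
move=> t P /nbhs_fro [e e0 HP]; apply/nbhs_ballP.
pose c := \sum_a fro (X a) + 1.
have c0 : 0 < c by rewrite ltr_wpDl // sumr_ge0 // => a _; exact: fro_ge0.
exists (e / c) => /=; first by rewrite divr_gt0.
move=> s [_ Hs]; apply: HP; rewrite -sumrB.
rewrite (le_lt_trans (fro_sum _ _ _)) //.
apply: (@le_lt_trans _ _ (\sum_a e / c * fro (X a))).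
  apply: ler_sum => a _; rewrite -scalerBl -rmorphB froZ ler_wpM2r //.
  by have := Hs 0 a; rewrite /ball /= distrC => /ltW.
rewrite -mulr_sumr -mulrA gtr_pMr // mulrC ltr_pdivrMr // mul1r.
by rewrite /c ltrDl.
Qed.

(** In an orthonormal basis of S the ball is a closed part of the continuous image of a box. *)
Lemma compact_fro_ball S r : rsub S -> compact [set A | S A /\ fro A <= r].
Proof.
move=> HS; have [k [X [SX oX HX]]] := orthonormal_basis HS.
pose phi (t : 'rV[R]_k) : M := \sum_a (t 0 a)%:C *: X a.
pose box := [set t : 'rV[R]_k | forall a, `[- r, r]%classic (t ord0 a)].
have cb : compact (phi @` box).
  apply: continuous_compact; first exact/continuous_subspaceT/lincomb_continuous.
  by apply: (@rV_compact _ _ (fun=> `[- r, r]%classic)) => _; exact: segment_compact.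
have -> : [set A | S A /\ fro A <= r] = phi @` box `&` [set A | fro A <= r].
  apply/seteqP; split => A /=.
    move=> [SA Ar]; split=> //; exists (\row_a dot A (X a)).
      move=> a /=; rewrite mxE in_itv /= -ler_norml (le_trans (dot_norm_le _ _)) //.
      by rewrite orthonormal_fro // mulr1.
    by rewrite [RHS]HX //; apply: eq_bigr => a _; rewrite mxE.
  by move=> [[t _ <-] Ar]; split=> //; apply: rsub_sum => // a; exact: rsubZ.
apply: compact_closedI => //.
have -> : [set A | fro A <= r] = @fro.body R n @^-1` [set x | x <= r] by [].
by apply: preimage_closed => [A _|]; [exact: fro_continuous | exact: closed_le].
Qed.

(** Replaces the extraction of a subsequence: the limit point is approached at arbitrarily large
    indices. *)
Lemma compact_cluster (K : set M) (u : nat -> M) : compact K -> (forall k, K (u k)) ->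
  exists2 A, K A & forall e N, 0 < e -> exists2 k, (N <= k)%N & fro (u k - A) < e.
Proof.
move=> cK uK.
have [|A [KA cA]] := cK (u @ \oo) _ _.
  by exists 0%N => // k _ /=.
exists A => // e N e0.
have [_ [[k kN <-] /= ke]] : (u @` [set k | (N <= k)%N]) `&` [set B | fro (B - A) < e] !=set0.
  apply: cA; last by apply/nbhs_fro; exists e.
  by exists N => // k /= kN; exists k.
by exists k.
Qed.

Lemma closed_fro (K : set M) A : closed K ->
  (forall e, 0 < e -> exists2 B, K B & fro (B - A) < e) -> K A.
Proof.
move=> cK H; apply: cK => P /nbhs_fro [e e0 HP].
by have [B KB hB] := H e e0; exists B; split=> //; exact: HP.
Qed.

Lemma closure_fro (K : set M) A :
  closure K A <-> forall e, 0 < e -> exists2 B, K B & fro (B - A) < e.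
Proof.
split=> [H e e0|H P /nbhs_fro [e e0 HP]].
  have [B [KB hB]] : K `&` [set B | fro (B - A) < e] !=set0.
    by apply: H; apply/nbhs_fro; exists e.
  by exists B.
by have [B KB hB] := H e e0; exists B; split=> //; exact: HP.
Qed.

Lemma fro_unitary V : V \is unitarymx -> fro V = Num.sqrt n%:R.
Proof.
by move=> uV; rewrite froE dotE unitary_adj // mxtrace1 -(rmorph_nat (real_complex R)).
Qed.

End Topology.

(** * The matrix exponential *)

Section CauchyProduct.

Lemma cauchy_product (V : pzRingType) (x y : nat -> V) N :
  (\sum_(0 <= j < N) x j) * (\sum_(0 <= i < N) y i)
  - \sum_(0 <= k < N) \sum_(0 <= i < k.+1) x (k - i)%N * y i
  = \sum_(0 <= i < N) \sum_(N - i <= j < N) x j * y i.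
Proof.
have -> : \sum_(0 <= k < N) \sum_(0 <= i < k.+1) x (k - i)%N * y i
   = \sum_(0 <= i < N) \sum_(0 <= j < N - i) x j * y i.
  elim: N => [|N IH]; first by rewrite !big_geq.
  rewrite big_nat_recr //= IH big_nat_recr //= [RHS]big_nat_recr //=.
  rewrite subSnn big_nat1 subnn addrA; congr (_ + _).
  rewrite -big_split /=; apply: eq_big_nat => i /andP[_ iN].
  by rewrite subSn ?(ltnW iN) // [RHS]big_nat_recr.
rewrite mulr_sumr -sumrB; apply: eq_big_nat => i /andP[_ iN].
by rewrite mulr_suml [X in X - _](big_cat_nat (leq0n (N - i)) (leq_subr _ _)) /= addrC addrK.
Qed.

End CauchyProduct.

Section MatrixPowerSeries.
Variables (R : realType) (n : nat).
Local Notation M := 'M[R[i]]_n.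
Implicit Types (A B C V : M) (e : R).

Definition mterm A (k : nat) : M := (k`!%:R)^-1 *: A ^+ k.
Definition mpart A (N : nat) : M := \sum_(0 <= k < N) mterm A k.
Definition epart (x : R) (N : nat) : R := \sum_(0 <= k < N) x ^+ k / k`!%:R.

Lemma inv_factC k : (k`!%:R : R[i])^-1 = ((k`!%:R : R)^-1)%:C.
Proof. by rewrite (rmorphV (real_complex R)) ?unitfE ?pnatr_eq0 -?lt0n ?fact_gt0 // rmorph_nat. Qed.

Lemma mtermE A k : mterm A k = ((k`!%:R : R)^-1)%:C *: A ^+ k.
Proof. by rewrite /mterm inv_factC. Qed.

Lemma bin_div_fact (F : numFieldType) k i : (i <= k)%N ->
  (k`!%:R)^-1 * 'C(k, i)%:R = (i`!%:R)^-1 * ((k - i)`!%:R)^-1 :> F.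
Proof.
move=> ik; rewrite mulrC -(bin_fact ik) !natrM.
have h j : (j`!%:R : F) != 0 by rewrite pnatr_eq0 -lt0n fact_gt0.
have hC : 'C(k, i)%:R != 0 :> F by rewrite pnatr_eq0 -lt0n bin_gt0.
by rewrite invfM mulrA divff // mul1r invfM.
Qed.

Lemma binomial_term (a b : R) k i : (i <= k)%N -> a * b *+ 'C(k, i) / k`!%:R =
     a / (k - i)`!%:R * (b / i`!%:R).
Proof.
move=> ik.
rewrite [RHS]mulrACA -invfM -natrM.
have h : ((k - i)`! * i`!)%:R != 0 :> R by rewrite pnatr_eq0 -lt0n muln_gt0 !fact_gt0.
have h2 : k`!%:R != 0 :> R by rewrite pnatr_eq0 -lt0n fact_gt0.
apply/eqP; rewrite eqr_div // -(bin_fact ik) mulnC -[(_ * (k - i)`!)%N]mulnC natrM.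
by rewrite -[X in X * _]mulr_natr mulnC !mulrA natrM mulnC natrM; apply/eqP; ring.
Qed.

Lemma epart_cvg x : epart x @ \oo --> expR x.
Proof. exact: is_cvg_series_exp_coeff. Qed.

Lemma epart_term_ge0 (x : R) k : 0 <= x -> 0 <= x ^+ k / k`!%:R.
Proof. by move=> x0; rewrite divr_ge0 // exprn_ge0. Qed.

Lemma epart_nondecreasing (x : R) N k : 0 <= x -> (N <= k)%N -> epart x N <= epart x k.
Proof.
move=> x0 Nk; rewrite /epart (big_cat_nat _ Nk) //= lerDl sumr_ge0 // => j _.
exact: epart_term_ge0.
Qed.

Lemma cvg_ge_limn (u : nat -> R) (l c : R) N :
  (u @ \oo --> l) -> (forall k, (N <= k)%N -> c <= u k) -> c <= l.
Proof.
move=> ul H; rewrite -(cvg_lim (@Rhausdorff R) ul); apply: limr_ge.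
  by apply/cvg_ex; exists l.
by exists N => // k /= /H.
Qed.

Lemma epart_le (x : R) N : 0 <= x -> epart x N <= expR x.
Proof.
by move=> x0; apply: (@cvg_ge_limn _ _ _ N (@epart_cvg x)) => k; exact: epart_nondecreasing.
Qed.

(* The factor sqrt n + 1 absorbs the zeroth power, whose norm is sqrt n. *)
Definition fcst : R := Num.sqrt n%:R + 1.

Lemma fcst_ge1 : 1 <= fcst. Proof. by rewrite /fcst lerDr sqrtr_ge0. Qed.

Lemma fro1 : fro (1%:M : M) = Num.sqrt n%:R.
Proof. by rewrite fro_unitary //; apply/unitarymxP; rewrite mul1mx adj_def adj1. Qed.

Lemma froX A k : fro (A ^+ k.+1) <= fro A ^+ k.+1.
Proof.
elim: k => [|k IH]; first by rewrite !expr1.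
by rewrite exprS [leRHS]exprS (le_trans (froM _ _)) // ler_wpM2l.
Qed.

Lemma fro_mterm A k : fro (mterm A k) <= fcst * (fro A ^+ k / k`!%:R).
Proof.
have k0 : 0 <= (k`!%:R : R)^-1 by rewrite invr_ge0.
rewrite mtermE froZ ger0_norm // mulrA [leRHS]mulrC ler_wpM2l //.
case: k {k0} => [|k].
  by rewrite !expr0 mulr1 -[1]/(1%:M) fro1 lerDl.
rewrite (le_trans (froX _ _)) // ler_peMl ?fcst_ge1 // exprn_ge0 //.
Qed.

Lemma mpart_cauchy A N k : (N <= k)%N ->
  fro (mpart A k - mpart A N) <= fcst * (expR (fro A) - epart (fro A) N).
Proof.
move=> Nk; rewrite /mpart [X in X - _](big_cat_nat (leq0n N) Nk) /= addrC addrK.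
rewrite (le_trans (fro_sum _ _ _)) //.
apply: (@le_trans _ _ (\sum_(N <= j < k) fcst * (fro A ^+ j / j`!%:R))).
  by apply: ler_sum => j _; exact: fro_mterm.
rewrite -mulr_sumr ler_wpM2l ?(le_trans _ fcst_ge1) // lerBrDl.
by rewrite (le_trans _ (epart_le k (fro_ge0 A))) // /epart [leRHS](big_cat_nat (leq0n N) Nk).
Qed.

Lemma M_hausdorff : hausdorff_space M.
Proof.
move=> A B cAB; apply/eqP; rewrite -subr_eq0; apply/negPn/negP => /fro_gt0 d0.
have [C [/= hA hB]] : [set C | fro (C - A) < fro (A - B) / 2] `&`
    [set C | fro (C - B) < fro (A - B) / 2] !=set0.
  by apply: cAB; apply/nbhs_fro; exists (fro (A - B) / 2); rewrite ?divr_gt0.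
by have := fro_triangle A C B; rewrite (fro_distC A C); lra.
Qed.

Lemma rsubT : rsub [set: M]. Proof. by []. Qed.

Lemma mpart_bounded A N : fro (mpart A N) <= fcst * expR (fro A).
Proof.
have := mpart_cauchy A (leq0n N); rewrite /mpart /epart [\sum_(0 <= j < 0) mterm _ _]big_geq // [\sum_(0 <= j < 0) _]big_geq //.
by rewrite !subr0.
Qed.

Lemma epart_tail (x e : R) : 0 < e -> exists N, forall k, (N <= k)%N -> expR x - epart x k < e.
Proof.
move=> e0; have /cvgrPdist_lt /(_ _ e0) [N _ HN] := @epart_cvg x.
by exists N => k kN; rewrite (le_lt_trans (ler_norm _)) //; exact: HN.
Qed.

(** The partial sums stay in a compact ball, and a Cauchy sequence converges to any of its cluster
    points. *)
Lemma mpart_cvg_mexp A : mpart A @ \oo --> mexp A.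
Proof.
have [L _ HL] := @compact_cluster R n [set B | setT B /\ fro B <= fcst * expR (fro A)]
  (mpart A) (compact_fro_ball rsubT) (fun N => conj I (mpart_bounded A N)).
have c0 : 0 < fcst := lt_le_trans ltr01 fcst_ge1.
have cL : mpart A @ \oo --> L.
  apply/cvg_fro => e e0.
  have e3 : 0 < e / 3 / fcst by rewrite !divr_gt0.
  have [N HN] := epart_tail (fro A) e3.
  have small k : (N <= k)%N -> fro (mpart A k - mpart A N) < e / 3.
    move=> kN; rewrite (le_lt_trans (mpart_cauchy A kN)) //.
    by rewrite mulrC -ltr_pdivlMr // HN.
  have [k kN hk] := HL (e / 3) N (divr_gt0 e0 (ltr0Sn _ 2)).
  exists N => l lN.
  have := fro_triangle (mpart A l) (mpart A k) L.
  have := fro_triangle (mpart A l) (mpart A N) (mpart A k).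
  rewrite (fro_distC (mpart A N)); have := small _ kN; have := small _ lN; lra.
by have -> : mexp A = L by exact: (cvg_lim M_hausdorff cL).
Qed.

End MatrixPowerSeries.

HB.lock Definition expmx (R : realType) (n : nat) (A : 'M[R[i]]_n) : 'M[R[i]]_n :=
  mexp A.

Section MatrixExponential.
Variables (R : realType) (n : nat).
Local Notation M := 'M[R[i]]_n.
Implicit Types (A B C V : M) (e : R).

Lemma expmxE A : mexp A = expmx A.
Proof. by rewrite expmx.unlock. Qed.

Lemma mpart_cvg A : mpart A @ \oo --> expmx A.
Proof. by rewrite -expmxE; exact: mpart_cvg_mexp. Qed.

Lemma expmx_lim A L : mpart A @ \oo --> L -> expmx A = L.
Proof.
move=> H; rewrite -(cvg_lim (@M_hausdorff R n) H).
by rewrite (cvg_lim (@M_hausdorff R n) (@mpart_cvg A)).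
Qed.

(** The bound is asked from index 2 on because [expmx_diff] compares partial sums whose terms of
    degree 0 and 1 are split off. *)
Lemma fro_lim_le (u : nat -> M) L (v : nat -> R) w :
  (u @ \oo --> L) -> (v @ \oo --> w) -> (forall k, (2 <= k)%N -> fro (u k) <= v k) ->
  fro L <= w.
Proof.
move=> uL vw H.
have fu : ((@fro.body R n) \o u) @ \oo --> fro L by apply: continuous_cvg => //; exact: fro_continuous.
rewrite -(cvg_lim (@Rhausdorff R) fu) -(cvg_lim (@Rhausdorff R) vw); apply: ler_lim.
- by apply/cvg_ex; exists (fro L).
- by apply/cvg_ex; exists w.
- by exists 2%N => // k /= /H.
Qed.

(** The difference expands into words in A and C with at least one C, dominated by the same
    expansion in the norms. The exponent [k.+1] avoids the norm of the identity, which is sqrt n. *)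
Lemma froMX_diff A C k :
  fro ((A + C) ^+ k.+1 - A ^+ k.+1) <= (fro A + fro C) ^+ k.+1 - fro A ^+ k.+1.
Proof.
elim: k => [|k IH]; first by rewrite !expr1 addrC addKr addrC addKr.
have -> : (A + C) ^+ k.+2 - A ^+ k.+2
    = ((A + C) ^+ k.+1 - A ^+ k.+1) * (A + C) + A ^+ k.+1 * C.
  by rewrite !(exprSr _ k.+1) mulrBl [X in _ - X + _]mulrDr opprD addrA subrK.
rewrite (le_trans (froD _ _)) //.
apply: (@le_trans _ _ (((fro A + fro C) ^+ k.+1 - fro A ^+ k.+1) * (fro A + fro C)
   + fro A ^+ k.+1 * fro C)).
  apply: lerD.
    rewrite (le_trans (froM _ _)) // ler_pM // ?froD //.
  by rewrite (le_trans (froM _ _)) // ler_wpM2r // froX.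
by rewrite le_eqVlt; apply/orP; left; apply/eqP; rewrite [X in _ = X - _]exprSr [X in _ = _ - X]exprSr; ring.
Qed.

(** Only terms of degree at least 2 survive. With a and c the norms of A and C they are dominated by
    exp (a + c) - exp a - c, and exp a >= (1 - c) exp (a + c). *)
Lemma expmx_diff A C : fro (expmx (A + C) - expmx A - C) <= fro C * (expR (fro A + fro C) - 1).
Proof.
apply: (@le_trans _ _ (expR (fro A + fro C) - expR (fro A) - fro C)); last first.
  have := expR_ge1Dx (- fro C); have := expR_gt0 (fro A + fro C).
  have -> : expR (fro A) = expR (fro A + fro C) * expR (- fro C) by rewrite -expRD addrK.
  by have := fro_ge0 C; nra.
apply: (@fro_lim_le (fun N => mpart (A + C) N - mpart A N - C) _
                    (fun N => epart (fro A + fro C) N - epart (fro A) N - fro C)).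
- by apply: cvgB; [apply: cvgB; exact: mpart_cvg | exact: cvg_cst].
- by apply: cvgB; [apply: cvgB; exact: epart_cvg | exact: cvg_cst].
move=> [|[|N]] // _.
have E0 (V : zmodType) (x y : nat -> V) :
  \sum_(0 <= k < N.+2) x k - \sum_(0 <= k < N.+2) y k
   = (x 0%N - y 0%N) + ((x 1%N - y 1%N) + \sum_(0 <= k < N) (x k.+2 - y k.+2)).
  by rewrite -sumrB big_nat_recl // big_nat_recl.
rewrite /mpart /epart !E0 /= /mterm !expr0 !expr1 !fact0 !subrr !add0r invr1 !scale1r !divr1.
rewrite [A + C]addrC addrK [X in X - C]addrC addrK.
rewrite [fro A + fro C]addrC addrK [X in X - fro C]addrC addrK.
rewrite (le_trans (fro_sum _ _ _)) // ler_sum // => k _.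
rewrite -scalerBr -mulrBl inv_factC froZ ger0_norm ?invr_ge0 // mulrC.
by rewrite ler_wpM2r ?invr_ge0 // addrC [fro C + _]addrC froMX_diff.
Qed.

Lemma expmx0 : expmx (0 : M) = 1%:M.
Proof.
suff H : mpart 0 @ \oo --> (1%:M : M) by exact: expmx_lim.
apply/cvg_fro => e e0; exists 1%N => -[//|k] _.
rewrite /mpart big_nat_recl //= big1_seq => [|j _].
  by rewrite addr0 /mterm expr0 fact0 invr1 scale1r subrr fro0.
by rewrite /mterm expr0n scaler0.
Qed.

Lemma expmx_sub1 C : fro (expmx C - 1%:M - C) <= fro C * (expR (fro C) - 1).
Proof. by have := expmx_diff 0 C; rewrite add0r fro0 add0r expmx0. Qed.

Lemma fro_expmx_sub A B :
  fro (expmx B - expmx A) <= fro (B - A) * expR (fro A + fro (B - A)).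
Proof.
have E : A + (B - A) = B by rewrite addrC subrK.
have := expmx_diff A (B - A); rewrite E => H.
have := froD (expmx B - expmx A - (B - A)) (B - A); rewrite subrK; lra.
Qed.

Lemma expmx_near A e : 0 < e -> exists2 d, 0 < d &
  forall B, fro (B - A) < d -> fro (expmx B - expmx A) < e.
Proof.
move=> e0; have E0 : 0 < expR (fro A + 1) by exact: expR_gt0.
exists (Num.min 1 (e / expR (fro A + 1))).
  by rewrite lt_min ltr01 divr_gt0.
move=> B; rewrite lt_min => /andP[h1 h2].
rewrite (le_lt_trans (fro_expmx_sub A B)) //.
rewrite (@le_lt_trans _ _ (fro (B - A) * expR (fro A + 1))) -?ltr_pdivlMr //.
by rewrite ler_wpM2l // ler_expR lerD2l ltW.
Qed.

Lemma expmx_continuous : continuous (@expmx.body R n).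
Proof. by move=> A; apply: continuous_fro => e; exact: expmx_near. Qed.

Lemma cvg_mulmx (u w : nat -> M) A B :
  (u @ \oo --> A) -> (w @ \oo --> B) -> (fun k => u k *m w k) @ \oo --> A *m B.
Proof.
move=> /cvg_fro uA /cvg_fro wB; apply/cvg_fro => e e0.
pose c := fro A + fro B + 1.
have c0 : 0 < c by rewrite ltr_wpDl // addr_ge0.
have d0 : 0 < Num.min 1 (e / c) by rewrite lt_min ltr01 divr_gt0.
have [N1 H1] := uA _ d0; have [N2 H2] := wB _ d0.
exists (maxn N1 N2) => k; rewrite geq_max => /andP[k1 k2].
have /H1 : (N1 <= k)%N by []. have /H2 : (N2 <= k)%N by [].
rewrite !lt_min => /andP[h1 h2] /andP[h3 h4].
have -> : u k *m w k - A *m B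
    = (u k - A) *m (w k - B) + (A *m (w k - B) + (u k - A) *m B).
  by rewrite addrA -mulmxDl subrK mulmxBr mulmxBl addrA subrK.
have := froD ((u k - A) *m (w k - B)) (A *m (w k - B) + (u k - A) *m B).
have := froD (A *m (w k - B)) ((u k - A) *m B).
have := froM (u k - A) (w k - B); have := froM A (w k - B); have := froM (u k - A) B.
move: h2 h4; rewrite !ltr_pdivlMr // /c.
have := fro_ge0 A; have := fro_ge0 B; have := fro_ge0 (u k - A); have := fro_ge0 (w k - B).
move: (fro A) (fro B) (fro (u k - A)) (fro (w k - B)) h1 h3 => a b x y.
nra.
Qed.

(** At order N the error is the triangle of [cauchy_product], bounded by [fcst] squared times the
    triangle for the real exponentials of the norms, which tends to 0. *)
Lemma expmxD A B : A *m B = B *m A -> expmx (A + B) = expmx A *m expmx B.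
Proof.
move=> cAB; apply/eqP; rewrite eq_sym -subr_eq0; apply/eqP/fro_eq0/le_anti.
rewrite fro_ge0 andbT.
have -> : 0 = fcst R n ^+ 2 * (expR (fro A) * expR (fro B) - expR (fro A + fro B)).
  by rewrite expRD subrr mulr0.
apply: (@fro_lim_le (fun N => mpart A N *m mpart B N - mpart (A + B) N) _
  (fun N => fcst R n ^+ 2 * (epart (fro A) N * epart (fro B) N - epart (fro A + fro B) N))).
- by apply: cvgB; [apply: cvg_mulmx; exact: mpart_cvg | exact: mpart_cvg].
- apply: cvgMr; apply: cvgB; last exact: epart_cvg.
  by apply: cvgM; exact: epart_cvg.
move=> N _.
have -> : mpart (A + B) N = \sum_(0 <= k < N) \sum_(0 <= i < k.+1) mterm A (k - i)%N * mterm B i.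
  apply: eq_bigr => k _; rewrite /mterm exprDn_comm // scaler_sumr big_mkord.
  apply: eq_bigr => i _; rewrite -[in RHS]mulmxE -scalemxAr -scalemxAl scalerA.
  have E : A ^+ (k - i) * B ^+ i *+ 'C(k, i) = 'C(k, i)%:R *: (A ^+ (k - i) *m B ^+ i).
    by rewrite scaler_nat.
  by rewrite E scalerA; congr (_ *: _); apply: bin_div_fact; rewrite -ltnS.
have -> : epart (fro A + fro B) N = \sum_(0 <= k < N) \sum_(0 <= i < k.+1)
    (fro A ^+ (k - i)%N / (k - i)`!%:R) * (fro B ^+ i / i`!%:R).
  apply: eq_bigr => k _; rewrite exprDn mulr_suml big_mkord.
  by apply: eq_bigr => i _; apply: binomial_term; rewrite -ltnS.
rewrite !cauchy_product mulr_sumr (le_trans (fro_sum _ _ _)) // ler_sum // => i _.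
rewrite mulr_sumr (le_trans (fro_sum _ _ _)) // ler_sum // => j _.
rewrite (le_trans (froM _ _)) // expr2 mulrACA.
by rewrite ler_pM // fro_mterm.
Qed.

Lemma expmxN A : expmx (- A) *m expmx A = 1%:M.
Proof. by rewrite -expmxD ?addNr ?expmx0 // mulNmx mulmxN. Qed.

Lemma expmxNr A : expmx A *m expmx (- A) = 1%:M.
Proof. by rewrite -[X in expmx X *m _]opprK expmxN. Qed.

Lemma expmx_unit A : expmx A \in unitmx.
Proof. by case/mulmx1_unit: (expmxN A). Qed.

Lemma expmx_inv A : invmx (expmx A) = expmx (- A).
Proof.
by apply: (can_inj (mulKmx (expmx_unit A))); rewrite mulmxV ?expmx_unit // expmxNr.
Qed.

Lemma expmxDZ (s t : R) A : expmx ((s + t)%:C *: A) = expmx (s%:C *: A) *m expmx (t%:C *: A).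
Proof.
rewrite rmorphD scalerDl; apply: expmxD.
by rewrite -(scalemxAl s%:C) -(scalemxAl t%:C) -(scalemxAr t%:C) -(scalemxAr s%:C) !scalerA mulrC.
Qed.

(** Asking f to be real-linear only covers the adjoint, which is conjugate-linear, together with
    conjugation by an invertible matrix. *)
Lemma expmx_morph (f : M -> M) (c : R) A : 0 < c -> {morph f : B C / B + C} ->
  (forall (r : R) B, f (r%:C *: B) = r%:C *: f B) ->
  (forall k, f (A ^+ k) = f A ^+ k) -> (forall B, fro (f B) <= c * fro B) ->
  f (expmx A) = expmx (f A).
Proof.
move=> c0 fD fZ fX fb.
have f0 : f 0 = 0 by have := fZ 0 0; rewrite !scale0r.
have fN B : f (- B) = - f B by apply/eqP; rewrite -addr_eq0 -fD addNr f0.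
have fm N : f (mpart A N) = mpart (f A) N.
  rewrite /mpart (big_morph f fD f0); apply: eq_bigr => k _.
  by rewrite !mtermE fZ fX.
suff H : mpart (f A) @ \oo --> f (expmx A) by rewrite (expmx_lim H).
have /cvg_fro H := @mpart_cvg A; apply/cvg_fro => e e0.
have [N HN] := H _ (divr_gt0 e0 c0); exists N => k kN.
rewrite -fm -fN -fD (le_lt_trans (fb _)) // mulrC -ltr_pdivlMr //; exact: HN.
Qed.

Lemma expmx_adj A : adj (expmx A) = expmx (adj A).
Proof.
apply: (@expmx_morph (@adj.body R n) 1) => //.
- by move=> B C; exact: adjD.
- by move=> r B; exact: adjZr.
- elim=> [|k IH]; first by rewrite !expr0 -[1]/(1%:M) adj1.
  by rewrite exprS exprSr -IH; exact: adjM.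
- by move=> B; rewrite fro_adj mul1r.
Qed.

Lemma expmx_conj V A : V \in unitmx -> expmx (V *m A *m invmx V) = V *m expmx A *m invmx V.
Proof.
move=> uV; symmetry.
apply: (@expmx_morph (fun B => V *m B *m invmx V) (fro V * fro (invmx V) + 1)) => //.
- by rewrite ltr_wpDl // mulr_ge0.
- by move=> B C; rewrite mulmxDr mulmxDl.
- by move=> r B; rewrite -scalemxAr -scalemxAl.
- elim=> [|k IH]; first by rewrite !expr0 -[1]/(1%:M) mulmx1 mulmxV.
  rewrite !exprS -IH -!mulmxE !mulmxA; congr (_ *m _); congr (_ *m _).
  by rewrite mulmxKV.
move=> B; rewrite (le_trans (froM _ _)) //.
rewrite (@le_trans _ _ (fro V * fro B * fro (invmx V))) // ?ler_wpM2r ?froM //.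
by rewrite mulrDl mul1r -mulrA [fro B * _]mulrC mulrA lerDl.
Qed.

Lemma Ad_expmx V A : V \in unitmx -> expmx (Ad V A) = Ad V (expmx A).
Proof. exact: expmx_conj. Qed.

Lemma expmx_comm A B : A *m B = B *m A -> expmx A *m B = B *m expmx A.
Proof.
move=> cAB.
have cP N : mpart A N *m B = B *m mpart A N.
  rewrite /mpart mulmx_suml mulmx_sumr; apply: eq_bigr => k _.
  rewrite /mterm -scalemxAl -scalemxAr; congr (_ *: _).
  elim: k => [|k IH]; first by rewrite !expr0 -[1]/(1%:M) mul1mx mulmx1.
  by rewrite exprS -mulmxE -mulmxA IH !mulmxA cAB.
have H1 : (fun N => mpart A N *m B) @ \oo --> expmx A *m B.
  by apply: cvg_mulmx; [exact: mpart_cvg | exact: cvg_cst].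
have H2 : (fun N => mpart A N *m B) @ \oo --> B *m expmx A.
  under eq_fun do rewrite cP.
  by apply: cvg_mulmx; [exact: cvg_cst | exact: mpart_cvg].
by rewrite -(cvg_lim (@M_hausdorff R n) H1) (cvg_lim (@M_hausdorff R n) H2).
Qed.

Lemma expmx_line_inj A B :
  (forall t : R, expmx (t%:C *: A) = expmx (t%:C *: B)) -> A = B.
Proof.
move=> H; apply/eqP; rewrite -subr_eq0; apply/negPn/negP => /fro_gt0 d0.
pose c := fro A + fro B + 1.
have c1 : 1 <= c by rewrite lerDr addr_ge0.
pose d := fro (A - B).
have key t : 0 < t -> d <= 2 * c * (expR (t * c) - 1).
  move=> t0; rewrite -(ler_pM2l t0).
  have bnd C : fro C <= c -> fro (expmx (t%:C *: C) - 1%:M - t%:C *: C) <= t * (c * (expR (t * c) - 1)).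
    move=> Cc; rewrite (le_trans (expmx_sub1 _)) // froZ gtr0_norm // -mulrA ler_wpM2l ?(ltW t0) //.
    have : expR (t * fro C) <= expR (t * c) by rewrite ler_expR ler_wpM2l // ltW.
    have := fro_ge0 C; have : 1 <= expR (t * fro C) by rewrite -expR0 ler_expR mulr_ge0 // ltW.
    nra.
  have := bnd A; have := bnd B; rewrite H => /(_ _)/wrap[|hB]; first by rewrite /c; have := fro_ge0 A; lra.
  move=> /(_ _)/wrap[|hA]; first by rewrite /c; have := fro_ge0 B; lra.
  have := fro_triangle (expmx (t%:C *: B) - 1%:M - t%:C *: B) 0 (expmx (t%:C *: B) - 1%:M - t%:C *: A).
  rewrite subr0 sub0r froN.
  have -> : expmx (t%:C *: B) - 1%:M - t%:C *: B - (expmx (t%:C *: B) - 1%:M - t%:C *: A) = t%:C *: (A - B).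
    by rewrite scalerBr opprB addrC addrA subrK.
  by rewrite froZ gtr0_norm // -/d; lra.
have x0 : 0 < d / (4 * c) by rewrite divr_gt0 // mulr_gt0 //; lra.
have cp : 0 < c by lra.
(* This t makes exp (t c) - 1 equal to d / (4 c), so that [key] reads d <= d / 2. *)
have := key (ln (1 + d / (4 * c)) / c); rewrite divfK ?gt_eqF // lnK; last by rewrite posrE; lra.
move=> /(_ _)/wrap[|]; first by rewrite divr_gt0 // ln_gt0 // ltrDl.
rewrite addrAC subrr add0r; have -> : 2 * c * (d / (4 * c)) = d / 2 by field; rewrite gt_eqF.
by rewrite /d; lra.
Qed.

Lemma expmxZnat A k : expmx (k%:R%:C *: A) = expmx A ^+ k.
Proof.
elim: k => [|k IH]; first by rewrite scale0r expmx0 expr0.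
by rewrite -addn1 natrD expmxDZ IH exprD expr1 scale1r.
Qed.

End MatrixExponential.

(** * Hermitian matrices and the polar decomposition *)

HB.lock Definition rdiag (R : realType) (n : nat) (d : 'I_n -> R) : 'M[R[i]]_n :=
  diag_mx (\row_j (d j)%:C).

Section HermitianExponential.
Variables (R : realType) (n : nat).
Local Notation M := 'M[R[i]]_n.
Implicit Types (A B V X Y : M) (e c : R).

Definition hermx A := adj A = A.

Lemma rdiagE (d : 'I_n -> R) i j : rdiag d i j = (d i)%:C *+ (i == j) :> R[i].
Proof. by rewrite rdiag.unlock !mxE; case: eqP => [->|]. Qed.

Lemma rdiag_mulE (d : 'I_n -> R) B i j : (rdiag d *m B) i j = (d i)%:C * B i j.
Proof. by rewrite rdiag.unlock mul_diag_mx !mxE. Qed.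

Lemma mul_rdiagE (d : 'I_n -> R) B i j : (B *m rdiag d) i j = (d j)%:C * B i j.
Proof. by rewrite rdiag.unlock mul_mx_diag !mxE mulrC. Qed.

Lemma hermx_spectral A : hermx A ->
  exists (V : M) (d : 'I_n -> R), V \is unitarymx /\ A = adj V *m rdiag d *m V.
Proof.
move=> hA.
have nA : A \is normalmx by apply/normalmxP; rewrite adj_def hA.
have /orthomx_spectralP := nA; set P := spectralmx A; set sp := spectral_diag A => E.
have uP : P \is unitarymx := spectral_unitarymx A.
rewrite invmx_unitary // adj_def in E.
have E2 : P *m A *m adj P = diag_mx sp.
  by rewrite E !mulmxA unitary_adj // mul1mx -mulmxA unitary_adj // mulmx1.
have spr j : sp 0 j = (complex.Re (sp 0 j))%:C.
  have : adj (diag_mx sp) = diag_mx sp by rewrite -E2 !adjM adjK hA mulmxA.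
  move/matrixP/(_ j j); rewrite adjE !mxE eqxx mulr1n.
  by case: (sp 0 j) => a b /= [] /eqP; rewrite -subr_eq0 -opprD oppr_eq0 -mulr2n mulrn_eq0 /= => /eqP ->.
exists P, (fun j => complex.Re (sp 0 j)); split=> //.
rewrite [LHS]E; congr (_ *m _ *m _); rewrite rdiag.unlock; congr diag_mx.
by apply/rowP => j; rewrite mxE -spr.
Qed.

Lemma rdiagX (d : 'I_n -> R) k : rdiag d ^+ k = rdiag (fun j => d j ^+ k).
Proof.
elim: k => [|k IH].
  rewrite expr0 -[1]/(1%:M); apply/matrixP => i j.
  by rewrite rdiagE !mxE expr0.
rewrite exprS IH -mulmxE; apply/matrixP => i j.
by rewrite rdiag_mulE !rdiagE exprS rmorphM mulrnAr.
Qed.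

Lemma expmx_rdiag (d : 'I_n -> R) : expmx (rdiag d) = rdiag (fun j => expR (d j)).
Proof.
suff H : mpart (rdiag d) @ \oo --> rdiag (fun j => expR (d j)).
  by exact: expmx_lim.
have E N : mpart (rdiag d) N = rdiag (fun j => epart (d j) N).
  apply/matrixP => i j; rewrite rdiagE /mpart summxE /epart rmorph_sum /= -sumrMnl.
  apply: eq_bigr => k _; rewrite mtermE rdiagX mxE rdiagE mulrnAr -rmorphM.
  by rewrite mulrC.
apply/cvg_fro => e e0.
have e1 : 0 < e / n.+1%:R by rewrite divr_gt0.
have : \forall N \near \oo, forall j, `|expR (d j) - epart (d j) N| < e / n.+1%:R.
  apply: filter_forall => j.
  by have /cvgrPdist_lt := @epart_cvg R (d j); apply.
move=> [N _ HN]; exists N => k /HN kN; rewrite E.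
apply: (@le_lt_trans _ _ (n%:R * (e / n.+1%:R))); last first.
  by rewrite mulrCA gtr_pMr // ltr_pdivrMr // mul1r ltr_nat.
apply: fro_le_entries => [|i j]; first exact: ltW.
rewrite mx_subE !rdiagE -mulrnBl; case: eqP => [->|_]; last first.
  by rewrite mulr0n /sqn /= expr0n /= addr0 exprn_ge0 // ltW.
rewrite mulr1n -rmorphB /sqn /= expr0n addr0.
by rewrite -[leLHS]real_normK ?num_real // ler_pXn2r ?nnegrE // ?(ltW e1) // distrC ltW.
Qed.

Lemma expmx_spectral V d : V \is unitarymx ->
  expmx (adj V *m rdiag d *m V) = adj V *m rdiag (fun j => expR (d j)) *m V.
Proof.
move=> uV; have uA := adj_unitary uV.
have iV : invmx (adj V) = V by rewrite invmx_unitary // adj_def adjK.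
by rewrite -expmx_rdiag -{2}iV expmx_conj ?unitarymx_unit // iV.
Qed.

Lemma fro_spectral V d : V \is unitarymx ->
  fro (adj V *m rdiag d *m V) ^+ 2 = \sum_j d j ^+ 2.
Proof.
move=> uV; rewrite fro_unitr // fro_unitl ?adj_unitary // sqr_fro dot_sqn.
apply: eq_bigr => i _; rewrite (bigD1 i) //= big1 => [|j ji].
  by rewrite rdiagE eqxx /sqn /= expr0n /= !addr0.
by rewrite rdiagE eq_sym (negbTE ji) /sqn /= expr0n /= addr0.
Qed.

Lemma spectral_le_fro V d j : V \is unitarymx -> `|d j| <= fro (adj V *m rdiag d *m V).
Proof.
move=> uV; rewrite -(@ler_pXn2r _ 2) ?nnegrE // fro_spectral // real_normK ?num_real //.
by rewrite (bigD1 j) //= lerDl sumr_ge0 // => k _; rewrite sqr_ge0.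
Qed.

(** The derivative of exp is at least exp (- c) on [- c, c]. *)
Lemma expR_lower_lipschitz (a b c : R) : `|a| <= c -> `|b| <= c ->
  `|a - b| <= expR c * `|expR a - expR b|.
Proof.
wlog ab : a b / b <= a.
  move=> H ac bc; have [/H|/ltW /H] := leP b a; first exact.
  by rewrite distrC [X in _ * X]distrC; exact.
move=> _; rewrite ler_norml => /andP[bc _].
rewrite !ger0_norm ?subr_ge0 ?ler_expR //.
have -> : expR a = expR b * expR (a - b) by rewrite -expRD addrC subrK.
have h1 := expR_ge1Dx (a - b); have h2 := expR_gt0 b.
have h3 : 1 <= expR c * expR b by rewrite -expRD -expR0 ler_expR; lra.
have h4 : 0 <= a - b by lra.
have -> : expR c * (expR b * expR (a - b) - expR b)
  = (expR c * expR b) * (expR (a - b) - 1) by ring.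
move: (a - b) (expR c * expR b) h1 h3 h4 => x y; move: (expR x) => z; nra.
Qed.

Lemma le_of_sqr (x y : R) : 0 <= y -> x ^+ 2 <= y ^+ 2 -> x <= y.
Proof.
move=> y0 H; rewrite (le_trans (ler_norm x)) // -(@ler_pXn2r _ 2) ?nnegrE //.
by rewrite real_normK ?num_real.
Qed.

(** In eigenbases of X and Y, the map sending B to X B - B Y multiplies the entry (i, j) by d_i -
    d'_j, so the scalar inequality applies entrywise. Leaving B free gives at once that exp is
    injective on Hermitian matrices, that its inverse is Lipschitz, and that what commutes with exp
    X commutes with X. *)
Lemma hermx_exp_lower X Y B c : hermx X -> hermx Y -> fro X <= c -> fro Y <= c ->
  fro (X *m B - B *m Y) <= expR c * fro (expmx X *m B - B *m expmx Y).
Proof.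
move=> /hermx_spectral [V [d [uV ->]]] /hermx_spectral [W [d' [uW ->]]] Xc0 Yc0.
have Xc j := le_trans (spectral_le_fro d j uV) Xc0.
have Yc j := le_trans (spectral_le_fro d' j uW) Yc0.
rewrite !expmx_spectral //.
have E (p q : 'I_n -> R) : fro (adj V *m rdiag p *m V *m B - B *m (adj W *m rdiag q *m W))
   = fro (rdiag p *m (V *m B *m adj W) - (V *m B *m adj W) *m rdiag q).
  rewrite -(fro_unitl _ uV) -(fro_unitr _ (adj_unitary uW)) mulmxBr mulmxBl.
  by rewrite !mulmxA unitary_adj // mul1mx -(mulmxA _ W) unitary_adj // mulmx1.
rewrite [leLHS]E [X in _ <= _ * X]E.
clear E Xc0 Yc0; apply: le_of_sqr.
  by apply: mulr_ge0; [exact: expR_ge0 | exact: fro_ge0].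
rewrite exprMn [X in X <= _]sqr_fro [X in _ <= _ * X]sqr_fro !dot_sqn.
rewrite mulr_sumr ler_sum // => i _; rewrite mulr_sumr ler_sum // => j _.
have sq (p q : R) z : sqn (p%:C * z - q%:C * z) = (p - q) ^+ 2 * sqn z.
  by rewrite -mulrBl -rmorphB; case: z => a b; rewrite /sqn /=; ring.
rewrite !mx_subE !rdiag_mulE !mul_rdiagE !sq.
rewrite mulrA ler_wpM2r // -exprMn.
rewrite -[leLHS]real_normK ?num_real // -[leRHS]real_normK ?num_real //.
rewrite ler_pXn2r ?nnegrE // normrM (ger0_norm (expR_ge0 _)).
by apply: expR_lower_lipschitz; [exact: Xc | exact: Yc].
Qed.

Lemma hermx_exp_intertwine X Y B : hermx X -> hermx Y ->
  expmx X *m B = B *m expmx Y -> X *m B = B *m Y.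
Proof.
move=> hX hY E; apply/eqP; rewrite -subr_eq0; apply/eqP/fro_eq0/le_anti.
rewrite fro_ge0 andbT.
have := @hermx_exp_lower X Y B (fro X + fro Y) hX hY; rewrite lerDl lerDr.
by move=> /(_ (fro_ge0 _) (fro_ge0 _)); rewrite E subrr fro0 mulr0.
Qed.

Lemma hermx_exp_inj X Y : hermx X -> hermx Y -> expmx X = expmx Y -> X = Y.
Proof.
move=> hX hY E; have := @hermx_exp_intertwine X Y 1%:M hX hY.
by rewrite !mulmx1 !mul1mx E; exact.
Qed.

Lemma Re_tr_le A : complex.Re (\tr A) <= Num.sqrt n%:R * fro A.
Proof.
by have := dot_le A 1%:M; rewrite dotE adj1 mulmx1 fro1 mulrC.
Qed.

Lemma hermxN X : hermx X -> hermx (- X).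
Proof. by move=> hX; rewrite /hermx adjN hX. Qed.

Lemma hermxZ (r : R) X : hermx X -> hermx (r%:C *: X).
Proof. by move=> hX; rewrite /hermx adjZr hX. Qed.

Lemma hermx_expmx X : hermx X -> hermx (expmx X).
Proof. by move=> hX; rewrite /hermx expmx_adj hX. Qed.

(** Each eigenvalue x satisfies x^2 <= 4 (exp x + exp (- x)), and the traces of exp X and exp (- X)
    sum these exponentials. The point is to bound X from exp X and its inverse. *)
Lemma fro_hermx_le X : hermx X ->
  fro X ^+ 2 <= 4 * (Num.sqrt n%:R * (fro (expmx X) + fro (expmx (- X)))).
Proof.
move=> hX.
have : fro X ^+ 2 <= 4 * (complex.Re (\tr (expmx X)) + complex.Re (\tr (expmx (- X)))).
  have [V [d [uV ->]]] := hermx_spectral hX.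
  have -> : - (adj V *m rdiag d *m V) = adj V *m rdiag (fun j => - d j) *m V.
    rewrite -mulNmx -mulmxN; congr (_ *m _ *m _).
    by apply/matrixP => i j; rewrite mxE !rdiagE rmorphN mulNrn.
  rewrite !expmx_spectral // fro_spectral //.
  have trE (p : 'I_n -> R) : complex.Re (\tr (adj V *m rdiag p *m V)) = \sum_j p j.
    rewrite mxtrace_mulC mulmxA unitary_adj // mul1mx /mxtrace Re_sum.
    by apply: eq_bigr => j _; rewrite rdiagE eqxx.
  rewrite !trE -big_split mulr_sumr ler_sum // => j _ /=.
  wlog dj : j d {hX uV trE} / 0 <= d j.
    move=> H; have [/H//|/ltW dj] := leP 0 (d j).
    by have := H j (fun k => - d k); rewrite opprK oppr_ge0 sqrrN addrC; exact.
  have -> : expR (d j) = expR (d j / 2) ^+ 2 by rewrite expr2 -expRD -splitr.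
  by have := expR_ge1Dx (d j / 2); have := expR_gt0 (- d j); nra.
have := Re_tr_le (expmx X); have := Re_tr_le (expmx (- X)).
move: (complex.Re _) (complex.Re _) (fro _) (fro _) => a b c d; lra.
Qed.

Lemma polar_bound k X : k \is unitarymx -> hermx X ->
  fro X ^+ 2 <= 4 * (Num.sqrt n%:R * (fro (k *m expmx X) + fro (invmx (k *m expmx X)))).
Proof.
move=> uk hX.
have -> : invmx (k *m expmx X) = expmx (- X) *m adj k.
  rewrite -expmx_inv; have uk' := unitarymx_unit uk.
  have uu : k *m expmx X \in unitmx by rewrite unitmx_mul uk' expmx_unit.
  apply: (can_inj (mulKmx uu)); rewrite mulmxV // !mulmxA mulmxK ?expmx_unit //.
  by rewrite unitary_adj.
by rewrite (fro_unitl _ uk) (fro_unitr _ (adj_unitary uk)); exact: fro_hermx_le.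
Qed.

End HermitianExponential.

(** * Lie algebras of closed matrix groups *)

Section PolarDecomposition.
Variables (R : realType) (n : nat).
Local Notation M := 'M[R[i]]_n.
Implicit Types (A B V X Y g h k : M) (e c : R).

Lemma fro_invmx_near g h : g \in unitmx -> h \in unitmx ->
  fro (g - h) * fro (invmx h) <= 2^-1 -> fro (invmx g) <= 2 * fro (invmx h).
Proof.
move=> ug uh H.
have E : invmx g = invmx h - invmx g *m (g - h) *m invmx h.
  by rewrite mulmxBr mulVmx // mulmxBl mul1mx -mulmxA mulmxV // mulmx1 opprB addrC subrK.
have := froB (invmx h) (invmx g *m (g - h) *m invmx h); rewrite -E.
have := froM (invmx g *m (g - h)) (invmx h); have := froM (invmx g) (g - h).
have := fro_ge0 (invmx g); have := fro_ge0 (invmx h).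
by move: (fro (invmx g)) (fro (invmx h)) (fro (g - h)) (fro _) (fro _) H => x y z v w; nra.
Qed.

Lemma polar_sqr k X : k \is unitarymx -> hermx X ->
  adj (k *m expmx X) *m (k *m expmx X) = expmx (X + X).
Proof.
move=> uk hX; rewrite adjM (hermx_expmx hX) mulmxA -(mulmxA _ (adj k)).
by rewrite unitary_adjl // mulmx1 expmxD.
Qed.

Lemma polar_unit k X : k \is unitarymx -> k *m expmx X \in unitmx.
Proof. by move=> uk; rewrite unitmx_mul unitarymx_unit // expmx_unit. Qed.

Lemma hermxD X Y : hermx X -> hermx Y -> hermx (X + Y).
Proof. by move=> hX hY; rewrite /hermx adjD hX hY. Qed.

Lemma polar_inj k k' X X' : k \is unitarymx -> k' \is unitarymx -> hermx X -> hermx X' ->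
  k *m expmx X = k' *m expmx X' -> k = k' /\ X = X'.
Proof.
move=> uk uk' hX hX' E.
have XX : X = X'.
  have : X + X = X' + X'.
    apply: hermx_exp_inj; [exact: hermxD | exact: hermxD |].
    by rewrite -(polar_sqr uk hX) -(polar_sqr uk' hX') E.
  by move/eqP; rewrite -!mulr2n -subr_eq0 -mulrnBl -scaler_nat scaler_eq0 pnatr_eq0 /= subr_eq0 => /eqP.
split=> //; move: E; rewrite XX => /(congr1 (mulmx^~ (invmx (expmx X')))).
by rewrite !mulmxK ?expmx_unit.
Qed.

(** 2 X is the logarithm of the adjoint of g times g. [polar_bound] keeps X bounded near g0, where
    [hermx_exp_lower] with B = 1 is a Lipschitz bound for that logarithm; then k = g exp (- X)
    follows. *)
Lemma polar_continuous k0 X0 e : k0 \is unitarymx -> hermx X0 -> 0 < e ->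
  exists2 d, 0 < d & forall k X, k \is unitarymx -> hermx X ->
    fro (k *m expmx X - k0 *m expmx X0) < d -> fro (k - k0) < e /\ fro (X - X0) < e.
Proof.
move=> uk0 hX0 e0.
pose g0 := k0 *m expmx X0.
have ug0 : g0 \in unitmx by exact: polar_unit.
pose b := fro g0; pose b' := fro (invmx g0).
have b0 : 0 <= b by exact: fro_ge0.
have b0' : 0 <= b' by exact: fro_ge0.
(* The bound that [polar_bound] gives for X when g has norm at most b + 1 and its inverse has norm
   at most 2 b'. *)
pose C := Num.sqrt (4 * (Num.sqrt n%:R * (b + 1 + 2 * b'))).
have C0 : 0 <= C by exact: sqrtr_ge0.
pose c := 2 * C + 2 * fro X0.
have [d1 d10 Hd1] : exists2 d, 0 < d & forall B, fro (B - - X0) < d ->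
    fro (expmx B - expmx (- X0)) < e / (2 * (b + 1)).
  by apply: expmx_near; rewrite divr_gt0 // mulr_gt0 //; lra.
have E0 := expR_gt0 c.
pose e2 := Num.min e d1.
have e20 : 0 < e2 by rewrite lt_min e0.
pose d := Num.min (Num.min 1 (1 / (2 * (b' + 1)))) (Num.min (e2 / (expR c * (2 * b + 1))) (e / (2 * (2 * b' + 1)))).
have d0 : 0 < d.
  by rewrite !lt_min ltr01 !divr_gt0 // ?mulr_gt0 //; lra.
exists d => // k X uk hX; set g := k *m expmx X; rewrite -/g0.
rewrite !lt_min => /andP[/andP[g1 g2] /andP[g3 g4]].
have ug : g \in unitmx by exact: polar_unit.
have gi : fro (invmx g) <= 2 * b'.
  apply: fro_invmx_near => //; rewrite -/b'.
  move: g2; rewrite ltr_pdivlMr ?mulr_gt0 ?ltr_wpDl //.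
  by have := fro_ge0 (g - g0); move: (fro (g - g0)) => x; nra.
have gb : fro g <= b + 1.
  by have := fro_lerB g g0; rewrite -/b; move: (fro g) (fro (g - g0)) g1 => x y; lra.
have XC : fro X <= C.
  rewrite -(@ler_pXn2r _ 2) ?nnegrE // sqr_sqrtr; last first.
    by rewrite !mulr_ge0 ?sqrtr_ge0 // !addr_ge0 // mulr_ge0.
  apply: (le_trans (polar_bound uk hX)); rewrite -/g.
  rewrite ler_pM2l // ler_wpM2l ?sqrtr_ge0 //; exact: lerD.
have Xc : fro (X + X) <= c.
  by have := froD X X; have := fro_ge0 X0; rewrite /c; move: (fro X) (fro X0) (fro _) XC => x y z; lra.
have X0c : fro (X0 + X0) <= c.
  by have := froD X0 X0; rewrite /c; move: (fro X0) (fro _) => x y; lra.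
have XX : fro (X - X0) < e2.
  have := hermx_exp_lower 1%:M (hermxD hX hX) (hermxD hX0 hX0) Xc X0c.
  rewrite !mulmx1 !mul1mx -(polar_sqr uk hX) -(polar_sqr uk0 hX0) -/g -/g0.
  have -> : X + X - (X0 + X0) = 2%:C *: (X - X0).
    by rewrite -[2]/(1 + 1) rmorphD scalerDl !scale1r opprD addrACA.
  rewrite froZ ger0_norm //.
  have -> : adj g *m g - adj g0 *m g0 = adj g *m (g - g0) + adj (g - g0) *m g0.
    by rewrite mulmxBr adjB mulmxBl addrA subrK.
  have := froD (adj g *m (g - g0)) (adj (g - g0) *m g0).
  have := froM (adj g) (g - g0); have := froM (adj (g - g0)) g0; rewrite !fro_adj -/b.
  move: g3; rewrite ltr_pdivlMr ?mulr_gt0 //; last by lra.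
  move: (fro _) (fro _) (fro _) (fro g) gb (fro (X - X0)) (fro (g - g0)) (fro_ge0 (g - g0)) => w y z v vb u x x0 h1 h2 h3 h4 h5.
  have h6 : w <= x * (2 * b + 1) by nra.
  have := ler_wpM2l (ltW E0) h6; move: (expR c) h1 h5 E0 => q; nra.
move: XX; rewrite lt_min => /andP[Xe Xd]; split=> //.
have kE : k = g *m expmx (- X) by rewrite /g -mulmxA expmxNr mulmx1.
have k0E : k0 = g0 *m expmx (- X0) by rewrite /g0 -mulmxA expmxNr mulmx1.
have fX : fro (expmx (- X)) <= 2 * b'.
  have -> : expmx (- X) = invmx g *m k.
    by apply: (can_inj (mulKmx ug)); rewrite mulKVmx // -kE.
  by rewrite fro_unitr.
have hX1 : fro (expmx (- X) - expmx (- X0)) < e / (2 * (b + 1)).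
  apply: Hd1; have -> : - X - - X0 = - (X - X0) by rewrite opprB opprK addrC.
  by rewrite froN.
have -> : k - k0 = (g - g0) *m expmx (- X) + g0 *m (expmx (- X) - expmx (- X0)).
  by rewrite mulmxBr mulmxBl addrA subrK -kE -k0E.
have := froD ((g - g0) *m expmx (- X)) (g0 *m (expmx (- X) - expmx (- X0))).
have := froM (g - g0) (expmx (- X)); have := froM g0 (expmx (- X) - expmx (- X0)); rewrite -/b.
move: g4 hX1; rewrite !ltr_pdivlMr ?mulr_gt0 //; [|lra|lra].
have := fro_ge0 (g - g0); have := fro_ge0 (expmx (- X) - expmx (- X0)).
move: (fro _) (fro _) (fro _) (fro (expmx (- X))) fX (fro (expmx (- X) - _)) (fro (g - g0)) => w u v y yb z x.
nra.
Qed.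

End PolarDecomposition.

(** * Lie algebras of closed subgroups and the exponential near 1 *)

Section LieAlgebra.
Variables (R : realType) (n : nat).
Local Notation M := 'M[R[i]]_n.
Implicit Types (A B D V X Y g h : M) (e c : R) (H : set M).

Lemma lieP H X : lie H X <-> forall t : R, H (expmx (t%:C *: X)).
Proof. by split=> h t; have := h t; rewrite expmxE. Qed.

Lemma lie_expmx H X : lie H X -> H (expmx X).
Proof. by move=> /lieP /(_ 1); rewrite scale1r. Qed.

(** Closedness relative to GL(n, C): the closure in M may contain singular matrices. *)
Definition closedGL H := forall g, g \in unitmx -> closure H g -> H g.

Lemma expR_sub1_le (x : R) : expR x - 1 <= x * expR x.
Proof.
have E : expR (- x) * expR x = 1 by rewrite -expRD addNr expR0.
have := expR_ge1Dx (- x); have := expR_gt0 x; move: (expR (- x)) (expR x) E => y z; nra.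
Qed.

Lemma fro_expmx_sub1 A : fro (expmx A - 1%:M) <= fro A * expR (fro A).
Proof.
have := expmx_sub1 A; have := froD (expmx A - 1%:M - A) A; rewrite subrK.
by move: (fro _) (fro _) (fro A) => x y z; lra.
Qed.

(** Telescoping: m errors 1 + A - exp A, each of second order in A, transported by factors 1 + A and
    exp A. *)
Lemma fro_pow_exp A m : fro A <= 1 ->
  fro ((1%:M + A) ^+ m - expmx A ^+ m)
  <= m%:R * expR (m%:R * (fro A * expR 1)) * (fro A * (fro A * expR 1)).
Proof.
set a := fro A => a1.
have a0 : 0 <= a by exact: fro_ge0.
have e1 : 1 <= expR 1 :> R by rewrite -expR0 ler_expR.
have ea : expR a <= expR 1 by rewrite ler_expR.
(* Multiplying by 1 + A or by exp A increases [fro] at most by the factor q; bounding through the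
   norms of these matrices would bring in the sqrt n of the identity at every step. *)
pose q := expR (a * expR 1).
have q1 : 1 + a * expR 1 <= q by exact: expR_ge1Dx.
have q0 : 0 < q by exact: expR_gt0.
have qa : 1 + a <= q by rewrite (le_trans _ q1) // lerD2l ler_peMr.
have qm (j : nat) : expR (j%:R * (a * expR 1)) = q ^+ j by rewrite mulrC expRM_natr.
have PY Y : fro ((1%:M + A) *m Y) <= q * fro Y.
  rewrite mulmxDl mul1mx; have := froD Y (A *m Y); have := froM A Y; rewrite -/a.
  by have := fro_ge0 Y; move: (fro _) (fro _) (fro Y) => x y z; nra.
have YQ Y : fro (Y *m expmx A) <= q * fro Y.
  have -> : Y *m expmx A = Y + Y *m (expmx A - 1%:M) by rewrite mulmxBr mulmx1 addrC subrK.
  have := froD Y (Y *m (expmx A - 1%:M)); have := froM Y (expmx A - 1%:M).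
  have z1 : fro (expmx A - 1%:M) <= q - 1.
    rewrite (le_trans (fro_expmx_sub1 A)) // -/a lerBrDl (le_trans _ q1) // lerD2l.
    by rewrite ler_wpM2l.
  have := ler_wpM2l (fro_ge0 Y) z1.
  move: (fro _) (fro (Y *m _)) (fro (expmx A - _)) (fro Y) => x y z w; lra.
have PQ : fro (1%:M + A - expmx A) <= a * (a * expR 1).
  rewrite fro_distC opprD addrA (le_trans (expmx_sub1 A)) // -/a ler_wpM2l //.
  by rewrite (le_trans (expR_sub1_le a)) // ler_wpM2l.
have d0 : 0 <= a * (a * expR 1) by rewrite !mulr_ge0 // expR_ge0.
rewrite qm; elim: m => [|m IH].
  by rewrite !expr0 subrr fro0 !mul0r.
have YQm Y : fro (Y *m expmx A ^+ m) <= q ^+ m * fro Y.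
  elim: (m) => [|j IHj]; first by rewrite !expr0 mul1r -[1]/(1%:M) mulmx1.
  rewrite exprSr -mulmxE mulmxA (le_trans (YQ _)) // exprS -mulrA ler_wpM2l //.
  exact: ltW.
have -> : (1%:M + A) ^+ m.+1 - expmx A ^+ m.+1
    = (1%:M + A) *m ((1%:M + A) ^+ m - expmx A ^+ m) + (1%:M + A - expmx A) *m expmx A ^+ m.
  by rewrite !exprS -!mulmxE mulmxBr (mulmxBl (1%:M + A)) addrA subrK.
apply: (le_trans (froD _ _)); rewrite -natr1 mulrDl mulrDl mul1r; apply: lerD.
  apply: (le_trans (PY _)); rewrite exprS.
  apply: (le_trans (ler_wpM2l (ltW q0) IH)).
  by rewrite le_eqVlt; apply/orP; left; apply/eqP; ring.
apply: (le_trans (YQm _)); rewrite exprS -mulrA.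
apply: (@le_trans _ _ (q ^+ m * (a * (a * expR 1)))).
  by rewrite ler_wpM2l // exprn_ge0 // ltW.
rewrite ler_peMl ?mulr_ge0 ?exprn_ge0 // ?(ltW q0) //.
by rewrite (le_trans _ q1) // lerDl mulr_ge0 // expR_ge0.
Qed.

Lemma subgroup_exp H g m : is_subgroup H -> H g -> H (g ^+ m).
Proof.
move=> [_ H1 HM _] Hg; elim: m => [|m IH]; first by rewrite expr0.
by rewrite exprS; exact: HM.
Qed.

(** Write w = 1 + E with s E close to D. For m the integer part of t s, w^m is close to exp (m E),
    hence to exp (t D), which lies in H because H is closed. Negative t follow by inversion. *)
Lemma lie_limit H D : is_subgroup H -> closedGL H ->
  (forall e, 0 < e -> exists w (s : R), [/\ H w, 0 < s, fro (w - 1%:M) < e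
     & fro (s%:C *: (w - 1%:M) - D) < e]) -> lie H D.
Proof.
move=> sH cH Hlim; apply/lieP.
suff pos (t : R) : 0 <= t -> H (expmx (t%:C *: D)).
  move=> t; have [/pos//|/ltW t0] := leP 0 t.
  have /pos : 0 <= - t by rewrite oppr_ge0.
  case: sH => _ _ _ HI /HI; rewrite expmx_inv rmorphN scaleNr opprK //.
move=> t0; apply: cH; first exact: expmx_unit.
apply/closure_fro => e e0.
have e20 : 0 < e / 2 by rewrite divr_gt0.
have [d d0 Hd] := expmx_near (t%:C *: D) e20.
pose K := t * (fro D + 1).
have K0 : 0 <= K by rewrite mulr_ge0 // addr_ge0.
pose Q := K * expR (K * expR 1) * expR 1.
have Q0 : 0 <= Q by apply: mulr_ge0; [apply: mulr_ge0 => //; exact: expR_ge0 | exact: expR_ge0].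
(* When E and s E - D have norm below x, [fro_pow_exp] costs at most Q times the norm of E, less
   than e / 2; and m E - t D, which is t (s E - D) up to a fractional multiple of E, stays below
   d. *)
pose x := Num.min (Num.min 1 (d / (1 + t))) (e / 2 / (Q + 1)).
have x0 : 0 < x by rewrite !lt_min ltr01 !divr_gt0 //; lra.
have [w [s [Hw s0 w1 wD]]] := Hlim x x0.
move: w1 wD; rewrite /x !lt_min => /andP[/andP[w1 w2] w3] /andP[/andP[D1 D2] D3].
pose m := Num.truncn (t * s).
have ts0 : 0 <= t * s by rewrite mulr_ge0 // ltW.
have /andP[m1 m2] := truncn_itv ts0; rewrite -/m in m1 m2.
exists (w ^+ m); first exact: subgroup_exp.
have [E EE] : exists E : M, E = w - 1%:M by exists (w - 1%:M).
rewrite -EE in w1 w2 w3 D1 D2 D3.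
have wE : w = 1%:M + E by rewrite EE addrC subrK.
have sE : s * fro E <= fro D + 1.
  have := fro_lerB (s%:C *: E) D; rewrite froZ gtr0_norm //.
  move: (fro _) (s * _) (fro D) D1 => u v q; lra.
have mE : m%:R * fro E <= K.
  rewrite /K (le_trans (ler_wpM2r (fro_ge0 E) m1)) // -mulrA ler_wpM2l //.
have p1 : fro (w ^+ m - expmx E ^+ m) < e / 2.
  rewrite wE (le_lt_trans (fro_pow_exp m (ltW w1))) //.
  have h1 : expR (m%:R * (fro E * expR 1)) <= expR (K * expR 1).
    by rewrite ler_expR mulrA ler_wpM2r ?expR_ge0.
  move: w3; rewrite ltr_pdivlMr; last by lra.
  move: h1 mE; have := expR_gt0 (m%:R * (fro E * expR 1)); have := fro_ge0 E.
  have := expR_gt0 (1 : R); rewrite /Q.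
  have : 0 <= m%:R :> R by [].
  move: (m%:R) (fro E) (expR 1) (expR (K * _)) (expR (m%:R * _)) => mm a e1 Y y mm0 e10 a0 y0 yY ma aQ.
  have h2 : mm * a * y <= K * Y by apply: ler_pM => //; [exact: mulr_ge0 | exact: ltW].
  have h3 : mm * a * y * (a * e1) <= K * Y * (a * e1) by rewrite ler_wpM2r // mulr_ge0 // ltW.
  have -> : mm * y * (a * (a * e1)) = mm * a * y * (a * e1) by ring.
  have h4 : K * Y * (a * e1) = a * (K * Y * e1) by ring.
  nra.
have p2 : fro (expmx E ^+ m - expmx (t%:C *: D)) < e / 2.
  rewrite -expmxZnat; apply: Hd.
  have -> : (m%:R)%:C *: E - t%:C *: D = t%:C *: (s%:C *: E - D) - (t * s - m%:R)%:C *: E.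
    by rewrite scalerBr scalerA -rmorphM rmorphB scalerBl opprB [RHS]addrC addrA subrK.
  rewrite (le_lt_trans (froB _ _)) // !froZ ger0_norm // ger0_norm; last by lra.
  move: w2 D2; rewrite !ltr_pdivlMr; [|lra|lra].
  have h : (t * s - m%:R) * fro E <= fro E.
    by rewrite ler_piMl //; move: m2; rewrite -natr1; lra.
  move: (fro E) (fro_ge0 E) (fro (s%:C *: E - D)) (fro_ge0 (s%:C *: E - D)) h => a a0 y y0 h; move: (_ * a) h => b; nra.
have := fro_triangle (w ^+ m) (expmx E ^+ m) (expmx (t%:C *: D)).
by move: (fro _) (fro _) (fro _) p1 p2 => *; lra.
Qed.

Lemma lie0 H : is_subgroup H -> lie H 0.
Proof. by move=> [_ H1 _ _]; apply/lieP => t; rewrite scaler0 expmx0. Qed.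

Lemma lieZ H (a : R) X : lie H X -> lie H (a%:C *: X).
Proof. by move=> /lieP hX; apply/lieP => t; rewrite scalerA -rmorphM; exact: hX. Qed.

Lemma trotter_bound X Y (h c : R) : 0 < h -> h <= 1 -> c = fro X + fro Y ->
  fro (expmx (h%:C *: X) *m expmx (h%:C *: Y) - 1%:M - h%:C *: (X + Y))
  <= h * (h * (3 * c ^+ 2 * expR c ^+ 2)).
Proof.
move=> h0 h1 cE.
have x0 := fro_ge0 X; have y0 := fro_ge0 Y.
have c0 : 0 <= c by rewrite cE addr_ge0.
have ec : 1 <= expR c by rewrite -expR0 ler_expR.
have bnd (Z : M) : fro Z <= c -> fro (expmx (h%:C *: Z) - 1%:M - h%:C *: Z) <= h * (h * (c ^+ 2 * expR c)).
  move=> Zc; have z0 := fro_ge0 Z.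
  have hz : fro (h%:C *: Z) = h * fro Z by rewrite froZ gtr0_norm.
  apply: (le_trans (expmx_sub1 _)); rewrite hz -mulrA ler_wpM2l ?(ltW h0) //.
  have := expR_sub1_le (h * fro Z).
  have : expR (h * fro Z) <= expR c by rewrite ler_expR (le_trans _ Zc) // ler_piMl.
  have := expR_gt0 (h * fro Z).
  move: (expR (h * fro Z)) (expR c) ec => u w w1 u0 uw ub.
  have h2 : u - 1 <= h * c * w.
    rewrite (le_trans ub) // ler_pM // ?mulr_ge0 // ?(ltW h0) ?(ltW u0) //.
    by rewrite ler_wpM2l // ltW.
  have h3 : 0 <= h * c * w by rewrite !mulr_ge0 // ?(ltW h0) // (le_trans ler01).
  have := ler_wpM2l z0 h2; have := ler_wpM2r h3 Zc; nra.
have bnd1 (Z : M) : fro Z <= c -> fro (expmx (h%:C *: Z) - 1%:M) <= h * (c * expR c).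
  move=> Zc; apply: (le_trans (fro_expmx_sub1 _)).
  rewrite froZ gtr0_norm // -mulrA ler_wpM2l ?(ltW h0) //.
  rewrite ler_pM // ?expR_ge0 // ler_expR (@le_trans _ _ (fro Z)) //.
  by rewrite ler_piMl.
have Xc : fro X <= c by rewrite cE lerDl.
have Yc : fro Y <= c by rewrite cE lerDr.
move: (bnd X Xc) (bnd Y Yc) (bnd1 X Xc) (bnd1 Y Yc) => {bnd bnd1}.
have [p ->] : exists p : M, expmx (h%:C *: X) = 1%:M + p.
  by exists (expmx (h%:C *: X) - 1%:M); rewrite addrC subrK.
have [q ->] : exists q : M, expmx (h%:C *: Y) = 1%:M + q.
  by exists (expmx (h%:C *: Y) - 1%:M); rewrite addrC subrK.
have K (r : M) : 1%:M + r - 1%:M = r by rewrite addrC addKr.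
rewrite !K => hX hY p1 q1.
have -> : (1%:M + p) *m (1%:M + q) - 1%:M - h%:C *: (X + Y)
   = (p - h%:C *: X) + (q - h%:C *: Y) + p *m q.
  rewrite mulmxDl mul1mx mulmxDr mulmx1 -[1%:M + q + _]addrA K scalerDr opprD.
  by rewrite [q + (p + _)]addrA [q + p]addrC [X in _ = X + _]addrACA [RHS]addrAC.
apply: (le_trans (froD _ _)).
apply: (@le_trans _ _ (h * (h * (c ^+ 2 * expR c)) + h * (h * (c ^+ 2 * expR c))
   + (h * (c * expR c)) * (h * (c * expR c)))).
  apply: lerD; first by apply: (le_trans (froD _ _)); exact: lerD.
  by apply: (le_trans (froM _ _)); apply: ler_pM.
have -> : (h * (c * expR c)) * (h * (c * expR c)) = h * (h * (c ^+ 2 * expR c ^+ 2)) by ring.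
rewrite -!mulrDr !ler_pM2l //.
have := sqr_ge0 c; move: (c ^+ 2) (expR c) ec => d w w1 d0; have : d * w <= d * w ^+ 2.
  by rewrite expr2 mulrA ler_peMr // mulr_ge0 // (le_trans ler01).
lra.
Qed.

(** X + Y is the limit of (w - 1) / h for w = exp (h X) exp (h Y) as h tends to 0. *)
Lemma lieD H X Y : is_subgroup H -> closedGL H -> lie H X -> lie H Y -> lie H (X + Y).
Proof.
move=> sH cH hX hY; apply: lie_limit => // e e0.
have [c Ec] : exists c, c = fro X + fro Y by eexists.
have c0 : 0 <= c by rewrite Ec addr_ge0.
pose K := 3 * c ^+ 2 * expR c ^+ 2.
have K0 : 0 <= K by rewrite /K; apply: mulr_ge0; [apply: mulr_ge0 => //|]; exact: sqr_ge0.
have [h [h0 h1 hK]] : exists h : R, [/\ 0 < h, h <= 1 & h * (K + c) < e].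
  exists (Num.min 1 (e / (K + c + 1))); split.
  - by rewrite lt_min ltr01 divr_gt0 //; lra.
  - by rewrite ge_min lexx.
  apply: (@le_lt_trans _ _ (e / (K + c + 1) * (K + c))).
    by rewrite ler_wpM2r ?addr_ge0 // ge_min lexx orbT.
  by rewrite -mulrA gtr_pMr // mulrC ltr_pdivrMr; lra.
have B := trotter_bound h0 h1 Ec; rewrite -/K in B.
exists (expmx (h%:C *: X) *m expmx (h%:C *: Y)), h^-1; split.
- by case: sH => _ _ HM _; apply: HM; apply: lie_expmx; exact: lieZ.
- by rewrite invr_gt0.
- set w := _ *m _ in B *.
  have -> : w - 1%:M = (w - 1%:M - h%:C *: (X + Y)) + h%:C *: (X + Y) by rewrite subrK.
  rewrite (le_lt_trans (froD _ _)) // froZ gtr0_norm // (le_lt_trans _ hK) // mulrDr lerD //.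
    by rewrite (le_trans B) // ler_wpM2l ?(ltW h0) // ler_piMl.
  by rewrite Ec ler_wpM2l ?(ltW h0) // froD.
set w := _ *m _ in B *.
have -> : (h^-1)%:C *: (w - 1%:M) - (X + Y) = (h^-1)%:C *: (w - 1%:M - h%:C *: (X + Y)).
  by rewrite [RHS]scalerBr scalerA -rmorphM mulVf ?gt_eqF // rmorph1 scale1r.
rewrite froZ gtr0_norm ?invr_gt0 // (le_lt_trans _ hK) //.
rewrite (@le_trans _ _ (h * K)) // ?ler_wpM2l ?(ltW h0) // ?lerDl //.
by rewrite ler_pdivrMl.
Qed.

Lemma rsub_lie H : is_subgroup H -> closedGL H -> rsub (lie H).
Proof.
move=> sH cH; split; first exact: lie0.
by move=> a X Y hX hY; exact: (lieD sH cH (lieZ a hX) hY).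
Qed.

Lemma lie_Ad H g X : is_subgroup H -> H g -> lie H X -> lie H (Ad g X).
Proof.
move=> [HU H1 HM HI] Hg /lieP hX; apply/lieP => t.
have -> : t%:C *: Ad g X = Ad g (t%:C *: X) by rewrite /Ad -scalemxAr -scalemxAl.
rewrite Ad_expmx ?HU //; apply: (HM _ _ _ (HI _ Hg)).
by apply: (HM _ _ Hg); exact: hX.
Qed.

Lemma lie_skew H X : (forall u, H u -> u \is unitarymx) -> lie H X -> adj X = - X.
Proof.
move=> uH /lieP hX; apply: expmx_line_inj => t.
rewrite -adjZr -expmx_adj scalerN -expmx_inv.
by rewrite invmx_unitary ?adj_def //; apply: uH.
Qed.

Lemma compact_closedGL H : compact H -> closedGL H.
Proof. by move=> cH g _ clg; apply: (compact_closed (@M_hausdorff R n) cH). Qed.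

(* Given u near 1, let exp A be a point of exp (lie U) closest to u with A small.  If
   w = exp (- A) u were different from 1, the direction D of w - 1 would be nearly
   orthogonal to lie U by minimality, while it is nearly in lie U by lie_limit. *)
Lemma lie_exp_surj U (r : R) : is_subgroup U -> (forall u, U u -> u \is unitarymx) ->
  compact U -> 0 < r ->
  exists2 d, 0 < d & forall u, U u -> fro (u - 1%:M) < d ->
    exists A, [/\ lie U A, fro A < r & expmx A = u].
Proof.
move=> sU uU cU r0; apply: contrapT => Hneg.
have rS := rsub_lie sU (compact_closedGL cU).
pose r1 := Num.min (r / 2) (4^-1).
have r10 : 0 < r1 by rewrite lt_min divr_gt0 //= invr_gt0.
have r1r : r1 < r by rewrite gt_min; apply/orP; left; lra.
have r14 : r1 <= 4^-1 by rewrite ge_min lexx orbT.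
have e4 : expR (4^-1) <= 4 / 3 :> R.
  have := expR_ge1Dx (- 4^-1 : R); have : expR (- 4^-1) * expR (4^-1) = 1 :> R.
    by rewrite -expRD addNr expR0.
  by have := expR_gt0 (4^-1 : R); move: (expR _) (expR _) => y x; nra.
have /choice [u Hu] : forall k : nat, exists u, [/\ U u, fro (u - 1%:M) < k.+1%:R^-1
    & forall A, lie U A -> fro A < r -> expmx A <> u].
  move=> k; apply: contrapT => Hk; apply: Hneg; exists (k.+1%:R^-1).
    by rewrite invr_gt0.
  move=> v Uv vk; apply: contrapT => HA; apply: Hk; exists v; split=> // A lA Ar E.
  by apply: HA; exists A.
pose K := [set A | lie U A /\ fro A <= r1].
have cK : compact K by exact: compact_fro_ball.
have K0 : K !=set0 by exists 0; split; [exact: lie0 | rewrite fro0 ltW].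
have /choice [A HA] : forall k, exists A, K A /\ forall B, K B -> fro (u k - expmx A) <= fro (u k - expmx B).
  move=> k; have [|A] := @compact_EVT_min _ _ (fun B => fro (u k - expmx B)) K K0 cK.
    apply: continuous_subspaceT => B.
    apply: (@continuous_comp _ _ _ (fun B => u k - expmx B) (@fro.body R n)); last exact: fro_continuous.
    by apply: continuousB; [exact: cst_continuous | exact: expmx_continuous].
  by rewrite inE => KA Amin; exists A; split=> // B KB; apply: Amin; rewrite inE.
have [e eE] : exists e : nat -> M, forall k, e k = u k - expmx (A k) by eexists.
have lA k : lie U (A k) by case: (HA k) => -[].
have uexp k : expmx (A k) \is unitarymx by apply: uU; apply: lie_expmx.
have e0 k : 0 < fro (e k).
  apply: fro_gt0; rewrite eE subr_eq0; apply/eqP => Ek.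
  have [_ _ HN] := Hu k; apply: (HN _ (lA k) _ (esym Ek)).
  by case: (HA k) => -[_ Ar] _; exact: le_lt_trans Ar r1r.
have e1 k : fro (e k) <= fro (u k - 1%:M).
  rewrite -expmx0 eE; case: (HA k) => _; apply.
  by split; [exact: lie0 | rewrite fro0 ltW].
pose w k := expmx (- A k) *m u k.
have Uw k : U (w k).
  case: (sU) => _ _ HM _; apply: HM; last by case: (Hu k).
  by apply: lie_expmx; apply: (rsubN rS); exact: lA.
have w1 k : w k - 1%:M = expmx (- A k) *m e k.
  by rewrite eE mulmxBr expmxN.
have fw k : fro (w k - 1%:M) = fro (e k).
  rewrite w1 fro_unitl //; apply: uU; apply: lie_expmx; apply: (rsubN rS); exact: lA.
pose D k := ((fro (e k))^-1)%:C *: (w k - 1%:M).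
have D1 k : fro (D k) = 1.
  by rewrite froZ gtr0_norm ?invr_gt0 // fw mulVf // gt_eqF.
have DK k : [set B : M | setT B /\ fro B <= 1] (D k) by split; rewrite ?D1.
have [D0 _ HD] := compact_cluster (compact_fro_ball (@rsubT R n)) DK.
have lD : lie U D0.
  apply: lie_limit; [exact: sU | exact: compact_closedGL |] => x x0.
  have [k kN hk] := HD x (Num.truncn (x^-1)) x0.
  exists (w k), (fro (e k))^-1; split; [exact: Uw | by rewrite invr_gt0 | | exact: hk].
  rewrite fw (le_lt_trans (e1 k)) //; case: (Hu k) => _ h _; apply: (lt_trans h).
  rewrite invf_plt ?posrE //; apply: (lt_le_trans (truncnS_gt _)).
  by rewrite ler_nat ltnS.
(* One k suffices: u k is then within r1 / 8 of 1, and the unit vector D k within 1 / 8 of its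
   cluster point D0. *)
have [k hk8 hk] : exists2 k : nat, (8 <= r1 * k.+1%:R :> R) & fro (D k - D0) < 8^-1.
  have [k kN hk] := HD 8^-1 (Num.truncn (8 / r1)) (ltac:(by rewrite invr_gt0)).
  exists k => //; rewrite mulrC -ler_pdivrMr //; apply/ltW/(lt_le_trans (truncnS_gt _)).
  by rewrite ler_nat ltnS.
have [_ uk _] := Hu k; have [[_ Ar] Amin] := HA k.
have x0 := e0 k; have xu := e1 k.
have uk8 : fro (u k - 1%:M) < r1 / 8.
  apply: (lt_le_trans uk); by rewrite ler_pdivlMr // mulrC ler_pdivrMr.
have E4 (y : R) : y <= 4^-1 -> expR y <= 4 / 3.
  by move=> hy; apply: le_trans e4; rewrite ler_expR.
have EA : fro (expmx (A k) - 1%:M) <= r1 / 4.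
  have := fro_triangle (expmx (A k)) (u k) 1%:M; rewrite (fro_distC (expmx _) (u k)) -eE.
  by move: (fro (expmx _ - _)) (fro (e k)) (fro (u k - _)) xu uk8 => p q z; lra.
(* The closest point must be well inside the ball of radius r1, so that the competitor below is
   still admissible. *)
have Aa : fro (A k) <= 3 * r1 / 8.
  have := expmx_sub1 (A k); have := E4 _ (le_trans Ar r14).
  have := fro_lerB (A k) (expmx (A k) - 1%:M); rewrite fro_distC.
  have := fro_ge0 (A k).
  move: (expR (fro (A k))) => E; move: (fro (expmx _ - _ - _)) (fro (expmx _ - _)) (fro (A k)) EA => p q a; nra.
have Dd : fro D0 <= 9 / 8.
  have := fro_lerB D0 (D k); rewrite fro_distC D1.
  by move: (fro D0) (fro _) hk => p q; lra.
(* The competitor is A k + s D0. With the norm of e equal to 8 s, the gain 2 s <e, D0> is at least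
   12.8 s^2, while the remainder Q and the squared displacement cost less than 4.4 s^2. *)
have [s Es] : exists s, s = fro (e k) / 8 by eexists.
have s0 : 0 < s by rewrite Es divr_gt0.
have [Q EQ] : exists Q, Q = expmx (A k + s%:C *: D0) - expmx (A k) - s%:C *: D0 by eexists.
have as_le : fro (A k) + s * fro D0 <= 7 / 16 * r1.
  have : s * fro D0 <= r1 / 64 * (9 / 8).
    by apply: ler_pM => //; [exact: ltW | rewrite Es; move: (fro (e k)) (fro (u k - _)) xu uk8 => p q; lra].
  by move: (s * _) => p; lra.
have fQ : fro Q <= s * (9 / 8 * (7 / 48)).
  rewrite EQ (le_trans (expmx_diff _ _)) // froZ gtr0_norm // -[leLHS]mulrA ler_pM2l //.
  have := expR_sub1_le (fro (A k) + s * fro D0).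
  have := E4 (fro (A k) + s * fro D0).
  have : 0 <= fro (A k) + s * fro D0 by rewrite addr_ge0 // mulr_ge0 // ltW.
  have := fro_ge0 D0.
  move: (_ + s * _) as_le (expR (fro (A k) + _)) => y yr E p0 y0 h1 h2.
  have h3 := h1 (ltac:(lra)).
  have h4 : E - 1 <= 7 / 48 by nra.
  by apply: (@le_trans _ _ (fro D0 * (7 / 48))); [rewrite ler_wpM2l | rewrite ler_wpM2r].
have KB : K (A k + s%:C *: D0).
  split; first by apply: (rsubD rS); [exact: lA | exact: (rsubZ s rS lD)].
  apply: (le_trans (froD _ _)); rewrite froZ gtr0_norm //.
  by move: (_ + s * _) as_le => y; lra.
have := Amin _ KB; rewrite -eE.
have -> : u k - expmx (A k + s%:C *: D0) = e k - (s%:C *: D0 + Q).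
  by rewrite EQ eE [s%:C *: D0 + _]addrC subrK opprB addrA subrK.
rewrite -(@ler_pXn2r _ 2) ?nnegrE // [X in _ <= X]sqr_fro dotBl !dotBr -!sqr_fro.
rewrite [dot (_ + Q) (e k)]dotC.
have : fro (s%:C *: D0 + Q) <= s * (13 / 10).
  apply: (le_trans (froD _ _)); rewrite froZ gtr0_norm //.
  have h1 := ler_wpM2l (ltW s0) Dd.
  by move: (fro Q) fQ (s * fro D0) h1 => p h1 q h2; lra.
rewrite dotDr dotZr.
have : `|dot (e k) Q| <= fro (e k) * (s * (9 / 8 * (7 / 48))).
  by rewrite (le_trans (dot_norm_le _ _)) // ler_wpM2l.
have : dot (e k) D0 >= fro (e k) * (4 / 5).
  have eDk : e k = (fro (e k))%:C *: (expmx (A k) *m D k).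
    rewrite /D -scalemxAr scalerA -rmorphM mulfV ?gt_eqF // rmorph1 scale1r w1 mulmxA.
    by rewrite expmxNr mul1mx.
  rewrite [X in _ <= dot X D0]eDk dotZl ler_pM2l //.
  have -> : expmx (A k) *m D k = D k + (expmx (A k) - 1%:M) *m D k.
    by rewrite mulmxBl mul1mx addrC subrK.
  rewrite dotDl.
  have h1 : dot (D k) D0 >= 7 / 8.
    have -> : D0 = D k - (D k - D0) by rewrite opprB addrC subrK.
    rewrite dotBr -sqr_fro D1 expr1n.
    have := dot_le (D k) (D k - D0); rewrite D1 mul1r.
    by move: (dot _ _) (fro _) hk => p q; lra.
  have h2 : `|dot ((expmx (A k) - 1%:M) *m D k) D0| <= (r1 / 4) * (9 / 8).
    rewrite (le_trans (dot_norm_le _ _)) // ler_pM // (le_trans (froM _ _)) // D1 mulr1 //.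
  by move: h2; rewrite ler_norml => /andP[h2 _]; move: (dot _ _) (dot _ _) h1 h2 => p q; lra.
rewrite ler_norml => + /andP[+ _].
have := fro_ge0 (s%:C *: D0 + Q).
move: (dot _ D0) (dot _ Q) (fro (_ + Q)) => p q z z0 h1 h2 h3 h4.
have xE : fro (e k) = 8 * s by rewrite Es mulrC divfK.
rewrite xE in h1 h2 *; have h5 : z ^+ 2 <= (s * (13 / 10)) ^+ 2.
  by rewrite ler_pXn2r ?nnegrE // mulr_ge0 // ltW.
nra.
Qed.

End LieAlgebra.

(** * Parabolic subgroups of a Hermitian matrix *)

HB.lock Definition mxcoords (R : realType) (n : nat) (V A : 'M[R[i]]_n) : 'M[R[i]]_n :=
  V *m A *m adj V.

(** The block-diagonal part of A along the eigenspaces of beta, of which V is an eigenbasis and d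
    the eigenvalues. *)
HB.lock Definition mxlevi (R : realType) (n : nat) (V : 'M[R[i]]_n) (d : 'I_n -> R)
    (A : 'M[R[i]]_n) : 'M[R[i]]_n :=
  adj V *m (\matrix_(a, b) if d a == d b then mxcoords V A a b else 0) *m V.

Section Parabolic.
Variables (R : realType) (n : nat).
Local Notation M := 'M[R[i]]_n.
Variables (V : 'M[R[i]]_n) (d : 'I_n -> R).
Hypothesis uV : V \is unitarymx.
Implicit Types (A B g h k Q : M) (e t : R).
Variable beta : 'M[R[i]]_n.
Hypothesis betaE : beta = adj V *m rdiag d *m V.
Local Notation coords := (mxcoords V).
Local Notation levi := (mxlevi V d).

(* exp (- t beta) A exp (t beta) stays bounded as t tends to + oo. *)
Definition parabolic A : Prop := forall a b, d a < d b -> coords A a b = 0.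

Lemma coordsE A : coords A = V *m A *m adj V.
Proof. by rewrite mxcoords.unlock. Qed.

Lemma leviE A :
  levi A = adj V *m (\matrix_(a, b) if d a == d b then coords A a b else 0) *m V.
Proof. by rewrite mxlevi.unlock. Qed.

Lemma coordsK A : adj V *m coords A *m V = A.
Proof.
rewrite !coordsE !mulmxA (unitary_adjl uV) mul1mx -mulmxA (unitary_adjl uV).
exact: mulmx1.
Qed.

Lemma coordsVK A : coords (adj V *m A *m V) = A.
Proof.
rewrite !coordsE !mulmxA (unitary_adj uV) mul1mx -mulmxA (unitary_adj uV).
exact: mulmx1.
Qed.

Lemma coordsM A B : coords (A *m B) = coords A *m coords B.
Proof.
rewrite !coordsE !mulmxA; congr (_ *m _ *m _).
by rewrite -(mulmxA (V *m A)) (unitary_adjl uV) mulmx1.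
Qed.

Lemma coords1 : coords 1%:M = 1%:M.
Proof. by rewrite !coordsE mulmx1 unitary_adj. Qed.

Lemma coords_inj A B : coords A = coords B -> A = B.
Proof. by move=> E; rewrite -(coordsK A) E coordsK. Qed.

Lemma coordsB A B : coords (A - B) = coords A - coords B.
Proof. by rewrite !coordsE mulmxBr mulmxBl. Qed.

Lemma coords_adj A : coords (adj A) = adj (coords A).
Proof. by rewrite !coordsE !adjM adjK mulmxA. Qed.

Lemma fro_coords A : fro (coords A) = fro A.
Proof. by rewrite !coordsE (fro_unitr _ (adj_unitary uV)) (fro_unitl _ uV). Qed.

Lemma coords_beta : coords beta = rdiag d.
Proof. by rewrite betaE coordsVK. Qed.

Lemma coords_exp t : coords (expmx (t%:C *: beta)) = rdiag (fun j => expR (t * d j)).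
Proof.
have -> : t%:C *: beta = adj V *m rdiag (fun j => t * d j) *m V.
  rewrite betaE scalemxAl scalemxAr; congr (_ *m _ *m _).
  by apply/matrixP => i j; rewrite mxE !rdiagE rmorphM mulrnAr.
by rewrite expmx_spectral // coordsVK.
Qed.

Definition dilate t A : M := expmx ((- t)%:C *: beta) *m A *m expmx (t%:C *: beta).

Lemma coords_dilate t A a b :
  coords (dilate t A) a b = (expR (t * (d b - d a)))%:C * coords A a b.
Proof.
rewrite !coordsM !coords_exp mul_rdiagE rdiag_mulE mulrA -rmorphM -expRD.
by congr ((expR _)%:C * _); ring.
Qed.

Lemma coords_levi A a b :
  coords (levi A) a b = if d a == d b then coords A a b else 0.
Proof. by rewrite leviE coordsVK mxE. Qed.

Lemma parabolic1 : parabolic 1%:M.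
Proof.
by move=> a b ab; rewrite coords1 mxE; case: eqP ab => [->|//]; rewrite ltxx.
Qed.

Lemma parabolicM A B : parabolic A -> parabolic B -> parabolic (A *m B).
Proof.
move=> pA pB a b ab; rewrite coordsM mxE big1 // => c _.
have [ac|ca] := ltP (d a) (d c); first by rewrite pA // mul0r.
by rewrite pB ?mulr0 // (le_lt_trans ca).
Qed.

(** Parabolic matrices are block triangular, and diagonal blocks of such matrices multiply. *)
Lemma leviM A B : parabolic A -> parabolic B -> levi (A *m B) = levi A *m levi B.
Proof.
move=> pA pB; apply: coords_inj; rewrite coordsM; apply/matrixP => a b.
rewrite coords_levi coordsM !mxE; case: eqP => ab.
  apply: eq_bigr => c _; rewrite !coords_levi; case: eqP => ac.
    by rewrite -ac ab eqxx.
  rewrite mul0r; case: (ltgtP (d a) (d c)) => [h|h|//].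
    by rewrite pA // mul0r.
  by rewrite pB ?mulr0 // -ab.
rewrite big1 // => c _; rewrite !coords_levi; case: (d a =P d c) => [ac|]; last by rewrite mul0r.
by case: (d c =P d b) => [cb|]; [case: ab; rewrite ac | rewrite mulr0].
Qed.

Lemma levi1 : levi 1%:M = 1%:M.
Proof.
apply: coords_inj; apply/matrixP => a b; rewrite coords_levi coords1 mxE.
by case: (eqVneq a b) => [->|_]; rewrite ?eqxx //; case: ifP.
Qed.

Lemma levi_comm A : levi A *m beta = beta *m levi A.
Proof.
apply: coords_inj; rewrite !coordsM coords_beta; apply/matrixP => a b.
rewrite mul_rdiagE rdiag_mulE coords_levi.
by case: eqP => [->|]; rewrite ?mulr0.
Qed.

Lemma comm_coords A a b : A *m beta = beta *m A -> d a != d b -> coords A a b = 0.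
Proof.
move=> /(congr1 coords); rewrite !coordsM coords_beta => /matrixP /(_ a b).
rewrite mul_rdiagE rdiag_mulE => /eqP; rewrite -subr_eq0 -mulrBl -rmorphB mulf_eq0.
rewrite -(rmorph0 (real_complex R)) (inj_eq (@complexI R)) subr_eq0 => /orP[/eqP ->|/eqP //].
by rewrite eqxx.
Qed.

Lemma comm_parabolic A : A *m beta = beta *m A -> parabolic A.
Proof. by move=> cA a b ab; apply: comm_coords => //; rewrite lt_eqF. Qed.

Lemma comm_levi A : A *m beta = beta *m A -> levi A = A.
Proof.
move=> cA; apply: coords_inj; apply/matrixP => a b; rewrite coords_levi.
by case: eqP => // /eqP ab; rewrite (comm_coords cA ab).
Qed.

(** The two hypotheses kill the blocks on either side of the diagonal. For a unitary A the adjoint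
    is the inverse. *)
Lemma unitary_parabolic_comm A : parabolic A -> parabolic (adj A) ->
  A *m beta = beta *m A.
Proof.
move=> pA pA'; rewrite -(_ : levi A = A); first exact: levi_comm.
apply: coords_inj; apply/matrixP => a b; rewrite coords_levi.
case: (ltgtP (d a) (d b)) => // h; first by rewrite pA.
have := pA' b a h; rewrite coords_adj adjE => /eqP; rewrite conjc_eq0.
by move/eqP.
Qed.

Lemma levi_fro A B : fro (levi A - levi B) <= fro (A - B).
Proof.
rewrite -(fro_coords (levi A - levi B)) -(fro_coords (A - B)) !coordsB.
apply: le_of_sqr => //; rewrite !sqr_fro !dot_sqn.
apply: ler_sum => a _; apply: ler_sum => b _; rewrite !mx_subE !coords_levi.
case: ifP => _ //; rewrite subrr {1}/sqn /= !expr0n /= addr0; exact: sqn_ge0.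
Qed.

Lemma expR_decay (c x e : R) : 0 < c -> 0 <= x -> 0 < e -> exists N : nat, forall k : nat,
  (N <= k)%N -> expR (- (k%:R * c)) * x < e.
Proof.
move=> c0 x0 e0; exists (Num.truncn (x / (c * e))).+1 => k kN.
have k1 : x / (c * e) < k%:R.
  by rewrite (lt_le_trans (truncnS_gt _)) // ler_nat.
move: k1; rewrite ltr_pdivrMr ?mulr_gt0 // => k1.
have := expR_ge1Dx (k%:R * c); have : expR (- (k%:R * c)) * expR (k%:R * c) = 1.
  by rewrite -expRD addNr expR0.
have := expR_gt0 (- (k%:R * c)).
move: (expR (k%:R * c)) (expR (- _)) => z y y0 yz zk.
have h : x < e * z by nra.
have -> : e = y * (e * z) by rewrite mulrCA yz mulr1.
by rewrite ltr_pM2l.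
Qed.

Lemma sqn_real (r : R) (z : R[i]) : sqn (r%:C * z) = r ^+ 2 * sqn z.
Proof. by case: z => a b; rewrite /sqn /=; ring. Qed.

Lemma sqn_coords_le A a b : sqn (coords A a b) <= fro A ^+ 2.
Proof. by rewrite -(fro_coords A); exact: sqn_le_fro. Qed.

Lemma dilate_levi A e : parabolic A -> 0 < e -> exists N : nat, forall k : nat, (N <= k)%N ->
  fro (dilate k%:R A - levi A) < e.
Proof.
move=> pA e0; have e1 : 0 < e / n.+1%:R by rewrite divr_gt0.
have : \forall k \near \oo, forall a b,
    sqn (coords (dilate k%:R A) a b - coords (levi A) a b) <= (e / n.+1%:R) ^+ 2.
  apply: filter_forall => a; apply: filter_forall => b.
  have [ab|ba|ab] := ltgtP (d a) (d b).
  - near=> k; rewrite coords_dilate coords_levi pA // mulr0 if_same subrr.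
    by rewrite {1}/sqn /= !expr0n /= addr0 sqr_ge0.
  - have [||N HN] := @expR_decay (d a - d b) (fro A) (e / n.+1%:R) _ _ e1.
    + by rewrite subr_gt0.
    + exact: fro_ge0.
    exists N => // k /HN kN; rewrite coords_dilate coords_levi gt_eqF // subr0 sqn_real.
    have -> : k%:R * (d b - d a) = - (k%:R * (d a - d b)) by ring.
    apply: (@le_trans _ _ ((expR (- (k%:R * (d a - d b))) * fro A) ^+ 2)).
      by rewrite exprMn ler_wpM2l ?sqr_ge0 // sqn_coords_le.
    by rewrite ler_pXn2r ?nnegrE ?mulr_ge0 ?expR_ge0 // ?(ltW e1) // ltW.
  - near=> k; rewrite coords_dilate coords_levi ab eqxx subrr mulr0 expR0 mul1r subrr.
    by rewrite {1}/sqn /= !expr0n /= addr0 sqr_ge0.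
move=> [N _ HN]; exists N => k kN.
rewrite -(fro_coords (dilate _ _ - _)).
apply: (@le_lt_trans _ _ (n%:R * (e / n.+1%:R))); last first.
  by rewrite mulrCA gtr_pMr // ltr_pdivrMr // mul1r ltr_nat.
apply: fro_le_entries => [|a b]; first exact: ltW.
by rewrite coordsB mx_subE; apply: HN.
Unshelve. all: by end_near.
Qed.

(** By the first hypothesis the coordinate (a, b) of Qs N is exp (- N (d b - d a)) times that of its
    adjoint, which is bounded; if d a < d b it tends to 0. *)
Lemma parabolic_cluster (Qs : nat -> M) Q C :
  (forall N, dilate N%:R (Qs N) = adj (Qs N)) -> (forall N, fro (Qs N) <= C) ->
  (forall e N, 0 < e -> exists2 k : nat, (N <= k)%N & fro (Qs k - Q) < e) ->
  parabolic Q.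
Proof.
move=> HQ QC HC a b ab.
have C0 : 0 <= C := le_trans (fro_ge0 _) (QC 0%N).
have small e : 0 < e -> sqn (coords Q a b) <= 4 * e ^+ 2.
  move=> e0; have [N HN] := expR_decay (c := d b - d a) (ltac:(by rewrite subr_gt0)) C0 e0.
  have [k /HN kN kQ] := HC e N e0.
  have : sqn (coords (Qs k) a b) <= e ^+ 2.
    have -> : coords (Qs k) a b = (expR (- (k%:R * (d b - d a))))%:C * coords (adj (Qs k)) a b.
      rewrite -HQ coords_dilate mulrA -rmorphM -expRD addNr expR0 rmorph1 mul1r //.
    rewrite sqn_real.
    apply: (@le_trans _ _ ((expR (- (k%:R * (d b - d a))) * C) ^+ 2)).
      rewrite exprMn ler_wpM2l ?sqr_ge0 // (le_trans (sqn_coords_le _ _ _)) // fro_adj.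
      by rewrite ler_pXn2r ?nnegrE.
    by rewrite ler_pXn2r ?nnegrE ?mulr_ge0 ?expR_ge0 // ?(ltW e0) // ltW.
  have : sqn (coords (Qs k) a b - coords Q a b) <= e ^+ 2.
    rewrite -mx_subE -coordsB (le_trans (sqn_coords_le _ _ _)) //.
    by rewrite ler_pXn2r ?nnegrE ?(ltW e0) // ltW.
  case: (coords (Qs k) a b) (coords Q a b) => x y [z w]; rewrite /sqn /=.
  have := sqr_ge0 (2 * x - z); have := sqr_ge0 (2 * y - w); nra.
have s0 : sqn (coords Q a b) = 0.
  apply/eqP; rewrite -[_ == 0]negbK; apply/negP => nz.
  have sp : 0 < sqn (coords Q a b) by rewrite lt_def nz sqn_ge0.
  have e0 : 0 < Num.sqrt (sqn (coords Q a b)) / 4 by rewrite divr_gt0 // sqrtr_gt0.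
  by have := small _ e0; rewrite exprMn sqr_sqrtr ?sqn_ge0 //; lra.
move: s0; case: (coords Q a b) => x y; rewrite /sqn /= => /eqP.
by rewrite paddr_eq0 ?sqr_ge0 // !sqrf_eq0 => /andP[/eqP -> /eqP ->].
Qed.

(** In eigencoordinates A = 1 + B, where B is supported on gaps d x - d y > 0. At a nonzero entry of
    B with the smallest gap dl, the entry of A^j is j times that of B, since products of two such
    terms have gap at least 2 dl. Linear growth contradicts the bound. *)
Lemma levi_unipotent A C : parabolic A -> levi A = 1%:M -> (forall j : nat, fro (A ^+ j) <= C) ->
  A = 1%:M.
Proof.
move=> pA lA AC; apply: coords_inj; rewrite coords1; apply/eqP; rewrite -subr_eq0.
apply/negPn/negP => N0; have [B BE] : exists B, B = coords A - 1%:M by eexists.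
have B0 a b : d a <= d b -> B a b = 0.
  move=> ab; rewrite BE mx_subE; case: (ltgtP (d a) (d b)) ab => // [ab _|ab _].
    by rewrite pA // -coords1 (parabolic1 ab) subrr.
  by have := coords_levi A a b; rewrite lA coords1 ab eqxx => ->; rewrite subrr.
have [[a0 b0] /= H0] : exists p : 'I_n * 'I_n, B p.1 p.2 != 0.
  apply: contrapT => H; move/negP: N0; rewrite -BE; apply; apply/eqP/matrixP => a b; rewrite [RHS]mxE.
  by apply/eqP/negPn/negP => h; apply: H; exists (a, b).
case: (@Order.TotalTheory.arg_minP _ _ _ (a0, b0) (fun p => B p.1 p.2 != 0) (fun p => d p.1 - d p.2) H0) => -[a b] /= Hab Hmin.
set dl := d a - d b in Hmin.
have dl0 : 0 < dl by rewrite subr_gt0 ltNge; apply: contra Hab => /B0 ->.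
have Bsupp x y : d x - d y < dl -> B x y = 0.
  move=> h; apply/eqP/negPn/negP => /(Hmin (x, y)) /=; rewrite leNgt h //.
have [D DE] : exists D : nat -> M, forall j, coords (A ^+ j) = 1%:M + D j.
  by exists (fun j => coords (A ^+ j) - 1%:M) => j; rewrite addrC subrK.
have DS j : D j.+1 = D j + B + D j *m B.
  have : 1%:M + D j.+1 = (1%:M + D j) *m (1%:M + B).
    by rewrite -!DE exprSr -mulmxE coordsM BE [1%:M + _]addrC subrK.
  by rewrite mulmxDl mul1mx mulmxDr mulmx1 -addrA => /addrI ->; rewrite addrA [B + _]addrC.
have step (j : nat) : (forall x y, d x - d y < dl -> D j x y = 0) /\ D j a b = B a b *+ j.
  elim: j => [|j [IH1 IH2]].
    have -> : D 0%N = 0.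
      by have /eqP := DE 0%N; rewrite expr0 -[1]/(1%:M) coords1 -subr_eq0 opprD addrA subrr sub0r oppr_eq0 => /eqP.
    by rewrite mulr0n; split=> [x y _|]; rewrite mxE.
  have Esupp x y : d x - d y < dl + dl -> (D j *m B) x y = 0.
    move=> xy; rewrite mxE big1 // => c _; have [h|h] := ltP (d x - d c) dl.
      by rewrite IH1 // mul0r.
    by rewrite Bsupp ?mulr0 //; lra.
  split=> [x y xy|].
    by rewrite DS !mx_addE Esupp; [rewrite IH1 // Bsupp // !addr0 | lra].
  rewrite DS !mx_addE Esupp; last by rewrite -/dl; lra.
  by rewrite addr0 IH2 mulrSr.
have sB : 0 < sqn (B a b).
  rewrite lt_def sqn_ge0 andbT; apply: contra Hab; case: (B a b) => x y; rewrite /sqn /=.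
  by rewrite paddr_eq0 ?sqr_ge0 // !sqrf_eq0 => /andP[/eqP -> /eqP ->].
pose W := (C + Num.sqrt n%:R) ^+ 2.
have bnd (j : nat) : j%:R ^+ 2 * sqn (B a b) <= W.
  have := sqn_le_fro (D j) a b; rewrite (step j).2.
  have -> : B a b *+ j = (j%:R)%:C * B a b by rewrite (rmorph_nat (real_complex R) j) mulr_natl.
  rewrite sqn_real => h; apply: (le_trans h).
  have Dj : fro (D j) <= C + Num.sqrt n%:R.
    have -> : D j = coords (A ^+ j) - 1%:M by rewrite DE addrC addKr.
    by rewrite (le_trans (froB _ _)) // fro1 lerD2r fro_coords.
  by rewrite /W ler_pXn2r ?nnegrE // (le_trans (fro_ge0 _) Dj).
have := bnd (Num.truncn (W / sqn (B a b))).+1; rewrite leNgt => /negP; apply.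
rewrite -ltr_pdivrMr //; apply: (lt_le_trans (truncnS_gt _)).
by rewrite expr2 ler_peMl // ler1n.
Qed.

End Parabolic.

(** * Unitary groups, their complexifications and compatible subgroups *)

Section UnitaryGroups.
Variables (R : realType) (n : nat).
Local Notation M := 'M[R[i]]_n.
Implicit Types (A B X Y g h k u : M) (e t : R) (H S : set M).

Lemma compact_mulmx H S : compact H -> compact S ->
  compact [set g *m h | g in H & h in S].
Proof.
move=> cH cS.
have -> : [set g *m h | g in H & h in S] = (fun p : M * M => p.1 *m p.2) @` (H `*` S).
  apply/seteqP; split=> [_ [g Hg] [h Sh] <-|_ [[g h] /= [Hg Sh] <-]].
    by exists (g, h).
  by exists g => //; exists h.
apply: continuous_compact; last exact: compact_setX.
apply: continuous_subspaceT => -[A B] P /= /nbhs_fro [e e0 HP].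
pose c := fro A + fro B + 1.
have c0 : 0 < c by rewrite ltr_wpDl // addr_ge0.
have d0 : 0 < Num.min 1 (e / c) by rewrite lt_min ltr01 divr_gt0.
exists ([set C | fro (C - A) < Num.min 1 (e / c)], [set C | fro (C - B) < Num.min 1 (e / c)]).
  by split; apply/nbhs_fro; exists (Num.min 1 (e / c)).
move=> [C D] /= [hC hD]; apply: HP; move: hC hD; rewrite !lt_min => /andP[h3 h4] /andP[h1 h2].
have -> : C *m D - A *m B
    = (C - A) *m (D - B) + (A *m (D - B) + (C - A) *m B).
  by rewrite addrA -mulmxDl subrK mulmxBr mulmxBl addrA subrK.
have := froD ((C - A) *m (D - B)) (A *m (D - B) + (C - A) *m B).
have := froD (A *m (D - B)) ((C - A) *m B).
have := froM (C - A) (D - B); have := froM A (D - B); have := froM (C - A) B.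
move: h2 h4; rewrite !ltr_pdivlMr // /c.
have := fro_ge0 A; have := fro_ge0 B; have := fro_ge0 (C - A); have := fro_ge0 (D - B).
move: (fro A) (fro B) (fro (C - A)) (fro (D - B)) h1 h3 => a b x y.
nra.
Qed.

Lemma compact_expmx S : compact S -> compact (@expmx.body R n @` S).
Proof. by move=> cS; apply: continuous_compact => //; exact/continuous_subspaceT/expmx_continuous. Qed.

Lemma rsub_imul S : rsub S -> rsub (imul S).
Proof.
move=> rS; split; first by exists 0; [case: rS | rewrite scaler0].
move=> a _ _ [X SX <-] [Y SY <-]; exists (a%:C *: X + Y).
  by case: rS => _; apply.
by rewrite scalerDr !scalerA mulrC.
Qed.

Lemma imul_hermx S X : (forall A, S A -> adj A = - A) -> imul S X -> hermx X.
Proof.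
move=> HS [A SA <-]; rewrite /hermx adjZ HS // scalerN -scaleNr; congr (_ *: _).
by rewrite /=; simpc.
Qed.

Lemma imul_imul S X : rsub S -> imul S X -> S ('i *: X).
Proof.
move=> rS [A SA <-]; rewrite scalerA.
have -> : 'i * 'i = -1 :> R[i] by rewrite -expr2 sqr_i.
by rewrite scaleN1r; exact: rsubN.
Qed.

Lemma Ad_imul S g X : (forall A, S A -> S (Ad g A)) -> imul S X -> imul S (Ad g X).
Proof.
move=> HS [A SA <-]; exists (Ad g A); first exact: HS.
by rewrite /Ad -scalemxAr -scalemxAl.
Qed.

Lemma Ad_scale g (z : R[i]) X : Ad g (z *: X) = z *: Ad g X.
Proof. by rewrite /Ad -scalemxAr -scalemxAl. Qed.

Lemma Ad_comm g X : g \in unitmx -> Ad g X = X <-> g *m X = X *m g.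
Proof.
move=> ug; rewrite /Ad; split=> [E|->]; last by rewrite mulmxK.
by rewrite -{2}E mulmxKV.
Qed.

Lemma hermx_ip X Y : hermx X -> hermx Y -> ip X Y = dot X Y.
Proof.
move=> hX hY; rewrite /ip /skew_part /herm_part !adj_def hX hY !subrr scaler0 mul0mx.
have E (Z : M) : 2%:R^-1 *: (Z + Z) = Z.
  by rewrite scalerDr -scalerDl -div1r -splitr scale1r.
by rewrite mxtrace0 oppr0 add0r !E dotE hY.
Qed.

Lemma dot_Ad u X Y : u \is unitarymx -> dot (Ad u X) (Ad u Y) = dot X Y.
Proof.
move=> uu; rewrite /Ad invmx_unitary // adj_def (dot_unitr _ _ (adj_unitary uu)).
exact: dot_unitl.
Qed.

Lemma Ad_inv g X : g \in unitmx -> Ad (invmx g) (Ad g X) = X.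
Proof. by move=> ug; rewrite /Ad !mulmxA mulVmx // mul1mx invmxK -mulmxA mulVmx // mulmx1. Qed.

End UnitaryGroups.

(** * The groups U^C, G and K *)

Section CompatibleGroups.
Variables (R : realType) (n : nat).
Local Notation M := 'M[R[i]]_n.
Implicit Types (A B X Y g h k u : M) (e t : R).
Variables (U G : set 'M[R[i]]_n).
Hypothesis HU : compact_connected_unitary U.
Local Notation UC := (complexification U).

Lemma U_subgroup : is_subgroup U. Proof. by case: HU. Qed.
Lemma U_unitary u : U u -> u \is unitarymx. Proof. by case: HU => _ H _ _; exact: H. Qed.
Lemma U_compact : compact U. Proof. by case: HU. Qed.

Lemma rsub_lieU : rsub (lie U).
Proof. exact: (rsub_lie U_subgroup (compact_closedGL U_compact)). Qed.

Lemma lieU_skew X : lie U X -> adj X = - X.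
Proof. exact: (lie_skew U_unitary). Qed.

Lemma rsub_iu : rsub (imul (lie U)).
Proof. exact: rsub_imul rsub_lieU. Qed.

Lemma iu_hermx X : imul (lie U) X -> hermx X.
Proof. exact: imul_hermx lieU_skew. Qed.

Lemma iu_iu X : imul (lie U) X -> lie U ('i *: X).
Proof. exact: imul_imul rsub_lieU. Qed.

Lemma UCP g : UC g <-> exists X u, [/\ imul (lie U) X, U u & g = expmx X *m u].
Proof.
split=> [[eta le] [u Uu] <-|[_ [u [[eta le <-] Uu ->]]]].
  by exists ('i *: eta), u; rewrite expmxE; split=> //; exists eta.
by exists eta => //; exists u => //; rewrite expmxE.
Qed.

Lemma iu_UC X : imul (lie U) X -> UC (expmx X).
Proof.
move=> hX; apply/UCP; exists X, 1%:M; split=> //; last by rewrite mulmx1.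
by case: U_subgroup.
Qed.

Lemma U_UC u : U u -> UC u.
Proof.
move=> Uu; apply/UCP; exists 0, u; split=> //; last by rewrite expmx0 mul1mx.
by case: rsub_iu.
Qed.

Lemma UC_unit g : UC g -> g \in unitmx.
Proof.
by move=> /UCP [X [u [hX Uu ->]]]; rewrite unitmx_mul expmx_unit unitarymx_unit // U_unitary.
Qed.

(** Elements exp (X) u near an invertible h have X bounded, so h is a limit of points of the compact
    product of exp of a ball of iu with U. *)
Lemma UC_closedGL : closedGL UC.
Proof.
move=> h uh /closure_fro clh.
pose b := fro h; pose b' := fro (invmx h).
have b0 : 0 <= b by exact: fro_ge0.
have b0' : 0 <= b' by exact: fro_ge0.
pose C := Num.sqrt (4 * (Num.sqrt n%:R * (b + 1 + 2 * b'))).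
pose W := [set g *m u | g in @expmx.body R n @` [set X | imul (lie U) X /\ fro X <= C] & u in U].
have cW : compact W.
  by apply: compact_mulmx U_compact; apply: compact_expmx; exact: compact_fro_ball rsub_iu.
suff [_ [X [hX _] <-] [u Uu <-]] : W h by apply/UCP; exists X, u.
apply: (closed_fro (compact_closed (@M_hausdorff R n) cW)) => e e0.
pose d := Num.min e (Num.min 1 (1 / (2 * (b' + 1)))).
have d0 : 0 < d by rewrite !lt_min e0 ltr01 divr_gt0 // mulr_gt0 //; lra.
have [g UCg] := clh d d0; rewrite !lt_min => /and3P[ge g1 g2].
exists g => //; have ug := UC_unit UCg.
have gi : fro (invmx g) <= 2 * b'.
  apply: fro_invmx_near => //; rewrite -/b'.
  move: g2; rewrite ltr_pdivlMr ?mulr_gt0 ?ltr_wpDl //.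
  by have := fro_ge0 (g - h); move: (fro (g - h)) => x; nra.
have gb : fro g <= b + 1.
  by have := fro_lerB g h; rewrite -/b; move: (fro g) (fro (g - h)) g1 => x y; lra.
have /UCP [X [u [hX Uu gE]]] := UCg.
exists (expmx X); last by exists u.
exists X => //; split=> //.
rewrite -(@ler_pXn2r _ 2) ?nnegrE ?sqrtr_ge0 // sqr_sqrtr; last first.
  by rewrite !mulr_ge0 ?sqrtr_ge0 // !addr_ge0 // mulr_ge0.
have uu := U_unitary Uu.
(* [polar_bound] expects the unitary factor on the left, hence the passage to adjoints. *)
have agE : adj g = adj u *m expmx X by rewrite gE adjM (hermx_expmx (iu_hermx hX)).
apply: (le_trans (polar_bound (adj_unitary uu) (iu_hermx hX))); rewrite -agE.
have -> : invmx (adj g) = adj (invmx g).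
  have ua : adj g \in unitmx by rewrite agE; apply: polar_unit; exact: adj_unitary.
  by apply: (can_inj (mulKmx ua)); rewrite mulmxV // -adjM mulVmx // adj1.
rewrite !fro_adj ler_pM2l // ler_wpM2l ?sqrtr_ge0 //; exact: lerD.
Qed.

Hypothesis HG : real_compatible U G.
Local Notation K := (cartanK U G).
Local Notation p := (cartanp U G).

Lemma G_subgroup : is_subgroup G. Proof. by case: HG => -[]. Qed.
Lemma G_UC g : G g -> UC g. Proof. by case: HG => -[_ H _] _ _ _; exact: H. Qed.

(** Compatibility only says that G is closed in U^C; the rest is that U^C is closed in GL(n, C). *)
Lemma G_closedGL : closedGL G.
Proof.
move=> g ug cg; case: HG => -[_ GU cG] _ _ _; apply: cG; split=> //.
apply: UC_closedGL => //; apply/closure_fro => e e0.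
by have /closure_fro /(_ e e0) [h Gh hg] := cg; exists h => //; exact: GU.
Qed.

Lemma G_unit g : G g -> g \in unitmx.
Proof. by move=> /G_UC /UC_unit. Qed.

Lemma K_U k : K k -> U k. Proof. by case. Qed.
Lemma K_G k : K k -> G k. Proof. by case. Qed.
Lemma K_unitary k : K k -> k \is unitarymx. Proof. by move=> /K_U /U_unitary. Qed.

Lemma K_subgroup : is_subgroup K.
Proof.
case: G_subgroup U_subgroup => [G0 G1 GM GI] [_ U1 UM UI]; split=> //.
- by move=> g [/G0].
- by move=> g h [Gg Ug] [Gh Uh]; split; [exact: GM | exact: UM].
- by move=> g [Gg Ug]; split; [exact: GI | exact: UI].
Qed.

Lemma K_compact : compact K.
Proof.
have -> : K = U `&` closure G.
  apply/seteqP; split=> g [Gg Ug]; split=> //; first exact: subset_closure.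
  by apply: G_closedGL => //; apply: UC_unit; exact: U_UC.
by apply: compact_closedI; [exact: U_compact | exact: closed_closure].
Qed.

Lemma rsub_p : rsub p.
Proof.
have [G0 HGs] := rsub_lie G_subgroup G_closedGL; have [iu0 iuS] := rsub_iu.
split=> [|a X Y [lX iX] [lY iY]]; first exact: conj G0 iu0.
exact: conj (HGs a X Y lX lY) (iuS a X Y iX iY).
Qed.

Lemma p_iu X : p X -> imul (lie U) X. Proof. by case. Qed.
Lemma p_hermx X : p X -> hermx X. Proof. by move=> /p_iu /iu_hermx. Qed.
Lemma p_G X : p X -> G (expmx X). Proof. by case=> /lie_expmx. Qed.

Lemma p_Ad k X : K k -> p X -> p (Ad k X).
Proof.
move=> [Gk Uk] [lX iX]; split; first exact: (lie_Ad G_subgroup Gk lX).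
by apply: Ad_imul iX => A; exact: (lie_Ad U_subgroup Uk).
Qed.

Lemma G_polar g : G g -> exists k X, [/\ K k, p X & g = k *m expmx X].
Proof.
case: HG => _ + _ _ => /seteqP[H _] => /H [k Kk] [X pX] <-.
by exists k, X; rewrite expmxE.
Qed.

End CompatibleGroups.

(** * Flows on the manifold *)

Section Calculus.
Variable R : realType.

Lemma is_derive_comp_curve (V W : normedModType R) (g : R -> V) (F : V -> W)
    (f : R -> W) (t : R) (v : V) :
  (\forall s \near t, F (g s) = f s) -> is_derive t (1 : R) g v ->
  differentiable F (g t) -> is_derive t (1 : R) f ('D_v F (g t)).
Proof.
move=> Hf Hg dF; apply: (near_eq_is_derive Hf).
have dg : differentiable g t by apply/derivable1_diffP; case: Hg.
have dc : differentiable (F \o g) t by exact: differentiable_comp.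
apply: DeriveDef; first exact/derivable1_diffP.
rewrite (deriveE _ dc) diff_comp //= (deriveE _ dF); congr ('d F (g t) _).
by rewrite -(deriveE _ dg) derive_val.
Qed.

Lemma is_derive_line (V W : normedModType R) (F : V -> W) (x v : V) (t : R) (D : W) :
  is_derive (x + t *: v) v F D -> is_derive t (1 : R) (fun s => F (x + s *: v)) D.
Proof.
have E : (fun h : R => h^-1 *: (F (h *: v + (x + t *: v)) - F (x + t *: v)))
   = (fun h : R => h^-1 *: (F (x + (h *: (1 : R) + t) *: v) - F (x + t *: v))).
  apply/funext => h; congr (_ *: (F _ - _)).
  have -> : h *: (1 : R) = h by exact: mulr1.
  by rewrite scalerDl addrCA.
move=> [dF <-]; move: dF; rewrite /derivable E => dd.
by apply: DeriveDef => //; rewrite /derive E.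
Qed.

Lemma derivable_line (V W : normedModType R) (F : V -> W) (x v : V) (t : R) :
  differentiable F (x + t *: v) ->
  is_derive t (1 : R) (fun s => F (x + s *: v)) ('D_v F (x + t *: v)).
Proof.
by move=> dF; apply: is_derive_line; apply: DeriveDef => //; exact: diff_derivable.
Qed.

Lemma is_derive_min (f : R -> R) (D : R) :
  is_derive (0 : R) (1 : R) f D -> (forall t, f 0 <= f t) -> D = 0.
Proof.
move=> [df Df] fmin; apply/eqP/negPn/negP => D0.
have D2 : 0 < `|D| / 2 by rewrite divr_gt0 // normr_gt0.
have : (fun h : R => h^-1 *: (f (h *: (1 : R) + 0) - f 0)) @ 0^' --> D by rewrite -Df.
move=> /cvgrPdist_lt /(_ _ D2) [e /= e0 He].
have key (h : R) : h != 0 -> `|h| < e -> `|D - h^-1 * (f h - f 0)| < `|D| / 2.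
  move=> h0 he; have := He h; rewrite /= sub0r normrN addr0.
  have -> : h *: (1 : R) = h by exact: mulr1.
  by apply.
have e2 : 0 < e / 2 by rewrite divr_gt0.
case: (ltgtP D 0) D0 => // Ds _.
  have := key (e / 2) (ltac:(by rewrite gt_eqF)) (ltac:(by rewrite gtr0_norm //; lra)).
  have : 0 <= (e / 2)^-1 * (f (e / 2) - f 0) by rewrite mulr_ge0 ?invr_ge0 ?(ltW e2) // subr_ge0.
  rewrite (ltr0_norm Ds); move: (_ * _) => q q0; rewrite ltr_norml => /andP[]; lra.
have := key (- (e / 2)) (ltac:(by rewrite oppr_eq0 gt_eqF)) (ltac:(by rewrite normrN gtr0_norm //; lra)).
have : 0 <= (e / 2)^-1 * (f (- (e / 2)) - f 0) by rewrite mulr_ge0 ?invr_ge0 ?(ltW e2) // subr_ge0.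
rewrite (gtr0_norm Ds) invrN mulNr; move: (_ * _) => q q0; rewrite ltr_norml => /andP[]; lra.
Qed.

Lemma mvt_derive (f : R -> R) (df : R -> R) (a b : R) : a < b ->
  (forall t, is_derive t (1 : R) f (df t)) ->
  exists c, [/\ a < c, c < b & f b - f a = df c * (b - a)].
Proof.
move=> ab H; have [|c] := @MVT R f df a b ab (fun t _ => H t).
  by apply: derivable_within_continuous => t _; case: (H t).
by rewrite in_itv /= => /andP[ac cb] E; exists c.
Qed.

End Calculus.

Section ManifoldCurves.
Variables (R : realType) (m : nat).

Lemma smooth_into_continuous (Z : manifold R m) k (B : set 'rV[R]_k) (c : 'rV[R]_k -> Z) y :
  smooth_into B c -> B y -> {for y, continuous c}.
Proof.
move=> Hc By; have [j cj] := cdom_cover (c y).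
have [oB sB] := Hc j.
have yB : (B `&` c @^-1` cdom j) y by [].
have c0 := sB 0%N y yB.
have nB : nbhs y (B `&` c @^-1` cdom j) by apply: open_nbhs_nbhs.
have cp : {for Defs.coord j (c y), continuous (param j)}.
  by apply: param_continuous; exists (c y).
move=> P nP; have n1 : nbhs y [set x | P (param j (Defs.coord j (c x)))].
  by apply: (c0 _ (cp _ _)); rewrite coordK.
suff: nbhs y (c @^-1` P) by [].
by apply: filterS (filterI nB n1) => x [[_ /= xj]]; rewrite /= coordK.
Qed.

End ManifoldCurves.

(** * Continuity of the action and its one-parameter flows *)

Section HamiltonianActions.
Variables (R : realType) (m n : nat) (Z : kahler R m).
Local Notation M := 'M[R[i]]_n.
Local Notation E := 'rV[R]_(m + m).
Local Notation crd := (@Defs.coord R m Z).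
Implicit Types (X Y g h u xi : M) (w z : Z) (e t : R) (j : chart Z).
Variables (U : set M) (act : M -> Z -> Z).
Hypothesis HU : compact_connected_unitary U.
Hypothesis Hact : holomorphic_action U act.
Local Notation UC := (complexification U).
Local Notation uC := (complexified_lie U).

Lemma lie_uC X : lie U X -> uC X.
Proof.
move=> lX; exists X => //; exists 0; last by rewrite addr0.
by case: (rsub_iu HU).
Qed.

Lemma iu_uC X : imul (lie U) X -> uC X.
Proof.
move=> iX; exists 0; first by case: (rsub_lieU HU).
by exists X => //; rewrite add0r.
Qed.

Lemma act1 w : act 1%:M w = w.
Proof. by case: Hact. Qed.

Lemma actM g h w : UC g -> UC h -> act (g *m h) w = act g (act h w).
Proof. by case: Hact => _ H _ _ _; exact: H. Qed.

Lemma UC1 : UC 1%:M.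
Proof. by apply: (U_UC HU); case: (U_subgroup HU). Qed.

Lemma act_smooth k (X : 'I_k -> M) i : (forall a, uC (X a)) ->
  smooth_into [set y : 'rV[R]_(k + (m + m)) | cimg i (rsubmx y)]
    (fun y => act (expmx (\sum_(a < k) (lsubmx y 0 a)%:C *: X a)) (param i (rsubmx y))).
Proof.
move=> uX; case: Hact => _ _ H _ _; have := H k X 1%:M i uX UC1.
by under [in X in smooth_into _ X]eq_fun do rewrite mulmx1 expmxE.
Qed.

(** Smoothness is read in the coordinates of an orthonormal basis of S, which turns it into joint
    continuity in X and in the point. It is applied with S = u and S = iu. *)
Lemma act_exp_continuous (S : set M) X0 w (A : set Z) : rsub S -> S `<=` uC -> S X0 ->
  nbhs (act (expmx X0) w) A -> exists d : R, exists B : set Z, [/\ 0 < d, nbhs w B &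
    forall X w', S X -> fro (X - X0) < d -> B w' -> A (act (expmx X) w')].
Proof.
move=> rS SuC SX0 nA; have [k [X [SX oX HX]]] := orthonormal_basis rS.
have [i iw] := cdom_cover w.
pose c (y : 'rV[R]_(k + (m + m))) : Z :=
  act (expmx (\sum_(a < k) (lsubmx y 0 a)%:C *: X a)) (param i (rsubmx y)).
pose emb Y (x : E) : 'rV[R]_(k + (m + m)) := row_mx (\row_a dot Y (X a)) x.
have cE Y w' : S Y -> cdom i w' -> c (emb Y (crd i w')) = act (expmx Y) w'.
  move=> SY iw'; rewrite /c row_mxKl row_mxKr coordK //; congr (act (expmx _) _).
  by rewrite [RHS]HX //; apply: eq_bigr => a _; rewrite mxE.
have cc : {for emb X0 (crd i w), continuous c}.
  apply: (smooth_into_continuous (act_smooth i (fun a => SuC _ (SX a)))).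
  by rewrite /= row_mxKr; exists w.
have : nbhs (emb X0 (crd i w)) (c @^-1` A) by apply: cc; rewrite cE.
move=> /nbhs_ballP [d /= d0 Hd].
exists d, (cdom i `&` (crd i) @^-1` (ball (crd i w) d)); split=> //.
  apply: filterI; first by apply: open_nbhs_nbhs; split=> //; exact: cdom_open.
  by have := Defs.coord_continuous iw; apply; exact: nbhsx_ballx.
move=> Y w' SY Yd [iw' wd]; rewrite -cE //; apply: Hd; split=> // a b.
rewrite /emb; case: (split_ordP b) => b' ->; last by rewrite !row_mxEr; case: wd => _; exact.
rewrite !row_mxEl !mxE /ball /= -dotBl.
rewrite (le_lt_trans (dot_norm_le _ _)) // orthonormal_fro // mulr1 fro_distC //.
Qed.

(** By [lie_exp_surj], an element of U near u is exp (eta) u with eta small in the Lie algebra. *)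
Lemma act_U_continuous u w (A : set Z) : U u -> nbhs (act u w) A ->
  exists2 d, 0 < d & forall u', U u' -> fro (u' - u) < d -> A (act u' w).
Proof.
move=> Uu nA.
have [|d1 [B [d10 nB HB]]] := @act_exp_continuous (lie U) 0 (act u w) A (rsub_lieU HU) lie_uC (rsub_lieU HU).1.
  by rewrite expmx0 act1.
have [d d0 Hd] := lie_exp_surj (U_subgroup HU) (U_unitary HU) (U_compact HU) d10.
exists d => // u' Uu' u'u.
have uu := U_unitary HU Uu.
have Uv : U (u' *m adj u).
  case: (U_subgroup HU) => _ _ UM UI; apply: UM => //.
  by rewrite -adj_def -invmx_unitary //; exact: UI.
have [|eta [leta eta1 etaE]] := Hd _ Uv.
  rewrite -(unitary_adj uu) -mulmxBl fro_unitr ?adj_unitary //.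
have -> : act u' w = act (expmx eta) (act u w).
  by rewrite etaE -(actM _ (U_UC HU Uv) (U_UC HU Uu)) -mulmxA unitary_adjl // mulmx1.
apply: HB => //; first by rewrite subr0.
exact: nbhs_singleton.
Qed.

Lemma act_continuous g0 w (A : set Z) : UC g0 -> nbhs (act g0 w) A ->
  exists2 d, 0 < d & forall g, UC g -> fro (g - g0) < d -> A (act g w).
Proof.
move=> /UCP [X0 [u0 [iX0 Uu0 ->]]]; rewrite (actM _ (iu_UC HU iX0) (U_UC HU Uu0)) => nA.
have [d1 [B [d10 nB HB]]] := act_exp_continuous (rsub_iu HU) iu_uC iX0 nA.
have [d2 d20 Hd2] := act_U_continuous Uu0 nB.
have d120 : 0 < Num.min d1 d2 by rewrite lt_min d10.
(* Adjoints turn exp (X) u into the form unitary times exp X. The exponential factor is handled by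
   [act_exp_continuous], the unitary one by [act_U_continuous]. *)
have [d d0 Hd] := polar_continuous (adj_unitary (U_unitary HU Uu0)) (iu_hermx HU iX0) d120.
exists d => // g /UCP [X [u [iX Uu ->]]] gd.
rewrite (actM _ (iu_UC HU iX) (U_UC HU Uu)).
have [] := Hd (adj u) X (adj_unitary (U_unitary HU Uu)) (iu_hermx HU iX).
  rewrite -(hermx_expmx (iu_hermx HU iX)) -(hermx_expmx (iu_hermx HU iX0)) -!adjM -adjB fro_adj //.
rewrite !lt_min -adjB fro_adj => /andP[_ u2] /andP[X1 _].
by apply: HB => //; exact: Hd2.
Qed.

Lemma act_limit h w w' : UC h ->
  (forall e, 0 < e -> exists g, [/\ UC g, fro (g - h) < e & act g w = w']) ->
  act h w = w'.
Proof.
move=> UCh H; apply: (@mhausdorff R m Z) => A B nA nB.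
have [d d0 Hd] := act_continuous UCh nA.
have [g [UCg gd gw]] := H d d0.
exists w'; split; last exact: nbhs_singleton.
by rewrite -gw; exact: Hd.
Qed.

(** In these two kinds of directions exp (t X) is plainly in U^C, and the argument flows along no
    others. *)
Definition flow_dir X := lie U X \/ imul (lie U) X.

Lemma dir_uC X : flow_dir X -> uC X.
Proof. by case=> [/lie_uC|/iu_uC]. Qed.

Lemma dirZ t X : flow_dir X -> flow_dir (t%:C *: X).
Proof.
by case=> H; [left; exact: (rsubZ t (rsub_lieU HU) H) | right; exact: (rsubZ t (rsub_iu HU) H)].
Qed.

Lemma dir_UC X : flow_dir X -> UC (expmx X).
Proof. by case=> [/lie_expmx /(U_UC HU)|/(iu_UC HU)]. Qed.

Lemma dir_UCZ t X : flow_dir X -> UC (expmx (t%:C *: X)).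
Proof. by move=> /(dirZ t) /dir_UC. Qed.

Definition flow X w (t : R) : Z := act (expmx (t%:C *: X)) w.

Lemma flow0 X w : flow X w 0 = w.
Proof. by rewrite /flow scale0r expmx0 act1. Qed.

Lemma flowD X w s t : flow_dir X -> flow X w (s + t) = flow X (flow X w t) s.
Proof. by move=> dX; rewrite /flow expmxDZ actM //; exact: dir_UCZ. Qed.

Lemma flow_continuous X w t : flow_dir X -> {for t, continuous (flow X w)}.
Proof.
move=> dX P nP; have [d d0 Hd] := act_continuous (dir_UCZ t dX) nP.
have [d1 d10 Hd1] := expmx_near (t%:C *: X) d0.
suff: nbhs t (flow X w @^-1` P) by [].
have q0 : 0 < d1 / (fro X + 1) by rewrite divr_gt0 // ltr_wpDl.
apply/nbhs_ballP; exists (d1 / (fro X + 1)) => //= s st; apply: Hd; first exact: dir_UCZ.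
apply: Hd1; rewrite -scalerBl -rmorphB froZ.
move: st; rewrite /ball /= distrC ltr_pdivlMr ?ltr_wpDl //.
by have := fro_ge0 X; have := normr_ge0 (s - t); move: (fro X) `|_| => x y; nra.
Qed.

Lemma fundE X j w : fund act X j w = derive1 (fun t : R => crd j (flow X w t)) 0.
Proof. by rewrite /fund /flow; under eq_fun do rewrite expmxE. Qed.

Lemma flow_derivable X w t j : flow_dir X -> cdom j (flow X w t) ->
  exists D, is_derive t (1 : R) (fun s => crd j (flow X w s)) D.
Proof.
move=> dX jt; have [i iw] := cdom_cover w.
have sm := act_smooth i (fun _ : 'I_1 => dir_uC dX).
set B := [set y | _] in sm; set c := (fun y => _) in sm.
pose x : 'rV[R]_(1 + (m + m)) := row_mx 0 (crd i w).
pose v : 'rV[R]_(1 + (m + m)) := row_mx (const_mx 1) 0.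
have lineE (s : R) : x + s *: v = row_mx (const_mx s) (crd i w).
  rewrite /x /v scale_row_mx add_row_mx scaler0 addr0 add0r; congr row_mx.
  by apply/rowP => a; rewrite !mxE mulr1.
have cE (s : R) : c (x + s *: v) = flow X w s.
  by rewrite /c lineE row_mxKl row_mxKr coordK // big_ord1 mxE.
have [_ sB] := sm j; have [dB _] := sB 1%N.
have d0 : differentiable (fun y => crd j (c y)) (x + t *: v).
  apply: dB; split; last by rewrite /= cE.
  by rewrite /B /= lineE row_mxKr; exists w.
have := derivable_line d0.
have -> : (fun s : R => crd j (c (x + s *: v))) = (fun s => crd j (flow X w s)).
  by apply/funext => s; rewrite cE.
by move=> H; eexists; exact: H.
Qed.

Lemma flow_is_derive X w t j : flow_dir X -> cdom j (flow X w t) ->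
  is_derive t (1 : R) (fun s => crd j (flow X w s)) (fund act X j (flow X w t)).
Proof.
move=> dX jt; have [D HD] := flow_derivable dX jt.
suff -> : fund act X j (flow X w t) = D by [].
have dg : differentiable (fun s => crd j (flow X w s)) (0 + t).
  by rewrite add0r; apply/derivable1_diffP; case: HD.
have hs : is_derive (0 : R) (1 : R) (fun s : R => s + t) 1.
  by have := is_deriveD (is_derive_id (0 : R) (1 : R)) (is_derive_cst t (0 : R) (1 : R)); rewrite addr0.
have := @is_derive_comp_curve R R _ (fun s => s + t) (fun s => crd j (flow X w s))
  (fun s => crd j (flow X (flow X w t) s)) 0 1 _ hs dg.
have near0 : \forall s \near (0 : R), crd j (flow X w (s + t)) = crd j (flow X (flow X w t) s).
  by near=> s; rewrite flowD.
move=> /(_ near0) H; rewrite fundE derive1E (@derive_val _ _ _ _ _ _ _ H) add0r.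
exact: (@derive_val _ _ _ _ _ _ _ HD).
Unshelve. all: by end_near.
Qed.

End HamiltonianActions.

(** * The momentum map along flows *)

Section MomentumFlow.
Variables (R : realType) (m n : nat) (Z : kahler R m).
Local Notation M := 'M[R[i]]_n.
Local Notation E := 'rV[R]_(m + m).
Local Notation crd := (@Defs.coord R m Z).
Implicit Types (X Y g h u eta : M) (w z : Z) (e t : R) (j : chart Z).
Variables (U : set M) (act : M -> Z -> Z).
Hypothesis HU : compact_connected_unitary U.
Hypothesis Hact : holomorphic_action U act.
Local Notation UC := (complexification U).
Local Notation uC := (complexified_lie U).

Lemma flow_near_chart X w t j : flow_dir U X -> cdom j (flow act X w t) ->
  \forall s \near t, cdom j (flow act X w s).
Proof.
move=> dX jt; have := @flow_continuous R m n Z U act HU Hact X w t dX.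
by apply; apply: open_nbhs_nbhs; split=> //; exact: cdom_open.
Qed.

Lemma is_derive_flow_comp (F : Z -> R) X w t j : flow_dir U X -> cdom j (flow act X w t) ->
  differentiable (fun x => F (param j x)) (crd j (flow act X w t)) ->
  is_derive t (1 : R) (fun s => F (flow act X w s))
    ('D_(fund act X j (flow act X w t)) (fun x => F (param j x)) (crd j (flow act X w t))).
Proof.
move=> dX jt dF.
apply: (is_derive_comp_curve (g := fun s => crd j (flow act X w s))) => //.
  have := flow_near_chart dX jt; apply: filterS => s js.
  by rewrite coordK.
exact: (flow_is_derive HU Hact).
Qed.

(** As g commutes with the flow of X, the differential of its action carries the vector of X at w to
    the vector of X at g w. *)
Lemma fund_act_eq0 X g w i j : flow_dir U X -> UC g ->
  (forall t : R, g *m expmx (t%:C *: X) = expmx (t%:C *: X) *m g) ->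
  cdom i w -> cdom j (act g w) -> fund act X i w = 0 -> fund act X j (act g w) = 0.
Proof.
move=> dX UCg Xg iw jgw f0.
have flowg s : flow act X (act g w) s = act g (flow act X w s).
  by rewrite /flow -!(actM Hact) ?Xg //; exact: dir_UCZ.
pose Phi x := crd j (act g (param i x)).
have dPhi : differentiable Phi (crd i (flow act X w 0)).
  case: Hact => _ _ _ H _; have [_ /(_ 1%N) [dd _]] := (H g UCg).1 i j.
  rewrite (flow0 Hact); apply: dd; split; first by exists w.
  by rewrite /= coordK.
have jw0 : cdom i (flow act X w 0) by rewrite (flow0 Hact).
have D : is_derive (0 : R) (1 : R) (fun s => crd j (flow act X (act g w) s))
    ('D_(fund act X i (flow act X w 0)) Phi (crd i (flow act X w 0))).
  apply: (is_derive_comp_curve (g := fun s => crd i (flow act X w s))) => //.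
    have := flow_near_chart dX jw0; apply: filterS => s js.
    by rewrite /Phi coordK // flowg.
  exact: (flow_is_derive HU Hact).
rewrite fundE derive1E (@derive_val _ _ _ _ _ _ _ D).
by rewrite (deriveE _ dPhi) (flow0 Hact) f0 linear0.
Qed.

Lemma fund_flow_eq0 X w t i j : flow_dir U X -> cdom i w -> cdom j (flow act X w t) ->
  fund act X i w = 0 -> fund act X j (flow act X w t) = 0.
Proof.
move=> dX iw jt; apply: (fund_act_eq0 dX _ _ iw jt); first exact: dir_UCZ.
by move=> s; rewrite -!expmxDZ addrC.
Qed.

(** The field vanishes along the whole orbit by [fund_flow_eq0], so the coordinates are constant as
    long as the orbit stays in the chart; the group law then reaches all times. *)
Lemma fund_eq0_fixed X w j t : flow_dir U X -> cdom j w -> fund act X j w = 0 ->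
  flow act X w t = w.
Proof.
move=> dX jw f0.
have jw0 : cdom j (flow act X w 0) by rewrite (flow0 Hact).
have /nbhs_ballP [e /= e0 He] := flow_near_chart dX jw0.
have He' (s : R) : `|s| < e -> cdom j (flow act X w s).
  by move=> se; apply: He; rewrite /ball /= sub0r normrN.
have Dc (a : 'I_(m + m)) s : `|s| < e -> is_derive s (1 : R) (fun s => crd j (flow act X w s) 0 a) 0.
  move=> se; have js := He' s se.
  have dl : differentiable (fun x : E => x 0 a) (crd j (flow act X w s)).
    exact: differentiable_coord.
  have <- : 'D_(fund act X j (flow act X w s)) (fun x : E => x 0 a) (crd j (flow act X w s)) = 0.
    by rewrite (fund_flow_eq0 dX jw js f0) (deriveE _ dl) linear0.
  apply: (is_derive_comp_curve (g := fun s => crd j (flow act X w s))) => //.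
    by near=> s0.
  exact: (flow_is_derive HU Hact).
have small (s : R) : `|s| < e -> flow act X w s = w.
  move=> se; rewrite -[RHS](coordK jw) -[LHS](coordK (He' s se)); congr (param j _).
  apply/rowP => a; pose h := fun s => crd j (flow act X w s) 0 a.
  have -> : crd j w 0 a = h 0 by rewrite /h (flow0 Hact).
  have cst (x y : R) : x <= y -> `|x| < e -> `|y| < e -> h y = h x.
    move=> xy xe ye; have inxy (z : R) : x <= z <= y -> `|z| < e.
      move: xe ye; rewrite !ltr_norml => /andP[x1 x2] /andP[y1 y2] /andP[z1 z2]; lra.
    have [||c _] := @MVT_segment R h (fun _ => 0) x y xy.
    - by move=> c; rewrite in_itv /= => /andP[c1 c2]; apply: Dc; apply: inxy; rewrite !ltW.
    - apply: derivable_within_continuous => c; rewrite in_itv /= => /inxy /(Dc a) [dc _].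
      exact: dc.
    by rewrite mul0r => /eqP; rewrite subr_eq0 => /eqP.
  have [s0|/ltW s0] := leP 0 s; first by apply: cst => //; rewrite normr0.
  by symmetry; apply: cst => //; rewrite normr0.
(* The time t is cut into N + 1 steps, each short enough to remain in the chart. *)
have [N HN] : exists N : nat, `|t| < e * N.+1%:R.
  exists (Num.bound (`|t| / e)); rewrite mulrC -ltr_pdivrMr //.
  have : 0 <= `|t| / e by rewrite divr_ge0 // ltW.
  move=> /archi_boundP /lt_le_trans; apply.
  by rewrite ler_nat.
have tN : `|t / N.+1%:R| < e by rewrite normrM normfV normr_nat ltr_pdivrMr.
have iter k : flow act X w (k%:R * (t / N.+1%:R)) = w.
  elim: k => [|k IH]; first by rewrite mul0r (flow0 Hact).
  by rewrite -natr1 mulrDl mul1r (flowD HU Hact) // small // IH.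
by rewrite -[RHS](iter N.+1) mulrCA divff ?pnatr_eq0 // mulr1.
Unshelve. all: by end_near.
Qed.

Variable mu : Z -> M -> R.
Hypothesis Hmu : momentum_map U act mu.

Lemma mu_param_differentiable eta j w : lie U eta -> cdom j w ->
  differentiable (fun x => mu (param j x) eta) (crd j w).
Proof.
case: Hmu => _ H _ leta jw; have [dd _] := H eta leta j 1%N.
by apply: dd; exists w.
Qed.

Lemma mu_flow_derive X eta w t j : flow_dir U X -> lie U eta -> cdom j (flow act X w t) ->
  is_derive t (1 : R) (fun s => mu (flow act X w s) eta)
    (komega j (crd j (flow act X w t)) (fund act X j (flow act X w t))
       (fund act eta j (flow act X w t))).
Proof.
move=> dX leta jt; case: (Hmu) => _ _ <- //.
apply: (@is_derive_flow_comp (fun w => mu w eta)) => //.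
exact: mu_param_differentiable.
Qed.

Lemma mu_continuous eta w : lie U eta -> {for w, continuous (fun w => mu w eta)}.
Proof.
move=> leta; have [j jw] := cdom_cover w.
have cF : {for crd j w, continuous (fun x => mu (param j x) eta)}.
  exact/differentiable_continuous/mu_param_differentiable.
have cc : {for w, continuous (fun w' => mu (param j (crd j w')) eta)}.
  apply: (@continuous_comp _ _ _ (crd j) (fun x => mu (param j x) eta)) => //.
  exact: Defs.coord_continuous.
move=> A nA; have nA' : nbhs (mu (param j (crd j w)) eta) A by rewrite coordK.
have nj : nbhs w (cdom j) by apply: open_nbhs_nbhs; split=> //; exact: cdom_open.
have : nbhs w [set w' | A (mu (param j (crd j w')) eta)] by exact: cc.
by move=> H; apply: filterS (filterI nj H) => w' [jw'] /=; rewrite coordK.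
Qed.

Lemma komega_J_ge0 j w (v : E) : cdom j w -> 0 <= komega j (crd j w) v (Jmul v).
Proof.
move=> jw; have [->|v0] := eqVneq v 0.
  by rewrite /komega /bapp !mul0mx mxE.
by apply/ltW/kform_pos => //; exists w.
Qed.

Lemma komega_J_eq0 j w (v : E) : cdom j w -> komega j (crd j w) v (Jmul v) = 0 -> v = 0.
Proof.
move=> jw; apply: contra_eq => v0; rewrite gt_eqF //; apply: kform_pos => //.
by exists w.
Qed.

Lemma fund_i X j w : uC X -> cdom j w -> fund act ('i *: X) j w = Jmul (fund act X j w).
Proof. by case: Hact => _ _ _ _ H; exact: H. Qed.

(** The derivative along the flow is omega (v, J v) >= 0, with v the vector of X and J v that of i
    X: X generates the gradient flow of this component of mu. *)
Lemma mu_flow_mono X w : imul (lie U) X ->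
  mu w ('i *: X) <= mu (act (expmx X) w) ('i *: X).
Proof.
move=> iX; have dX : flow_dir U X by right.
have lX := iu_iu HU iX.
pose h s := mu (flow act X w s) ('i *: X).
have Dh s : exists2 D, is_derive s (1 : R) h D & 0 <= D.
  have [j js] := cdom_cover (flow act X w s).
  eexists; first exact: (mu_flow_derive dX lX js).
  by rewrite (fund_i (iu_uC HU iX) js) komega_J_ge0.
have [c [_ _]] := @mvt_derive R h (fun s => 'D_1 h s) 0 1 ltr01
  (fun s => let: ex_intro2 D HD _ := Dh s in DeriveDef (@ex_derive _ _ _ _ _ _ _ HD) erefl).
rewrite subr0 mulr1 {1 2}/h (flow0 Hact) /flow scale1r => E.
rewrite -subr_ge0 E; have [D HD D0] := Dh c.
by rewrite (@derive_val _ _ _ _ _ _ _ HD).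
Qed.

(** By the mean value theorem the squared length of the vector of X vanishes at some time c; the
    point reached then is stationary, so w is that point. *)
Lemma mu_flow_eq X w t : imul (lie U) X ->
  mu (act (expmx X) w) ('i *: X) <= mu w ('i *: X) -> flow act X w t = w.
Proof.
move=> iX Hle; have dX : flow_dir U X by right.
have lX := iu_iu HU iX.
pose h s := mu (flow act X w s) ('i *: X).
have Dh s : exists D, is_derive s (1 : R) h D.
  have [j js] := cdom_cover (flow act X w s).
  by eexists; exact: (mu_flow_derive dX lX js).
have [c [_ _]] := @mvt_derive R h (fun s => 'D_1 h s) 0 1 ltr01
  (fun s => let: ex_intro D HD := Dh s in DeriveDef (@ex_derive _ _ _ _ _ _ _ HD) erefl).
rewrite subr0 mulr1 {1 2}/h (flow0 Hact) /flow scale1r => E.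
have [j jc] := cdom_cover (flow act X w c).
have : 'D_1 h c <= 0 by rewrite -E subr_le0.
rewrite (@derive_val _ _ _ _ _ _ _ (mu_flow_derive dX lX jc)) (fund_i (iu_uC HU iX) jc) => D0.
have fc : fund act X j (flow act X w c) = 0.
  by apply: (komega_J_eq0 jc); apply/le_anti; rewrite D0 komega_J_ge0.
have fixc s : flow act X (flow act X w c) s = flow act X w c by exact: fund_eq0_fixed dX jc fc.
have wc : w = flow act X w c.
  by rewrite -(fixc (- c)) -(flowD HU Hact) // addNr (flow0 Hact).
rewrite wc; exact: fixc.
Qed.

Lemma critical_fund_eq0 (h : Z -> R) eta z j : lie U eta -> critical_point h z ->
  (forall w, h z + (mu w eta - mu z eta) <= h w) -> cdom j z -> fund act eta j z = 0.
Proof.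
move=> leta hcrit hle jz; apply: (komega_J_eq0 jz).
(* The differential of h minus the component mu (eta) vanishes at its minimum z, and that of h by
   criticality; evaluated on v, J times the vector of eta, this leaves its squared length. *)
set v := Jmul _; set x := crd j z.
have xE : x + (0 : R) *: v = x by rewrite scale0r addr0.
have D1 : is_derive (0 : R) (1 : R) (fun s => h (param j (x + s *: v))) 0.
  by apply: (@is_derive_line R _ _ (fun y => h (param j y))); rewrite xE; exact: hcrit.
have D2 : is_derive (0 : R) (1 : R) (fun s => mu (param j (x + s *: v)) eta)
    (komega j x v (fund act eta j z)).
  case: (Hmu) => _ _ <- //.
  have := @derivable_line R _ _ (fun y => mu (param j y) eta) x v 0.
  by rewrite xE; apply; exact: mu_param_differentiable.
have := is_deriveB D1 D2; rewrite sub0r => D.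
have := is_derive_min D _; rewrite /= -/(komega _ _ _ _) => H.
apply/eqP; rewrite -oppr_eq0; apply/eqP.
rewrite /komega -kform_skew; last by exists z.
apply/eqP; rewrite -oppr_eq0; apply/eqP; apply: H => t.
rewrite !fctE xE /x coordK //.
by have := hle (param j (crd j z + t *: v)); lra.
Qed.

Lemma critical_fixed (h : Z -> R) X z t : imul (lie U) X -> critical_point h z ->
  (forall w, h z + (mu w ('i *: X) - mu z ('i *: X)) <= h w) ->
  act (expmx (t%:C *: X)) z = z.
Proof.
move=> iX hcrit hle; have [j jz] := cdom_cover z.
have dX : flow_dir U X by right.
apply: (fund_eq0_fixed (X := X) t dX jz).
have := critical_fund_eq0 (iu_iu HU iX) hcrit hle jz.
rewrite (fund_i (iu_uC HU iX) jz) /Jmul => E.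
have E1 : row_mx (- rsubmx (fund act X j z)) (lsubmx (fund act X j z)) = row_mx 0 0.
  by rewrite E row_mx0.
have [/eqP e1 e2] := eq_row_mx E1.
by rewrite -[LHS]hsubmxK e2; move: e1; rewrite oppr_eq0 => /eqP ->; rewrite row_mx0.
Qed.

End MomentumFlow.

(** * Critical points of the gradient map *)

Section Gradient.
Variables (R : realType) (n : nat) (p : set 'M[R[i]]_n) (f : 'M[R[i]]_n -> R).
Local Notation M := 'M[R[i]]_n.
Implicit Types (X Y d : M).
Hypothesis rp : rsub p.
Hypothesis fconvex : strictly_convex p f.

Lemma strictly_convex_gradient (zeta : M) : p zeta -> exists beta,
  [/\ p beta,
      forall d, p d -> is_derive (0 : R) (1 : R) (fun s : R => f (zeta + s%:C *: d)) (dot beta d)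
    & forall Y, p Y -> Y != zeta -> f zeta + dot beta (Y - zeta) < f Y].
Proof.
move=> pz; have [k [X [pX oX HX]]] := orthonormal_basis rp.
case: fconvex => fsm fpos.
pose Phi (t : 'rV[R]_k) := f (\sum_a (t 0 a)%:C *: X a).
pose co Y : 'rV[R]_k := \row_a dot Y (X a).
have coE (s : R) d : p d -> f (zeta + s%:C *: d) = Phi (co zeta + s *: co d).
  move=> pd; rewrite /Phi; congr f; rewrite {1}(HX zeta) // {1}(HX d) // scaler_sumr -big_split /=.
  by apply: eq_bigr => a _; rewrite !mxE rmorphD rmorphM scalerDl scalerA.
have sm := fsm k X pX; have dPhi x : differentiable Phi x by have [dd _] := sm 1%N; exact: dd.
have dDPhi v x : differentiable (fun y => 'D_v Phi y) x.
  by have [_ /(_ v) [dd _]] := sm 2%N; exact: dd.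
pose beta := \sum_a ('D_(delta_mx 0 a) Phi (co zeta))%:C *: X a.
have betaE d : p d -> dot beta d = 'D_(co d) Phi (co zeta).
  move=> pd; rewrite (deriveE _ (dPhi _)) (row_sum_delta (co d)) linear_sum /= dot_suml.
  by apply: eq_bigr => a _; rewrite dotZl linearZ /= mxE mulrC (deriveE _ (dPhi _)) (dotC (X a)).
have deri d s : p d -> is_derive s (1 : R) (fun s : R => f (zeta + s%:C *: d))
    ('D_(co d) Phi (co zeta + s *: co d)).
  by move=> pd; under eq_fun do rewrite coE //; exact: derivable_line.
exists beta; split; first by apply: rsub_sum => // a; exact: rsubZ.
  by move=> d pd; have := deri d 0 pd; rewrite scale0r addr0 betaE.
move=> Y pY Yz; set d := Y - zeta.
have pd : p d by exact: rsubB.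
have d0 : d != 0 by rewrite subr_eq0.
set x := co zeta in deri *; set v := co d.
pose D2 (s : R) := 'D_v (fun y => 'D_v Phi y) (x + s *: v).
have D2pos s : 0 < D2 s.
  have := fpos (zeta + s%:C *: d) d (rsubD rp pz (rsubZ _ rp pd)) pd d0.
  rewrite /hess.
  have -> : (fun s' : R => derive1 (fun t : R => f (zeta + s%:C *: d + s'%:C *: d + t%:C *: d)) 0)
      = (fun s' : R => 'D_v Phi ((x + s *: v) + s' *: v)).
    apply/funext => s'.
    have -> : (fun t : R => f (zeta + s%:C *: d + s'%:C *: d + t%:C *: d))
        = (fun t : R => Phi ((x + s *: v + s' *: v) + t *: v)).
      by apply/funext => t; rewrite -!addrA -!scalerDl -!rmorphD coE // !scalerDl !addrA.
    rewrite derive1E (@derive_val _ _ _ _ _ _ _ (derivable_line (dPhi _))).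
    by rewrite scale0r addr0.
  rewrite derive1E (@derive_val _ _ _ _ _ _ _ (derivable_line (dDPhi _ _))).
  by rewrite scale0r addr0.
(* Two mean values along the segment: f (zeta + d) - f zeta is the slope at c, and this exceeds the
   slope at 0, which is <beta, d>, by c times a positive second derivative. *)
have [c [c0 _ E1]] := mvt_derive ltr01 (fun s => deri d s pd).
have [c' [_ _ E2]] := mvt_derive c0 (fun s => derivable_line (dDPhi v (x + s *: v))).
move: E1 E2; rewrite !scale0r scale1r !addr0 subr0 mulr1 subr0 -(betaE d pd) -/v => E1 E2.
have -> : Y = zeta + d by rewrite addrC subrK.
have := mulr_gt0 (D2pos c') c0; rewrite /D2 -E2; lra.
Qed.

End Gradient.

Section AdFixed.
Variables (R : realType) (n : nat).
Local Notation M := 'M[R[i]]_n.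

(** Ad_u is an isometry, so the squared norm of Ad_u X - X is 2 (<X, X> - <X, Ad_u X>). *)
Lemma dot_Ad_fixed (u X : M) : u \is unitarymx -> dot X X <= dot X (Ad u X) -> Ad u X = X.
Proof.
move=> uu Hle; apply/eqP; rewrite -subr_eq0; apply/eqP/dot_eq0/le_anti.
rewrite dot_ge0 andbT !(dotBl, dotBr) (dot_Ad _ _ uu) (dotC (Ad u X) X).
by move: Hle; lra.
Qed.

End AdFixed.

Section CommutingPolar.
Variables (R : realType) (n : nat).
Local Notation M := 'M[R[i]]_n.
Implicit Types (X B k : M).

Lemma hermx_double_comm X B : (X + X) *m B = B *m (X + X) -> X *m B = B *m X.
Proof.
rewrite mulmxDl mulmxDr => E; have n2 : (2%:R : R[i]) != 0 by rewrite pnatr_eq0.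
by apply: (scalerI n2); rewrite !scaler_nat !mulr2n.
Qed.

(** B commutes with g and, being Hermitian, with its adjoint, hence with exp (X + X), hence with X,
    and so with k = g exp (- X). *)
Lemma polar_comm k X B : k \is unitarymx -> hermx X -> hermx B ->
  (k *m expmx X) *m B = B *m (k *m expmx X) -> X *m B = B *m X /\ k *m B = B *m k.
Proof.
move=> uk hX hB E.
have E' : adj (k *m expmx X) *m B = B *m adj (k *m expmx X).
  by have := congr1 (@adj.body R n) E; rewrite (adjM _ B) (adjM B) hB.
have XB : X *m B = B *m X.
  apply: hermx_double_comm; apply: hermx_exp_intertwine; try exact: hermxD.
  rewrite -(polar_sqr uk hX); move: (k *m expmx X) E E' => g E E'.
  by rewrite -mulmxA E mulmxA E' mulmxA.
split=> //; apply: (can_inj (mulmxK (expmx_unit X))).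
by rewrite -(mulmxA k B) -(expmx_comm XB) mulmxA E mulmxA.
Qed.

End CommutingPolar.

Section GradientMap.
Variables (R : realType) (m n : nat) (Z : kahler R m).
Local Notation M := 'M[R[i]]_n.
Implicit Types (X Y g h k eta : M) (w : Z) (t : R).
Variables (U G : set 'M[R[i]]_n) (act : 'M[R[i]]_n -> Z -> Z).
Variables (mu : Z -> 'M[R[i]]_n -> R) (mup : Z -> 'M[R[i]]_n).
Hypothesis HU : compact_connected_unitary U.
Hypothesis Hact : holomorphic_action U act.
Hypothesis Hmu : momentum_map U act mu.
Hypothesis Hequiv : Ad_star_equivariant U act mu.
Hypothesis HG : real_compatible U G.
Hypothesis Hmup : gradient_map U G mu mup.
Local Notation K := (cartanK U G).
Local Notation p := (cartanp U G).

Lemma mup_p w : p (mup w).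
Proof. by have [b []] := Hmup w. Qed.

Lemma dot_mup w eta : p eta -> dot (mup w) eta = mu w ('i *: eta).
Proof.
move=> peta; have [b [ib Hb pm /(_ eta peta)]] := Hmup w.
have hm := p_hermx HU pm; have hb := iu_hermx HU ib; have he := p_hermx HU peta.
rewrite hermx_ip //; last by rewrite /hermx adjB hm hb.
by rewrite dotBl -(hermx_ip hb he) Hb; [move=> /eqP; rewrite subr_eq0 => /eqP | case: peta].
Qed.

Lemma Ad_K k X : K k -> Ad k (Ad (invmx k) X) = X.
Proof.
move=> Kk; have uk : invmx k \in unitmx by rewrite unitmx_inv (G_unit HU HG) //; exact: K_G Kk.
by have := Ad_inv X uk; rewrite invmxK.
Qed.

Lemma K_inv k : K k -> K (invmx k).
Proof. by case: (K_subgroup HU HG) => _ _ _; exact. Qed.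

Lemma mup_act k w : K k -> mup (act k w) = Ad k (mup w).
Proof.
move=> Kk; have pk := p_Ad HU HG Kk (mup_p w).
apply/eqP; rewrite -subr_eq0; apply/eqP/dot_eq0.
suff H eta : p eta -> dot (mup (act k w)) eta = dot (Ad k (mup w)) eta.
  by rewrite dotBl H ?subrr //; exact: (rsubB (rsub_p HU HG) (mup_p _) pk).
move=> peta; have pe := p_Ad HU HG (K_inv Kk) peta.
rewrite dot_mup // -[in RHS](Ad_K eta Kk) dot_Ad ?(K_unitary HU Kk) // dot_mup //.
rewrite Hequiv ?Ad_scale //; first exact: K_U Kk.
by apply: (iu_iu HU); case: peta.
Qed.

End GradientMap.

(** * The stabilizer of a critical point *)

Section CriticalPoint.
Variables (R : realType) (m n : nat) (Z : kahler R m).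
Local Notation M := 'M[R[i]]_n.
Implicit Types (X Y g h k eta : M) (w : Z) (t e : R).
Variables (U G : set 'M[R[i]]_n) (act : 'M[R[i]]_n -> Z -> Z).
Variables (mu : Z -> 'M[R[i]]_n -> R) (mup : Z -> 'M[R[i]]_n).
Variables (f : 'M[R[i]]_n -> R) (z : Z) (beta : 'M[R[i]]_n).
Hypothesis HU : compact_connected_unitary U.
Hypothesis Hact : holomorphic_action U act.
Hypothesis Hmu : momentum_map U act mu.
Hypothesis Hequiv : Ad_star_equivariant U act mu.
Hypothesis HG : real_compatible U G.
Hypothesis Hmup : gradient_map U G mu mup.
Local Notation K := (cartanK U G).
Local Notation p := (cartanp U G).
Hypothesis f_invariant : Ad_invariant K p f.
Hypothesis z_critical : critical_point (fun w : Z => f (mup w)) z.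
Hypothesis pbeta : p beta.
Hypothesis beta_derive : forall d, p d ->
  is_derive (0 : R) (1 : R) (fun s : R => f (mup z + s%:C *: d)) (dot beta d).
Hypothesis beta_lt : forall Y, p Y -> Y != mup z -> f (mup z) + dot beta (Y - mup z) < f Y.
Local Notation UC := (complexification U).
Local Notation mupz := (mup z).
Local Notation Gz := (stabilizer act G z).
Local Notation Kz := (stabilizer act K z).

(** Otherwise Y = Ad (k^-1) mupz differs from mupz while f takes the same value there, and the
    strict inequality gives <Ad_k beta, mupz> < <beta, mupz>. *)
Lemma mupz_fixed k : K k -> dot beta mupz <= dot (Ad k beta) mupz -> Ad k mupz = mupz.
Proof.
move=> Kk Hle; have Kk' := K_inv HU HG Kk.
have pz : p mupz := mup_p Hmup z.
have E : Ad (invmx k) mupz = mupz.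
  apply/eqP/negPn/negP => ne.
  have := beta_lt (p_Ad HU HG Kk' pz) ne; rewrite (f_invariant Kk' pz) dotBr.
  rewrite -(dot_Ad beta (Ad (invmx k) mupz) (K_unitary HU Kk)) (Ad_K HU HG _ Kk).
  by move: Hle; move: (dot (Ad k beta) _) (dot beta _) (f _) => x y v; lra.
by rewrite -[in LHS]E (Ad_K HU HG).
Qed.

(** By invariance f has the same derivative at mupz along beta and along Ad_k beta, so <beta, Ad_k
    beta> = <beta, beta>. *)
Lemma beta_fixed k : K k -> Ad k mupz = mupz -> Ad k beta = beta.
Proof.
move=> Kk kz; have pk := p_Ad HU HG Kk pbeta.
apply: dot_Ad_fixed; first exact: (K_unitary HU Kk).
have D1 := beta_derive pk.
have D2 := beta_derive pbeta.
suff E : (fun s : R => f (mupz + s%:C *: Ad k beta)) = (fun s : R => f (mupz + s%:C *: beta)).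
  rewrite E in D1.
  by rewrite -(@derive_val _ _ _ _ _ _ _ D1) -(@derive_val _ _ _ _ _ _ _ D2).
apply/funext => s; have ps : p (mupz + s%:C *: beta).
  by apply: (rsubD (rsub_p HU HG) (mup_p Hmup z)); exact: (rsubZ _ (rsub_p HU HG) pbeta).
rewrite -(f_invariant Kk ps); congr f.
by rewrite [RHS]/Ad mulmxDr mulmxDl -!/(Ad k _) Ad_scale kz.
Qed.

Lemma beta_le w :
  f mupz + (mu w ('i *: beta) - mu z ('i *: beta)) <= f (mup w).
Proof.
rewrite -!(dot_mup HU Hmup _ pbeta) -dotBl dotC.
have [->|ne] := eqVneq (mup w) mupz; first by rewrite subrr dot0r addr0.
exact/ltW/beta_lt/ne/mup_p/Hmup.
Qed.

Lemma exp_beta_fixed t : act (expmx (t%:C *: beta)) z = z.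
Proof. exact: (critical_fixed HU Hact Hmu t (p_iu pbeta) z_critical beta_le). Qed.

Lemma fund_ibeta j : cdom j z -> fund act ('i *: beta) j z = 0.
Proof.
move=> jz; apply: (critical_fund_eq0 Hmu (iu_iu HU (p_iu pbeta)) z_critical beta_le jz).
Qed.

Lemma stabilizer_subgroup (H : set M) : is_subgroup H -> H `<=` UC ->
  is_subgroup (stabilizer act H z).
Proof.
move=> [H0 H1 HM HI] HUC; split.
- by move=> g [/H0].
- by split=> //; exact: (act1 Hact).
- move=> g h [Hg gz] [Hh hz]; split; first exact: HM.
  by rewrite (actM Hact _ (HUC _ Hg) (HUC _ Hh)) hz.
- move=> g [Hg gz]; split; first exact: HI.
  rewrite -[in LHS]gz -(actM Hact _ (HUC _ (HI _ Hg)) (HUC _ Hg)).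
  by rewrite mulVmx ?H0 // (act1 Hact).
Qed.

Lemma Gz_subgroup : is_subgroup Gz.
Proof. by apply: stabilizer_subgroup; [exact: G_subgroup HG | move=> g; exact: (G_UC HG)]. Qed.

Lemma Kz_subgroup : is_subgroup Kz.
Proof.
apply: stabilizer_subgroup; first exact: (K_subgroup HU HG).
by move=> k /K_G; exact: (G_UC HG).
Qed.

Lemma Kz_compact : compact Kz.
Proof.
have cK := K_compact HU HG.
apply: (subclosed_compact _ cK); last by move=> k [].
move=> k /closure_fro clk; have Kk : K k.
  apply: (closed_fro (compact_closed (@M_hausdorff R n) cK)) => e e0.
  by have [h [Kh _] hk] := clk e e0; exists h.
split=> //; apply: (act_limit HU Hact (G_UC HG (K_G Kk))) => e e0.
by have [h [Kh hz] hk] := clk e e0; exists h; split=> //; exact: (G_UC HG (K_G Kh)).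
Qed.

Lemma exp_beta_Gz t : Gz (expmx (t%:C *: beta)).
Proof.
split; last exact: exp_beta_fixed.
by apply: p_G; exact: (rsubZ t (rsub_p HU HG) pbeta).
Qed.

(* If g exp(N beta) = k_N exp X_N, then Q = k_N^-1 g = exp X_N exp(- N beta) satisfies
   exp(- N beta) Q exp(N beta) = Q^*; let N tend to infinity along a cluster point of k_N. *)
Lemma iwasawa g V (d : 'I_n -> R) : V \is unitarymx -> beta = adj V *m rdiag d *m V ->
  G g -> exists k, [/\ K k, parabolic V d (invmx k *m g) & parabolic V d (invmx g *m k)].
Proof.
move=> uV betaE Gg.
have HNs N : {kX : M * M | [/\ K kX.1, p kX.2 & g *m expmx (N%:R%:C *: beta) = kX.1 *m expmx kX.2]}.
  apply: cid; case: (G_subgroup HG) => _ _ GM _.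
  have [|k [X [Kk pX E]]] := G_polar HG (GM _ _ Gg (_ : G (expmx (N%:R%:C *: beta)))).
    by apply: p_G; exact: (rsubZ _ (rsub_p HU HG) pbeta).
  by exists (k, X).
pose kN N := (sval (HNs N)).1; pose XN N := (sval (HNs N)).2.
have KN N : K (kN N) by rewrite /kN; case: (HNs N) => kX [].
have pN N : p (XN N) by rewrite /XN; case: (HNs N) => kX [].
have EN N : g *m expmx (N%:R%:C *: beta) = kN N *m expmx (XN N).
  by rewrite /kN /XN; case: (HNs N) => kX [].
have [k Kk Hk] := compact_cluster (K_compact HU HG) KN.
have ug := G_unit HU HG Gg.
have invK h : K h -> invmx h = adj h.
  by move=> Kh; rewrite (invmx_unitary (K_unitary HU Kh)) adj_def.
have hb := p_hermx HU pbeta.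
have expV N : expmx (N%:R%:C *: beta) *m expmx ((- N%:R)%:C *: beta) = 1%:M.
  by rewrite -expmxDZ subrr scale0r expmx0.
have expVl N : expmx ((- N%:R)%:C *: beta) *m expmx (N%:R%:C *: beta) = 1%:M.
  by rewrite -expmxDZ addNr scale0r expmx0.
have QE N : invmx (kN N) *m g = expmx (XN N) *m expmx ((- N%:R)%:C *: beta).
  have -> : g = kN N *m (expmx (XN N) *m expmx ((- N%:R)%:C *: beta)).
    by rewrite mulmxA -EN -mulmxA expV mulmx1.
  by rewrite mulKmx // (G_unit HU HG) //; exact: (K_G (KN N)).
have QE' N : invmx g *m kN N = expmx (N%:R%:C *: beta) *m expmx (- XN N).
  apply: (can_inj (mulKmx ug)); rewrite (mulKVmx ug) mulmxA EN -mulmxA expmxNr.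
  by rewrite mulmx1.
exists k; split=> //.
- apply: (@parabolic_cluster R n V d uV beta betaE (fun N => invmx (kN N) *m g) _ (fro g)).
  + move=> N; rewrite QE /dilate adjM !hermx_expmx; try exact: hermxZ; try exact: (p_hermx HU (pN N)).
    by rewrite -!mulmxA expVl mulmx1.
  + by move=> N; rewrite invK // (fro_unitl _ (adj_unitary (K_unitary HU (KN N)))).
  + move=> e N e0; have ge0 : 0 < e / (fro g + 1) by rewrite divr_gt0 // ltr_wpDl.
    have [j Nj Hj] := Hk _ N ge0; exists j => //.
    rewrite -mulmxBl !invK // -adjB (le_lt_trans (froM _ _)) // fro_adj.
    move: Hj; rewrite ltr_pdivlMr ?ltr_wpDl //.
    by have := fro_ge0 g; have := fro_ge0 (kN j - k); move: (fro g) (fro _) => x y; nra.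
(* The inverse exp (N beta) exp (- X_N) of Q satisfies the same identity, with - X_N in place of
   X_N. *)
- apply: (@parabolic_cluster R n V d uV beta betaE (fun N => invmx g *m kN N) _ (fro (invmx g))).
  + move=> N; rewrite QE' /dilate adjM !hermx_expmx; try exact: hermxZ; try exact: (hermxN (p_hermx HU (pN N))).
    by rewrite !mulmxA expVl mul1mx.
  + by move=> N; rewrite (fro_unitr _ (K_unitary HU (KN N))).
  + move=> e N e0; have ge0 : 0 < e / (fro (invmx g) + 1) by rewrite divr_gt0 // ltr_wpDl.
    have [j Nj Hj] := Hk _ N ge0; exists j => //.
    rewrite -mulmxBr (le_lt_trans (froM _ _)) //.
    move: Hj; rewrite ltr_pdivlMr ?ltr_wpDl //.
    by have := fro_ge0 (invmx g); have := fro_ge0 (kN j - k); move: (fro (invmx g)) (fro _) => x y; nra.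
Qed.

Lemma mup_flow_fixed X w t : p X -> dot (mup (act (expmx X) w)) X <= dot (mup w) X ->
  act (expmx (t%:C *: X)) w = w.
Proof.
move=> pX; rewrite !(dot_mup HU Hmup _ pX) => Hle.
exact: (mu_flow_eq HU Hact Hmu t (p_iu pX) Hle).
Qed.

Lemma mup_flow_mono X w : p X -> dot (mup w) X <= dot (mup (act (expmx X) w)) X.
Proof. by move=> pX; rewrite !(dot_mup HU Hmup _ pX); exact: (mu_flow_mono HU Hact Hmu w (p_iu pX)). Qed.

(** Both polar factors of g commute with beta. The unitary one is harmless by equivariance; along
    exp (s X) the field of i beta stays zero, as it vanishes at z, and so does the derivative of
    this component of mu. *)
Lemma mu_comm_eq g : G g -> g *m beta = beta *m g ->
  mu (act g z) ('i *: beta) = mu z ('i *: beta).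
Proof.
move=> Gg gb; have [k [X [Kk pX E]]] := G_polar HG Gg.
rewrite E in gb; have [Xb kb] := polar_comm (K_unitary HU Kk) (p_hermx HU pX) (p_hermx HU pbeta) gb.
have lb := iu_iu HU (p_iu pbeta).
have dX : flow_dir U X by right; exact: p_iu pX.
have db : flow_dir U ('i *: beta) by left.
rewrite E (actM Hact); [|exact: (G_UC HG (K_G Kk))|exact: (iu_UC HU (p_iu pX))].
rewrite Hequiv //; last exact: K_U Kk.
have -> : Ad (invmx k) ('i *: beta) = 'i *: beta.
  have uk := G_unit HU HG (K_G Kk).
  by rewrite Ad_scale -[in LHS](_ : Ad k beta = beta) ?Ad_inv //; apply/Ad_comm.
pose h s := mu (flow act X z s) ('i *: beta).
have D s : is_derive s (1 : R) h 0.
  have [j js] := cdom_cover (flow act X z s); have [i iz] := cdom_cover z.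
  have := mu_flow_derive HU Hact Hmu dX lb js.
  have -> : fund act ('i *: beta) j (flow act X z s) = 0.
    apply: (fund_act_eq0 HU Hact db (dir_UCZ HU s dX) _ iz js (fund_ibeta iz)) => t.
    have Xb' : (s%:C *: X) *m (t%:C *: ('i *: beta)) = (t%:C *: ('i *: beta)) *m (s%:C *: X).
      by rewrite -!scalemxAl -!scalemxAr Xb !scalerA; congr (_ *: _); ring.
    by apply: expmx_comm; symmetry; apply: expmx_comm.
  by rewrite /komega /bapp trmx0 mulmx0 mxE.
have [c [_ _]] := mvt_derive ltr01 D.
rewrite mul0r /h (flow0 Hact) /flow scale1r => /eqP.
by rewrite subr_eq0 => /eqP.
Qed.


Variables (V : 'M[R[i]]_n) (d : 'I_n -> R).
Hypothesis uV : V \is unitarymx.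
Hypothesis betaE : beta = adj V *m rdiag d *m V.
Local Notation par := (parabolic V d).
Local Notation levi := (mxlevi V d).

Lemma levi_unit g h : par g -> par h -> g *m h = 1%:M -> levi g \in unitmx.
Proof.
move=> pg ph gh; have := leviM uV pg ph; rewrite gh (levi1 _ uV) => E.
by have [] := mulmx1_unit (esym E).
Qed.

Lemma dilate_G N g : G g -> G (dilate beta N g).
Proof.
case: (G_subgroup HG) => _ _ GM _ Gg; apply: (GM); first apply: (GM) => //.
  by case: (exp_beta_Gz (- N)).
by case: (exp_beta_Gz N).
Qed.

(** The Levi part is a limit of conjugates of g by exp (N beta), which lie in G; the parabolic
    inverse h makes it invertible, so closedness in GL(n, C) applies. *)
Lemma levi_G g h : G g -> par g -> par h -> g *m h = 1%:M -> G (levi g).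
Proof.
move=> Gg pg ph gh; apply: (G_closedGL HU HG (levi_unit pg ph gh)).
apply/closure_fro => e e0; have [N /(_ N (leqnn N)) HN] := dilate_levi uV betaE pg e0.
by exists (dilate beta N%:R g) => //; exact: dilate_G.
Qed.

Lemma act_dilate_le g k t : G g -> K k -> act g z = z -> 0 < t ->
  mu (act (dilate beta t (invmx k *m g)) z) ('i *: beta) <= dot mupz (Ad k beta).
Proof.
move=> Gg Kk gz t0; case: (G_subgroup HG) => _ _ GM _.
have uk := G_unit HU HG (K_G Kk).
have GQ : G (invmx k *m g) by apply: GM => //; exact: (K_G (K_inv HU HG Kk)).
have Gt s : G (expmx (s%:C *: beta)) by case: (exp_beta_Gz s).
have GU h : G h -> UC h := @G_UC R n U G HG h.
have pk := p_Ad HU HG Kk pbeta.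
have pX := rsubZ (- t) (rsub_p HU HG) pk.
have XE : act (expmx ((- t)%:C *: Ad k beta)) z = act k (act (dilate beta t (invmx k *m g)) z).
  rewrite -Ad_scale (Ad_expmx _ uk) /Ad -[in LHS]gz.
  have Gk := K_G Kk; have Gk' := K_G (K_inv HU HG Kk).
  have Gc := GM _ _ (Gt (- t)) GQ.
  rewrite -(actM Hact _ (GU _ (GM _ _ (GM _ _ Gk (Gt _)) Gk')) (GU _ Gg)).
  rewrite /dilate (actM Hact _ (GU _ Gc) (GU _ (Gt _))) exp_beta_fixed.
  rewrite -(actM Hact _ (GU _ Gk) (GU _ Gc)).
  by rewrite !mulmxA.
have := mup_flow_mono z pX; rewrite XE (mup_act HU Hequiv HG Hmup _ Kk) !dotZr.
rewrite (dot_Ad _ _ (K_unitary HU Kk)) (dot_mup HU Hmup _ pbeta) !mulNr lerN2.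
by rewrite ler_pM2l.
Qed.

Lemma Gz_parabolic g : Gz g -> par g.
Proof.
move=> [Gg gz]; have [k [Kk pQ pQ']] := iwasawa uV betaE Gg.
have uk := G_unit HU HG (K_G Kk); have ug := G_unit HU HG Gg.
have GQ : G (invmx k *m g).
  by case: (G_subgroup HG) => _ _ GM _; apply: GM => //; exact: (K_G (K_inv HU HG Kk)).
have QQ : (invmx k *m g) *m (invmx g *m k) = 1%:M.
  by rewrite mulmxA mulmxK // mulVmx.
have lb := iu_iu HU (p_iu pbeta).
have Gr := levi_G GQ pQ pQ' QQ.
have le1 : mu (act (levi (invmx k *m g)) z) ('i *: beta) <= dot mupz (Ad k beta).
  rewrite leNgt; apply/negP => lt1.
  have nA : nbhs (act (levi (invmx k *m g)) z) [set w | dot mupz (Ad k beta) < mu w ('i *: beta)].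
    have nV : nbhs (mu (act (levi (invmx k *m g)) z) ('i *: beta)) [set y | dot mupz (Ad k beta) < y].
      by apply: open_nbhs_nbhs; split=> //; exact: open_gt.
    exact: (mu_continuous Hmu lb nV).
  have [e e0 He] := act_continuous HU Hact (G_UC HG Gr) nA.
  (* [N.+1] because [act_dilate_le] divides by the time, which must be positive. *)
  have [N /(_ N.+1 (leqnSn N)) HN] := dilate_levi uV betaE pQ e0.
  have /= := He _ (G_UC HG (dilate_G N.+1%:R GQ)) HN.
  by rewrite ltNge act_dilate_le.
(* The Levi part commutes with beta, so the left side is <mupz, beta> and [le1] becomes the
   hypothesis of [mupz_fixed]. *)
rewrite (mu_comm_eq Gr (levi_comm uV betaE _)) -(dot_mup HU Hmup _ pbeta) in le1.
rewrite (dotC mupz beta) (dotC mupz) in le1.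
have /(Ad_comm _ uk) kb := beta_fixed Kk (mupz_fixed Kk le1).
rewrite -(mulKVmx uk g); apply: (parabolicM uV) => //.
exact: (comm_parabolic uV betaE).
Qed.

Lemma Gz_inv g : Gz g -> Gz (invmx g).
Proof. by case: Gz_subgroup => _ _ _; exact. Qed.

Lemma Gz_mulV g : Gz g -> g *m invmx g = 1%:M.
Proof. by move=> [Gg _]; rewrite mulmxV // (G_unit HU HG). Qed.

Lemma Gz_levi g : Gz g -> Gz (levi g).
Proof.
move=> gGz; have pg := Gz_parabolic gGz; have pg' := Gz_parabolic (Gz_inv gGz).
have Gl : G (levi g) by case: (gGz) => Gg _; exact: (levi_G Gg pg pg' (Gz_mulV gGz)).
split=> //; apply: (act_limit HU Hact (G_UC HG Gl)) => e e0.
have [N /(_ N (leqnn N)) HN] := dilate_levi uV betaE pg e0.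
have [Gd dz] : Gz (dilate beta N%:R g).
  case: Gz_subgroup => _ _ GM _; apply: (GM); last exact: exp_beta_Gz.
  by apply: (GM) => //; exact: exp_beta_Gz.
by exists (dilate beta N%:R g); split=> //; exact: (G_UC HG).
Qed.

(** k commutes with beta, so Ad_k fixes mupz. From exp (X) z = k^-1 z one gets mu_p (exp (X) z) =
    mupz: <mu_p, X> does not grow along the flow of X, which therefore fixes z, and then k fixes z
    too. *)
Lemma Gz_comm_polar g : Gz g -> g *m beta = beta *m g ->
  exists k X, [/\ Kz k, p X, k *m beta = beta *m k & g = k *m expmx X].
Proof.
move=> [Gg gz] gb; have [k [X [Kk pX E]]] := G_polar HG Gg.
rewrite E in gb gz; have [Xb kb] := polar_comm (K_unitary HU Kk) (p_hermx HU pX) (p_hermx HU pbeta) gb.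
exists k, X; split=> //; split=> //.
have uk := G_unit HU HG (K_G Kk).
have kz : Ad k mupz = mupz.
  by apply: mupz_fixed => //; rewrite (_ : Ad k beta = beta) //; apply/Ad_comm.
have UX := iu_UC HU (p_iu pX); have Uk := G_UC HG (K_G Kk).
have Xz : act (expmx X) z = act (invmx k) z.
  rewrite -[in RHS]gz -(actM Hact); last 2 first.
  - exact: (G_UC HG (K_G (K_inv HU HG Kk))).
  - by rewrite -E; exact: (G_UC HG Gg).
  by rewrite mulKmx.
have X1 : act (expmx X) z = z.
  rewrite -[X]scale1r; apply: (mup_flow_fixed 1 pX); rewrite Xz.
  rewrite (mup_act HU Hequiv HG Hmup _ (K_inv HU HG Kk)) -{1}kz Ad_inv //.
by rewrite (actM Hact) // X1 in gz.
Qed.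

End CriticalPoint.

(** * Maximal compactness of the identity component *)

Section IdentityComponent.
Variables (R : realType) (n : nat).
Local Notation M := 'M[R[i]]_n.
Implicit Types (A B g h k X : M) (H L : set M) (e : R).

Lemma mulmxr_continuous h : continuous (fun g : M => g *m h).
Proof.
move=> g; apply: continuous_fro => e e0; exists (e / (fro h + 1)).
  by rewrite divr_gt0 // ltr_wpDl.
move=> B; rewrite ltr_pdivlMr ?ltr_wpDl // -mulmxBl => Bg.
rewrite (le_lt_trans (froM _ _)) //.
by have := fro_ge0 h; have := fro_ge0 (B - g); move: Bg; move: (fro h) (fro _) => x y; nra.
Qed.

Lemma id_component_sub H : id_component H `<=` H.
Proof. exact: connected_component_sub. Qed.

Lemma id_component_mono H L : L `<=` H -> id_component L `<=` id_component H.
Proof. by move=> LH g [C [C1 CL cC] Cg]; exists C => //; split=> // x /CL /LH. Qed.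

(** Right translation by h sends the component to a connected set that contains 1, the image of
    h^-1. The hypothesis on [invmx h] lets one lemma serve for inverses and then for products. *)
Lemma id_component_mulr H g h : is_subgroup H -> H h -> id_component H (invmx h) ->
  id_component H g -> id_component H (g *m h).
Proof.
move=> [Hu H1 HM HI] Hh Hh' Hg.
suff S : (fun x => x *m h) @` id_component H `<=` id_component H by apply: S; exists g.
apply: connected_component_max.
- by exists (invmx h) => //; rewrite mulVmx // Hu.
- by move=> _ [x /id_component_sub Hx <-]; exact: HM.
- apply: connected_continuous_connected; first exact: component_connected.
  exact/continuous_subspaceT/mulmxr_continuous.
Qed.

Lemma id_component_subgroup H : is_subgroup H -> is_subgroup (id_component H).
Proof.
move=> sH; have [Hu H1 HM HI] := sH.
have HoI g : id_component H g -> id_component H (invmx g).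
  move=> Hg; have Hg' := id_component_sub Hg.
  rewrite -[invmx g]mul1mx; apply: id_component_mulr => //; first exact: HI.
    by rewrite invmxK.
  exact: connected_component_refl.
split=> //.
- by move=> g /id_component_sub /Hu.
- exact: connected_component_refl.
- move=> g h Hg Hh; apply: id_component_mulr => //; first exact: id_component_sub.
  exact: HoI.
Qed.

Lemma id_component_compact H : compact H -> compact (id_component H).
Proof.
move=> cH; apply: (subclosed_compact _ cH (@id_component_sub H)).
by apply: component_closed; exact: compact_closed (@M_hausdorff R n) cH.
Qed.

Lemma compact_fro_bound H : compact H -> exists C, forall g, H g -> fro g <= C.
Proof.
move=> cH; have cF : compact (@fro.body R n @` H).
  by apply: continuous_compact => //; exact/continuous_subspaceT/fro_continuous.
have [C [_ HC]] := compact_bounded cF.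
exists (C + 1) => g Hg; have := HC (C + 1) _ (fro g).
by rewrite /= ger0_norm //; apply; [rewrite ltrDl | exists g].
Qed.

Lemma within_continuous_fro H (f : M -> M) :
  (forall g e, H g -> 0 < e -> exists2 d, 0 < d &
     forall h, H h -> fro (h - g) < d -> fro (f h - f g) < e) ->
  {within H, continuous f}.
Proof.
move=> Hf; apply/subspace_continuousP => g Hg P /nbhs_fro [e e0 HP].
have [d d0 Hd] := Hf g e Hg e0.
apply/nbhs_fro; exists d => // h hg Hh; apply: HP; exact: Hd.
Qed.

(** * Retraction of a group H of parabolic matrices onto a compact L; used with H = G_z and L =
    K_z *)

Variables (V : M) (d : 'I_n -> R) (beta : M).
Hypothesis uV : V \is unitarymx.
Hypothesis betaE : beta = adj V *m rdiag d *m V.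
Local Notation par := (parabolic V d).
Local Notation levi := (mxlevi V d).

Variables H L : set M.
Hypothesis sH : is_subgroup H.
Hypothesis sL : is_subgroup L.
Hypothesis cL : compact L.
Hypothesis uL : forall k, L k -> k \is unitarymx.
Hypothesis LH : L `<=` H.
Hypothesis H_parabolic : forall g, H g -> par g.
Hypothesis H_levi : forall g, H g -> exists k X,
  [/\ L k, hermx X, k *m beta = beta *m k & levi g = k *m expmx X].

(** q takes the unitary polar factor of the Levi part. It is continuous because the Levi part is a
    contraction for [fro] and polar factors are continuous. *)
Lemma levi_retraction : exists q : M -> M,
  (forall g, H g -> exists X, [/\ L (q g), hermx X, q g *m beta = beta *m q g
     & levi g = q g *m expmx X]) /\
  {within H, continuous q}.
Proof.
have /choice [q Hq] : forall g, exists k, H g -> exists X,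
    [/\ L k, hermx X, k *m beta = beta *m k & levi g = k *m expmx X].
  (* Outside H the value g is a mere default. *)
  move=> g; have [Hg|nHg] := pselect (H g); last by exists g.
  by have [k [X HX]] := H_levi Hg; exists k => _; exists X.
exists q; split=> //; apply: within_continuous_fro => g e Hg e0.
have [X [Lk hX _ E]] := Hq g Hg.
have [r r0 Hr] := polar_continuous (uL Lk) hX e0; exists r => // h Hh hg.
have [Y [Lk' hY _ E']] := Hq h Hh.
have [] // := Hr (q h) Y (uL Lk') hY.
by rewrite -E -E'; exact: le_lt_trans (levi_fro d uV h g) hg.
Qed.

Lemma unitary_H_comm g : H g -> g \is unitarymx -> g *m beta = beta *m g.
Proof.
move=> Hg ug; apply: (unitary_parabolic_comm uV betaE); apply: H_parabolic => //.
by rewrite -adj_def -invmx_unitary //; case: sH => _ _ _; exact.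
Qed.

(** A unitary g in H is its own Levi part, with polar decomposition g exp 0, and polar
    decompositions are unique. *)
Lemma retraction_unitary q g X : H g -> g \is unitarymx -> L (q g) -> hermx X ->
  levi g = q g *m expmx X -> q g = g.
Proof.
move=> Hg ug Lq hX; rewrite (comm_levi uV betaE (unitary_H_comm Hg ug)).
have h0 : hermx (0 : M) by exact: adj0.
rewrite -[g in LHS]mulmx1 -expmx0 => E.
by have [] := polar_inj ug (uL Lq) h0 hX E.
Qed.

Lemma retraction_component (q : M -> M) :
  (forall g, H g -> exists X, [/\ L (q g), hermx X, q g *m beta = beta *m q g
     & levi g = q g *m expmx X]) ->
  {within H, continuous q} -> q @` id_component H `<=` id_component L.
Proof.
move=> Hq cq; have [_ H1 _ _] := sH; apply: connected_component_max.
- exists 1%:M; first exact: connected_component_refl.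
  have [X [Lq hX _ E]] := Hq _ H1.
  by apply: (retraction_unitary H1 _ Lq hX E); apply: uL; case: sL.
- by move=> _ [g /id_component_sub Hg <-]; have [X []] := Hq g Hg.
- apply: connected_continuous_connected; first exact: component_connected.
  by apply: continuous_subspaceW cq; exact: id_component_sub.
Qed.

Lemma id_component_unitary :
  id_component L = id_component H `&` [set g | g \is unitarymx].
Proof.
have [q [Hq cq]] := levi_retraction.
apply/seteqP; split=> [g Lg|g [Hg /= ug]].
  by split; [exact: id_component_mono Lg | apply: uL; exact: id_component_sub].
have Hg' := id_component_sub Hg; have [X [Lq hX _ E]] := Hq g Hg'.
by rewrite -(retraction_unitary Hg' ug Lq hX E); apply: (retraction_component Hq cq); exists g.
Qed.

(** [fro_hermx_le] applied to j X bounds j^2 times the squared norm of X uniformly in j. *)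
Lemma bounded_expmx_eq0 X C : hermx X -> (forall j : nat, fro (expmx (j%:R%:C *: X)) <= C) ->
  (forall j : nat, fro (expmx (- (j%:R%:C *: X))) <= C) -> X = 0.
Proof.
move=> hX C1 C2; apply/fro_eq0/eqP/negPn/negP => X0.
have Xp : 0 < fro X by rewrite lt_def X0 fro_ge0.
pose W := 4 * (Num.sqrt n%:R * (C + C)).
have bnd (j : nat) : j%:R ^+ 2 * fro X ^+ 2 <= W.
  have := fro_hermx_le (hermxZ j%:R hX).
  rewrite froZ normr_nat exprMn => /le_trans; apply.
  by rewrite ler_pM2l // ler_wpM2l ?sqrtr_ge0 // lerD.
have := bnd (Num.truncn (W / fro X ^+ 2)).+1; rewrite leNgt => /negP; apply.
rewrite -ltr_pdivrMr ?exprn_gt0 //; apply: (lt_le_trans (truncnS_gt _)).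
by rewrite -natrX ler_nat expnS leq_pmulr // expn_gt0.
Qed.

Lemma levi_compact_eq1 g X C : H g -> hermx X -> levi g = expmx X ->
  (forall j : nat, fro (g ^+ j) <= C) -> (forall j : nat, fro (invmx (g ^+ j)) <= C) -> g = 1%:M.
Proof.
move=> Hg hX lE C1 C2; have pg := H_parabolic Hg; have [Hu _ _ HI] := sH.
have fl A : fro (levi A) <= fro A.
  have := levi_fro d uV A 0.
  by rewrite (comm_levi uV betaE (A := 0)) ?subr0 // mul0mx mulmx0.
have Hj j : H (g ^+ j) by exact: subgroup_exp.
have lj j : levi (g ^+ j) = expmx (j%:R%:C *: X).
  elim: j => [|j IH]; first by rewrite expr0 scale0r expmx0 (levi1 _ uV).
  rewrite exprS -mulmxE (leviM uV pg (H_parabolic (Hj j))) IH lE.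
  have -> : expmx X = expmx (1%:C *: X) by rewrite scale1r.
  by rewrite -expmxDZ addrC natr1.
have X0 : X = 0.
  apply: (bounded_expmx_eq0 hX (C := C)) => j; first by rewrite -lj (le_trans (fl _)).
  have E : levi (invmx (g ^+ j)) *m levi (g ^+ j) = 1%:M.
    rewrite -(leviM uV (H_parabolic (HI _ (Hj j))) (H_parabolic (Hj j))).
    by rewrite mulVmx ?Hu // (levi1 _ uV).
  rewrite -[expmx _]mul1mx -E lj -mulmxA expmxNr mulmx1.
  exact: le_trans (fl _) (C2 j).
apply: (levi_unipotent uV pg _ C1).
by rewrite lE X0 expmx0.
Qed.

Lemma id_component_maximal_compact :
  maximal_compact_subgroup (id_component L) (id_component H).
Proof.
have [q [Hq cq]] := levi_retraction.
split; [exact: id_component_subgroup | exact: id_component_compact | exact: id_component_mono |].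
move=> L' [L'u L'1 L'M L'I] cL' L'H LL'; apply/seteqP; split=> // g L'g.
have Hg := id_component_sub (L'H _ L'g); have [X [Lk hX kb E]] := Hq g Hg.
have Lk' : id_component L (q g) by apply: (retraction_component Hq cq); exists g => //; exact: L'H.
have L'k := LL' _ Lk'; have uk := L'u _ L'k.
have sL' : is_subgroup L' by [].
(* Dividing by q g, which belongs to L', leaves an element of L' whose Levi part is exp X;
   compactness of L' bounds its powers and their inverses. *)
have L'h : L' (invmx (q g) *m g) by apply: L'M => //; exact: L'I.
have Hh := id_component_sub (L'H _ L'h).
have Hk : H (invmx (q g)) by case: sH => _ _ _ HI; apply: HI; exact: LH.
have kb' : invmx (q g) *m beta = beta *m invmx (q g).
  by apply: (can_inj (mulKmx uk)); rewrite mulmxA mulmxV // mul1mx mulmxA kb mulmxK.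
have lh : levi (invmx (q g) *m g) = expmx X.
  rewrite (leviM uV (H_parabolic Hk) (H_parabolic Hg)) (comm_levi uV betaE kb') E.
  by rewrite mulKmx.
have [C HC] := compact_fro_bound cL'.
have L'j j : L' ((invmx (q g) *m g) ^+ j) by exact: subgroup_exp.
have h1 : invmx (q g) *m g = 1%:M.
  by apply: (levi_compact_eq1 Hh hX lh) => j; apply: HC => //; exact: L'I.
have -> : g = q g by rewrite -[LHS](mulKVmx uk) h1 mulmx1.
exact: Lk'.
Qed.

End IdentityComponent.

Unset Implicit Arguments.

Theorem theorem2 (R : realType) (m n : nat) (Z : kahler R m)
    (U G : set 'M[R[i]]_n) (act : 'M[R[i]]_n -> Z -> Z)
    (mu : Z -> 'M[R[i]]_n -> R) (mup : Z -> 'M[R[i]]_n)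
    (f : 'M[R[i]]_n -> R) (z : Z)
    (Zcompact : compact [set: Z])
    (Zconnected : connected [set: Z])
    (HU : compact_connected_unitary U)
    (Hact : holomorphic_action U act)
    (Hiso : forall u, U u -> kahler_isometry (act u))
    (Hmu : momentum_map U act mu)
    (Hequiv : Ad_star_equivariant U act mu)
    (HG : real_compatible U G)
    (Hmup : gradient_map U G mu mup)
    (f_invariant : Ad_invariant (cartanK U G) (cartanp U G) f)
    (f_convex : strictly_convex (cartanp U G) f)
    (z_critical : critical_point (fun w : Z => f (mup w)) z)
    (f_extension : exists F : 'M[R[i]]_n -> R,
       [/\ forall X, cartanp U G X -> F X = f X,
           strictly_convex (imul (lie U)) F,
           Ad_invariant U (imul (lie U)) F
         & kp_compatible_at U G F (mup z)]) :
  let Gzo := id_component (stabilizer act G z) in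
  let Kzo := id_component (stabilizer act (cartanK U G) z) in
  Kzo = Gzo `&` cartanK U G /\ maximal_compact_subgroup Kzo Gzo.
Proof.
have [beta [pbeta bder blt]] := strictly_convex_gradient (rsub_p HU HG) f_convex (mup_p Hmup z).
have [V [d [uV betaE]]] := hermx_spectral (p_hermx HU pbeta).
have KG : stabilizer act (cartanK U G) z `<=` stabilizer act G z by move=> k [/K_G].
have uK k : stabilizer act (cartanK U G) z k -> k \is unitarymx.
  by move=> [Kk _]; exact: (K_unitary HU Kk).
have sG := Gz_subgroup z Hact HG; have sK := Kz_subgroup z HU Hact HG.
have cK := Kz_compact HU Hact HG (z := z).
have Hpar g : stabilizer act G z g -> parabolic V d g.
  exact: (Gz_parabolic HU Hact Hmu Hequiv HG Hmup f_invariant z_critical pbeta bder blt uV betaE).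
have Hlevi g : stabilizer act G z g -> exists k X, [/\ stabilizer act (cartanK U G) z k,
    hermx X, k *m beta = beta *m k & mxlevi V d g = k *m expmx X].
  move=> Hg; have Hl := Gz_levi HU Hact Hmu Hequiv HG Hmup f_invariant z_critical pbeta bder blt uV betaE Hg.
  have [k [X [Kk pX kb E]]] := Gz_comm_polar HU Hact Hmu Hequiv HG Hmup f_invariant pbeta blt
    Hl (levi_comm uV betaE _).
  by exists k, X; split=> //; exact: (p_hermx HU pX).
split; last exact: (id_component_maximal_compact uV betaE sG sK cK uK KG Hpar Hlevi).
apply/seteqP; split=> k Hk.
  split; first exact: id_component_mono Hk.
  by have [] := id_component_sub Hk.
rewrite (id_component_unitary uV betaE sG sK uK KG Hpar Hlevi); case: Hk => Gk Kk.
by split=> //; exact: (K_unitary HU Kk).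
Qed.
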